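(* Let $N\ge2$, $k>0$, let $\Omega_1\Subset\Omega$ be bounded open subsets of $\mathbb{R}^N$ with $\Omega$ having Lipschitz boundary, and let $\mathcal{A}$ be the family of compact subsets of $\overline{\Omega_1}$. Let $\{K_n\}_{n\in\mathbb{N}}\subset\mathcal{A}$ and $K\in\mathcal{A}$ be such that $K_n$ converges to $K$ in the Hausdorff distance as $n\to\infty$. Assume that, as $n\to\infty$, either (1) $H^1(\Omega\setminus K_n)$ converges to $H^1(\Omega\setminus K)$ in the sense of Mosco, or (2) for some $\tilde K\in\mathcal{A}$, $H^1(\Omega\setminus\partial K_n)$ converges to $H^1(\Omega\setminus\tilde K)$ in the sense of Mosco and $\partial K_n$ converges to $\tilde K$ in the Hausdorff distance. For every $n$ let $u_n\in H^1(\Omega\setminus K_n)$ be a weak solution of $$\Delta u_n+k^2u_n=0\ \text{in }\Omega\setminus K_n,\qquad\nabla u_n\cdot\nu=0\ \text{on }\partial K_n,$$ and assume that for some constant $C$ one has $\|(u_n,\nabla u_n)\|_{L^2(\Omega,\mathbb{R}^{N+1})}\le C$ for every $n$. Assume further that there are constants $p>2$ and $C_1>0$ such that for every $n\in\mathbb{N}$ $$\|u\|_{L^p(\Omega\setminus K_n)}\le C_1\|u\|_{H^1(\Omega\setminus K_n)}\quad\text{for every }u\in H^1(\Omega\setminus K_n).$$ Then, up to a subsequence, $u_n$ converges strongly in $L^2(\Omega)$ to a function $u$ which is a weak solution of $$\Delta u+k^2u=0\ \text{in }\Omega\setminus K,\qquad\nabla u\cdot\nu=0\ \text{on }\partial 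K.$$
   Context: Functions in $H^1(\Omega\setminus K)$ and their gradients are extended by $0$ on $K$; via $u\mapsto(u,\nabla u)$, $H^1(\Omega\setminus K)$ is identified with a closed subspace of $L^2(\Omega,\mathbb{R}^{N+1})$. Closed subspaces $A_n$ of a reflexive Banach space $X$ converge in the sense of Mosco to a closed subspace $A$ if: (i) whenever $x_k\in A_{n_k}$ along a subsequence and $x_k\rightharpoonup x$ weakly in $X$, then $x\in A$; (ii) for every $x\in A$ there are $x_n\in A_n$ with $x_n\to x$ strongly in $X$. Mosco convergence of $H^1(\Omega\setminus K_n)$ to $H^1(\Omega\setminus K)$ is meant as subspaces of $L^2(\Omega,\mathbb{R}^{N+1})$. Weak solution: $u\in H^1(\Omega\setminus K)$ solves $\Delta u+k^2u=0$ in $\Omega\setminus K$, $\nabla u\cdot\nu=0$ on $\partial K$ weakly if $\int_{\Omega\setminus K}\nabla u\cdot\nabla\varphi-k^2u\varphi=0$ for every $\varphi\in H^1(\Omega\setminus K)$ whose support is compactly contained in $\Omega$ (no condition is imposed on $\partial\Omega$). *)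

(* Defs.v *)
From HB Require Import structures.
From mathcomp Require Import all_boot all_order all_algebra.
From mathcomp Require Import all_classical all_reals all_analysis.
From mathcomp Require Import measurable_realfun.

Set Implicit Arguments.
Unset Strict Implicit.
Unset Printing Implicit Defensive.

Import Order.TTheory GRing.Theory Num.Theory.
Import numFieldNormedType.Exports.

Local Open Scope classical_set_scope.
Local Open Scope ring_scope.

Definition measure_mx_display : measure_display -> measure_display.
Proof. exact. Qed.

Section measurable_mx.
Context {d} {T : sigmaRingType d}.
Variables m n : nat.

Definition mx_coord (ij : 'I_m * 'I_n) (x : 'M[T]_(m, n)) : T := x ij.1 ij.2.

Definition mx_cylinders : set (set 'M[T]_(m, n)) :=
  \bigcup_ij preimage_set_system [set: 'M[T]_(m, n)] (mx_coord ij) measurable.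

Let mx_set0 : <<s mx_cylinders >> set0.
Proof. exact: sigma_algebra0. Qed.

Let mx_setC A : <<s mx_cylinders >> A -> <<s mx_cylinders >> (~` A).
Proof. exact: sigma_algebraC. Qed.

Let mx_bigcup (F : (set 'M[T]_(m, n))^nat) :
  (forall i, <<s mx_cylinders >> (F i)) ->
  <<s mx_cylinders >> (\bigcup_i (F i)).
Proof. exact: sigma_algebra_bigcup. Qed.

HB.instance Definition _ := @isMeasurable.Build (measure_mx_display d)
  'M[T]_(m, n) <<s mx_cylinders >> mx_set0 mx_setC mx_bigcup.

End measurable_mx.

Lemma measurable_mx_coord d (T : sigmaRingType d) m n (i : 'I_m) (j : 'I_n) :
  measurable_fun [set: 'M[T]_(m, n)] (fun x : 'M[T]_(m, n) => x i j).
Proof.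
move=> _ Y mY; rewrite setTI; apply: sub_sigma_algebra => /=.
by exists (i, j) => //; exists Y => //; rewrite setTI.
Qed.

Lemma measurable_fun_mxP d1 d2 (T1 : measurableType d1) (T2 : measurableType d2)
    m n (f : T1 -> 'M[T2]_(m, n)) :
  (forall i j, measurable_fun [set: T1] (fun x => f x i j)) ->
  measurable_fun [set: T1] f.
Proof.
move=> mf; apply: (@measurability _ _ _ _ _ _ (@mx_cylinders _ T2 m n)) => //.
move=> _ [_ [[i j] _ [B mB <-]] <-]; rewrite !setTI.
by have := mf i j measurableT _ mB; rewrite setTI.
Qed.

(* hence, for real entries, the sigma-algebra generated by the coordinates is
   the Borel one, the coordinates being continuous *)
Lemma measurable_mx_open (R : realType) m n (U : set 'M[R]_(m, n)) :
  open U -> measurable U.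
Proof.
move=> oU.
pose I := ('M[rat]_(m, n) * rat)%type.
pose B (q : I) : set 'M[R]_(m, n) :=
  ball (map_mx (fun x : rat => ratr x : R) q.1 : 'M[R]_(m, n)) (ratr q.2).
have mB q : 0 < ratr q.2 :> R -> measurable (B q).
  move=> q0; have -> : B q = \bigcap_(ij in [set: 'I_m * 'I_n])
      ((fun x : 'M[R]_(m, n) => x ij.1 ij.2) @^-1`
        ball (ratr (q.1 ij.1 ij.2) : R) (ratr q.2)).
    apply/seteqP; split=> [x|x xB].
      by move=> [_ xB] ij _ /=; move: (xB ij.1 ij.2); rewrite mxE.
    by split=> // i j; rewrite mxE; exact: (xB (i, j)).
  apply: fin_bigcap_measurable => [|ij _]; first exact: finite_finset.
  rewrite -[X in measurable X]setTI.
  apply: measurable_mx_coord => //.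
  by apply: open_measurable; exact: ball_open.
have -> : U = \bigcup_(q in [set q | 0 < ratr q.2 :> R /\ B q `<=` U]) B q.
  apply/seteqP; split=> [x Ux|x [q [_ qU] /qU//]].
  have /nbhs_ballP[e /= e0 eU] : nbhs x U by exact: open_nbhs_nbhs.
  have [r r0 re] : exists2 r : rat, 0 < ratr r :> R & ratr r < e / 2.
    have /rat_in_itvoo[r] : 0 < e / 2 by rewrite divr_gt0.
    by rewrite in_itv/= => /andP[? ?]; exists r.
  have [q xq] : exists q : 'M[rat]_(m, n), forall i j,
      `|x i j - ratr (q i j)| < ratr r.
    have qP i j : exists q : rat, `|x i j - ratr q| < ratr r.
      have /rat_in_itvoo[q] : x i j - ratr r < x i j by rewrite ltrBlDr ltrDl.
      rewrite in_itv/= => /andP[? ?]; exists q.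
      by rewrite gtr0_norm ?subr_gt0// ltrBlDr -ltrBlDl.
    exists (\matrix_(i, j) sval (cid (qP i j))) => i j.
    by rewrite mxE; case: cid.
  exists (q, r).
    split=> //= y [_ /= qy]; apply: eU; split=> // i j.
    have /= := qy i j; rewrite mxE /ball/= => qyij.
    rewrite (splitr e) (le_lt_trans (ler_distD (ratr (q i j)) _ _))//.
    by rewrite ltrD// (lt_trans _ re).
  by split=> //= i j; rewrite mxE /ball/= distrC.
rewrite bigcup_mkcond; apply: countable_bigcupT_measurable => //.
by move=> q; case: ifPn => //; rewrite inE => -[q0 _]; exact: mB.
Qed.

Section lebesgue_cons.
Context {R : realType} {n : nat}.

Definition rV_cons (p : R * 'rV[R]_n) : 'rV[R]_n.+1 :=
  row_mx (const_mx p.1 : 'rV_1) p.2.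

Lemma rV_cons0 p : rV_cons p ord0 ord0 = p.1.
Proof.
rewrite /rV_cons mxE; case: splitP => [j _|k /= /eqP//]; by rewrite mxE.
Qed.

Lemma rV_consS p i : rV_cons p ord0 (lift ord0 i) = p.2 ord0 i.
Proof.
rewrite /rV_cons mxE; case: splitP => [j /= |k /= [ik]].
  by rewrite ord1.
by congr (p.2 _ _); apply/val_inj.
Qed.

Lemma measurable_rV_cons : measurable_fun [set: measurableTypeR R * 'rV[R]_n] rV_cons.
Proof.
apply: measurable_fun_mxP => i j; rewrite (ord1 i).
have [k ->|->] := unliftP ord0 j.
  rewrite (_ : (fun _ => _) = (fun x : 'rV[R]_n => x ord0 k) \o snd).
    by apply: measurableT_comp => //; exact: measurable_mx_coord.
  by apply/funext => p; rewrite rV_consS.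
rewrite (_ : (fun _ => _) = fst); first exact: measurable_fst.
by apply/funext => p; rewrite rV_cons0.
Qed.

Variable mu : {sigma_finite_measure set 'rV[R]_n -> \bar R}.

Definition lebesgue_cons : set 'rV[R]_n.+1 -> \bar R :=
  pushforward (@lebesgue_measure R \x mu)%E rV_cons.

HB.instance Definition _ := Measure.copy lebesgue_cons
  (measure_function_pushforward__canonical__measure_function_Measure
    (@lebesgue_measure R \x mu)%E measurable_rV_cons).

Let lebesgue_cons_sigma_finite : sigma_finite setT lebesgue_cons.
Proof.
have /sigma_finiteP[F [TF ndF Foo]] := sigma_finiteT (@lebesgue_measure R).
have /sigma_finiteP[G [TG ndG Goo]] := sigma_finiteT mu.
pose E k : set 'rV[R]_n.+1 :=
  [set x | F k (x ord0 ord0) /\ G k (\row_i x ord0 (lift ord0 i))].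
have rV_consE k : rV_cons @^-1` E k = F k `*` G k.
  have rowE (p : R * 'rV[R]_n) : \row_i rV_cons p ord0 (lift ord0 i) = p.2.
    by apply/rowP => i; rewrite mxE rV_consS.
  by apply/seteqP; split=> -[x y]; rewrite /E /= rV_cons0 rowE.
exists E.
  apply/seteqP; split=> [x _|//].
  have [i _ Fi] : (\bigcup_i F i) (x ord0 ord0) by rewrite -TF.
  have [j _ Gj] : (\bigcup_i G i) (\row_i x ord0 (lift ord0 i)) by rewrite -TG.
  exists (maxn i j) => //; split.
    by move: Fi; exact/subsetPset/ndF/leq_maxl.
  by move: Gj; exact/subsetPset/ndG/leq_maxr.
move=> k; have [mF Fk] := Foo k; have [mG Gk] := Goo k; split.
  apply: measurableI; rewrite -[X in measurable X]setTI.
    exact: measurable_mx_coord.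
  have /(_ measurableT _ mG) : measurable_fun setT
      (fun x : 'rV[R]_n.+1 => \row_i x ord0 (lift ord0 i)) => //.
  apply: measurable_fun_mxP => i j.
  by under eq_fun do rewrite mxE; exact: measurable_mx_coord.
rewrite /lebesgue_cons /pushforward rV_consE product_measure1E//.
by rewrite lte_mul_pinfty// ge0_fin_numE.
Qed.

HB.instance Definition _ := Measure_isSigmaFinite.Build _ _ _ lebesgue_cons
  lebesgue_cons_sigma_finite.

End lebesgue_cons.

Fixpoint lebesgue_rV (R : realType) (n : nat) :
    {sigma_finite_measure set 'rV[R]_n -> \bar R} :=
  match n with
  | 0 => @dirac _ 'rV[R]_0 0 R
  | n.+1 => lebesgue_cons (lebesgue_rV R n)
  end.

Lemma lebesgue_rV_box (R : realType) n (a b : 'rV[R]_n) :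
  (forall i, a ord0 i <= b ord0 i) ->
  lebesgue_rV R n [set x | forall i, x ord0 i \in `[a ord0 i, b ord0 i]]
  = (\prod_i (b ord0 i - a ord0 i))%:E.
Proof.
elim: n a b => [|n IH] a b ab.
  by rewrite big_ord0 /= diracE mem_set// => -[].
rewrite big_ord_recl /= /lebesgue_cons /pushforward.
pose a' : 'rV[R]_n := \row_i a ord0 (lift ord0 i).
pose b' : 'rV[R]_n := \row_i b ord0 (lift ord0 i).
rewrite [X in (_ \x _)%E X](_ : _ = `[a ord0 ord0, b ord0 ord0]%classic `*`
    [set x : 'rV[R]_n | forall i, x ord0 i \in `[a' ord0 i, b' ord0 i]]); last first.
  apply/seteqP; split=> [p /= pab|p /= [p1 p2] i].
    split; first by have := pab ord0; rewrite rV_cons0.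
    by move=> i; have := pab (lift ord0 i); rewrite rV_consS !mxE.
  have [k ->|->] := unliftP ord0 i; last by rewrite rV_cons0.
  by rewrite rV_consS; have := p2 k; rewrite !mxE.
rewrite product_measure1E//; last first.
  rewrite (_ : mkset _ = \bigcap_(i in [set: 'I_n])
      (fun x : 'rV[R]_n => x ord0 i) @^-1` `[a' ord0 i, b' ord0 i]%classic).
    apply: fin_bigcap_measurable => [|i _]; first exact: finite_finset.
    rewrite -[X in measurable X]setTI.
    by apply: measurable_mx_coord => //; exact: measurable_itv.
  by apply/seteqP; split=> [x xab i _|x xab i]; [exact: xab|exact: (xab i)].
rewrite IH => [|i]; last by rewrite !mxE.
rewrite EFinM; congr (_ * _)%E.
  apply: (etrans (lebesgue_measure_itv `[a ord0 ord0, b ord0 ord0])).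
  rewrite /= lte_fin; case: ltgtP (ab ord0) => // ->.
  by rewrite subrr.
by congr EFin; apply: eq_bigr => i _; rewrite !mxE.
Qed.

Section mosco.
Context {R : realType} {E : lmodType R}.
(* [X] with the seminorm [nrm] stands for the Banach space obtained by
   identifying [x] and [y] when [nrm (x - y) = 0]; subspaces of that space are
   represented by their saturated preimages in [X] *)
Variables (X : set E) (nrm : E -> R).

(* only the values of [l] on [X] matter *)
Definition continuous_functional (l : E -> R) :=
  (forall (a : R) x y, X x -> X y -> l (a *: x + y) = a * l x + l y) /\
  (exists C : R, forall x, X x -> `|l x| <= C * nrm x).

Definition weak_cvg (x_ : nat -> E) (x : E) :=
  forall l, continuous_functional l -> l (x_ n) @[n --> \oo] --> l x.

Definition strong_cvg (x_ : nat -> E) (x : E) :=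
  nrm (x_ n - x) @[n --> \oo] --> 0.

Definition mosco_cvg (A_ : nat -> set E) (A : set E) :=
  (forall (s : nat -> nat) (x_ : nat -> E) (x : E),
     {homo s : i j / (i < j)%N} -> (forall j, A_ (s j) (x_ j)) -> X x ->
     weak_cvg x_ x -> A x) /\
  (forall x, A x ->
     exists2 x_ : nat -> E, (forall n, A_ n (x_ n)) & strong_cvg x_ x).

End mosco.

Section euclidean.
Context {R : realType} {n : nat}.
Implicit Types (x y : 'rV[R]_n) (A B : set 'rV[R]_n).

Definition dot x y : R := \sum_i x ord0 i * y ord0 i.

(* the norm [`|x|] of the library is the sup norm *)
Definition enorm x : R := Num.sqrt (dot x x).

Definition boundary A := closure A `\` A°.

Definition edist_set x A : \bar R :=
  ereal_inf [set (enorm (x - y))%:E | y in A].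

(* the outer [maxe 0] makes the distance of the empty set to itself 0;
   the distance of the empty set to a nonempty set is [+oo] *)
Definition hausdorff_dist A B : \bar R :=
  maxe 0%E (maxe (ereal_sup [set edist_set x B | x in A])
                 (ereal_sup [set edist_set y A | y in B])).

Definition hausdorff_cvg (A_ : nat -> set 'rV[R]_n) A :=
  hausdorff_dist (A_ j) A @[j --> \oo] --> 0%E.

(* near each boundary point, in suitable Cartesian coordinates [z], [A] lies
   below the graph of a Lipschitz function of the coordinates [z_j], [j != i] *)
Definition lipschitz_boundary A :=
  forall x, boundary A x ->
    exists (r : R) (Q : 'M[R]_n) (i : 'I_n) (psi : 'rV[R]_n.-1 -> R),
      [/\ 0 < r, Q *m Q^T = 1%:M, lipschitz psi &
        forall y, enorm (y - x) < r ->
          let z := (y - x) *m Q in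
          A y <-> z ord0 i < psi (col' i z)].

Definition compactly_contained A B := compact (closure A) /\ closure A `<=` B.

End euclidean.

Section sobolev.
Context {R : realType} {N : nat}.
Local Notation T := 'rV[R]_N.
Local Notation mu := (lebesgue_rV R N).

Definition ext0 (V : zmodType) (D : set T) (f : T -> V) : T -> V :=
  patch (fun=> 0) D f.

Definition Lp_norm (D : set T) (p : R) (f : T -> R) : \bar R :=
  Lnorm mu p%:E (EFin \o ext0 D f).

Definition L2 m (D : set T) : set (T -> 'rV[R]_m) :=
  [set F | forall i, ext0 D (fun x => F x ord0 i) \in Lfun mu 2%:E].

Definition L2_norm m (D : set T) (F : T -> 'rV[R]_m) : R :=
  fine (Lp_norm D 2 (enorm \o F)).

Definition partial (i : 'I_N) (f : T -> R) : T -> R :=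
  fun x => 'D_(delta_mx ord0 i) f x.

Definition smooth (f : T -> R) :=
  forall (s : seq 'I_N) x, differentiable (foldr partial f s) x.

Definition test_function (U : set T) (f : T -> R) :=
  [/\ smooth f, compact (closure [set x | f x != 0]) &
      closure [set x | f x != 0] `<=` U].

Definition weak_gradient (U : set T) (u : T -> R) (Du : T -> 'rV[R]_N) :=
  forall i phi, test_function U phi ->
    \int[mu]_(x in U) (u x * partial i phi x) =
    - \int[mu]_(x in U) (Du x ord0 i * phi x).

(* the function [(u, Du)] with values in R^(N+1) *)
Definition graph (u : T -> R) (Du : T -> 'rV[R]_N) : T -> 'rV[R]_N.+1 :=
  fun x => rV_cons (u x, Du x).

(* [u] belongs to H^1(U) and has weak gradient [Du]; the values of [u] and [Du]
   outside of [U] are irrelevant *)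
Definition H1 (U : set T) (u : T -> R) (Du : T -> 'rV[R]_N) :=
  L2 U (graph u Du) /\ weak_gradient U u Du.

Definition H1_norm (U : set T) (u : T -> R) (Du : T -> 'rV[R]_N) : R :=
  L2_norm U (graph u Du).

(* H^1(Omega \ K) as a subspace of L^2(Omega, R^(N+1)): functions and their
   gradients are extended by 0 on [K] *)
Definition H1_subspace (Omega K : set T) : set (T -> 'rV[R]_N.+1) :=
  [set F | L2 Omega F /\
    exists u Du, H1 (Omega `\` K) u Du /\
      {ae mu, forall x, Omega x -> F x = ext0 (Omega `\` K) (graph u Du) x}].

Definition mosco_H1 (Omega : set T) (K_ : nat -> set T) (K : set T) :=
  mosco_cvg (@L2 N.+1 Omega) (L2_norm Omega)
    (fun n => H1_subspace Omega (K_ n)) (H1_subspace Omega K).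

(* support of the a.e. class of a function defined on [D], a closed subset of
   the whole space *)
Definition ess_support (D : set T) (f : T -> R) : set T :=
  [set x | forall V, open V -> V x ->
    ~ {ae mu, forall y, V y -> D y -> f y = 0}].

Definition weak_solution (Omega K : set T) (k : R)
    (u : T -> R) (Du : T -> 'rV[R]_N) :=
  H1 (Omega `\` K) u Du /\
  forall phi Dphi, H1 (Omega `\` K) phi Dphi ->
    compactly_contained (ess_support (Omega `\` K) phi) Omega ->
    \int[mu]_(x in Omega `\` K)
      (dot (Du x) (Dphi x) - k ^+ 2 * u x * phi x) = 0.

End sobolev.

(* Main.v *)
(** A subsequence of (u_n, grad u_n), extended by 0, converges weakly in L^2, and
    by Mosco convergence its limit is (v, grad v) with v in H^1(Omega \ L), where
    L = K in case (1) and L = Kt in case (2).  Hausdorff convergence yields, in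
    case (2), that K \ Kt is open and that each of its points lies in K_n for all
    large n, so that v vanishes there and functions of H^1(Omega \ K) extended by 0
    belong to H^1(Omega \ Kt).

    Strong convergence: compact subsets of Omega \ L eventually avoid the
    approximating sets, so Rellich's theorem applies to cutoffs of the u_n.  The
    remainder is controlled by the uniform L^p bound, p > 2, once the measure of
    the complement of the cutoff in Omega \ K_n is small; the part carried by L
    is small because Mosco convergence also applies to the pairs (1, 0): the weak
    limits of the indicator functions of Omega \ L_n, with L_n = K_n in case (1)
    and L_n = boundary K_n in case (2), vanish a.e. on L.

    Weak equation: a test function phi is approximated through Mosco convergence
    by phi_n in H^1(Omega \ L_n); then chi phi_n, with a smooth cutoff chi equal
    to 1 on the support of phi, is admissible for u_n, and one passes to the limit
    in the pairing of a weakly and a strongly convergent sequence. *)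

Require Import Defs.
From mathcomp Require Import all_boot all_order all_algebra.
From mathcomp Require Import all_classical all_reals all_analysis.
From mathcomp Require Import measurable_realfun.
From mathcomp Require Import ring lra.

Set Implicit Arguments.
Unset Strict Implicit.
Unset Printing Implicit Defensive.

Import Order.TTheory GRing.Theory Num.Theory.
Import numFieldNormedType.Exports.

Local Open Scope classical_set_scope.
Local Open Scope ring_scope.

(** No regularity is asked of the obstacles, so there is no extension operator and no compact
    embedding uniform in n: mass of [u_n] could concentrate near the moving sets. Higher
    integrability forbids this only where a cutoff leaves out a region of small measure, and
    Hausdorff convergence does not provide such smallness when the limit obstacle has positive
    measure; hence the recourse to the Mosco condition for a sequence that has nothing to do with
    the equation. Both alternatives are instances of one statement about closed sets [L_n] inside
    [K_n] and [L] inside [K] with open differences. The cutoff chi is applied to the approximants of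
    phi because Mosco convergence gives no control on supports; that it leaves phi and its gradient
    unchanged follows from uniqueness of weak gradients. Rellich's theorem is proved for sequences
    already weakly null: averages over small cubes tend to 0 pointwise, and the gradient controls
    the distance to the averages. The L^2 theory works with a semidefinite form, to match the
    seminormed formulation of Mosco convergence. *)

(* [ip] need not be definite and only its values on [X] matter, so that L^2 can
   be handled with functions instead of a.e. classes. *)
Record hilbert_on (R : realType) (E : lmodType R) (X : set E)
    (ip : E -> E -> R) : Prop := {
  hilbert0 : X 0 ;
  hilbertP : forall a x y, X x -> X y -> X (a *: x + y) ;
  hilbertC : forall x y, X x -> X y -> ip x y = ip y x ;
  hilbert_linear : forall a x y z, X x -> X y -> X z ->
    ip (a *: x + y) z = a * ip x z + ip y z ;
  hilbert_ge0 : forall x, X x -> 0 <= ip x x ;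
  hilbert_complete : forall x_ : nat -> E, (forall n, X (x_ n)) ->
    (forall e : R, 0 < e -> exists n0, forall m n, (n0 <= m)%N -> (n0 <= n)%N ->
       ip (x_ m - x_ n) (x_ m - x_ n) <= e) ->
    exists2 x, X x & ip (x_ n - x) (x_ n - x) @[n --> \oo] --> (0 : R) }.

Lemma natSinv_lt (R : realType) (e : R) : 0 < e ->
  exists n0, forall n, (n0 <= n)%N -> n.+1%:R^-1 < e.
Proof.
move=> e0; have /cvgrPdistC_lt/(_ _ e0)[n0 _ n0P] := @cvg_harmonic R.
by exists n0 => n /n0P /=; rewrite subr0 ger0_norm// invr_ge0.
Qed.

(** * Weak compactness in Hilbert spaces *)

Section hilbert_theory.
Context {R : realType} {E : lmodType R} {X : set E} {ip : E -> E -> R}.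
Hypothesis H : hilbert_on X ip.
Implicit Types (x y z : E) (a : R).

Lemma hilbertD x y : X x -> X y -> X (x + y).
Proof. by move=> Xx Xy; rewrite -[x]scale1r; apply: (hilbertP H). Qed.

Lemma hilbertZ a x : X x -> X (a *: x).
Proof. by move=> Xx; rewrite -[_ *: _]addr0; apply: (hilbertP H) => //; apply: hilbert0 H. Qed.

Lemma hilbertB x y : X x -> X y -> X (x - y).
Proof. by move=> Xx Xy; rewrite -scaleN1r addrC; apply: (hilbertP H). Qed.

Lemma ipDl x y z : X x -> X y -> X z -> ip (x + y) z = ip x z + ip y z.
Proof. by move=> Xx Xy Xz; rewrite -[x]scale1r (hilbert_linear H)// scale1r mul1r. Qed.

Lemma ip0l z : X z -> ip 0 z = 0.
Proof.
move=> Xz; have X0 := hilbert0 H; have := ipDl X0 X0 Xz.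
by rewrite addr0 => /eqP; rewrite -subr_eq0 opprD addNKr oppr_eq0 => /eqP.
Qed.

Lemma ipZl a x z : X x -> X z -> ip (a *: x) z = a * ip x z.
Proof.
move=> Xx Xz; have X0 := hilbert0 H.
by rewrite -[a *: x]addr0 (hilbert_linear H)// ip0l// addr0.
Qed.

Lemma ipBl x y z : X x -> X y -> X z -> ip (x - y) z = ip x z - ip y z.
Proof.
by move=> Xx Xy Xz; rewrite -scaleN1r addrC (hilbert_linear H)// mulN1r addrC.
Qed.

Lemma ipDr x y z : X x -> X y -> X z -> ip z (x + y) = ip z x + ip z y.
Proof.
move=> Xx Xy Xz; rewrite (hilbertC H)//; last exact: hilbertD.
by rewrite ipDl// !(hilbertC H (y := z)).
Qed.

Lemma ipBr x y z : X x -> X y -> X z -> ip z (x - y) = ip z x - ip z y.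
Proof.
move=> Xx Xy Xz; rewrite (hilbertC H)//; last exact: hilbertB.
by rewrite ipBl// !(hilbertC H (y := z)).
Qed.

Lemma ipZr a x z : X x -> X z -> ip z (a *: x) = a * ip z x.
Proof.
move=> Xx Xz; rewrite (hilbertC H)//; last exact: hilbertZ.
by rewrite ipZl// (hilbertC H).
Qed.

Lemma ip_sqrD x y : X x -> X y ->
  ip (x + y) (x + y) = ip x x + 2 * ip x y + ip y y.
Proof.
move=> Xx Xy; have Xxy := hilbertD Xx Xy.
by rewrite ipDl// !ipDr// (hilbertC H Xy Xx); ring.
Qed.

Lemma ip_sqrB x y : X x -> X y ->
  ip (x - y) (x - y) = ip x x - 2 * ip x y + ip y y.
Proof.
move=> Xx Xy; have Xxy := hilbertB Xx Xy.
by rewrite ipBl// !ipBr// (hilbertC H Xy Xx); ring.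
Qed.

Lemma ip_sqrBZ a x y : X x -> X y ->
  ip (x - a *: y) (x - a *: y) = ip x x - 2 * a * ip x y + a ^+ 2 * ip y y.
Proof.
move=> Xx Xy; have Xay := hilbertZ a Xy; rewrite ip_sqrB// ipZr// ipZl//.
by rewrite ipZr//; ring.
Qed.

Lemma ip_CauchySchwarz x y : X x -> X y -> ip x y ^+ 2 <= ip x x * ip y y.
Proof.
move=> Xx Xy; have p0 := hilbert_ge0 H Xx; have q0 := hilbert_ge0 H Xy.
have Q a : 0 <= ip x x - 2 * a * ip x y + a ^+ 2 * ip y y.
  by rewrite -ip_sqrBZ//; apply: (hilbert_ge0 H); apply/hilbertB/hilbertZ.
have [q00|qn0] := eqVneq (ip y y) 0.
  (* The form may be degenerate at a nonzero [y]. If [ip x y] were nonzero, [Q], now affine in [a],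
     would assert 0 <= -1 at this value. *)
  have := Q ((ip x x + 1) / 2 / ip x y).
  have [->|c0] := eqVneq (ip x y) 0; first by rewrite expr0n mulr_ge0.
  rewrite q00 mulr0 addr0.
  have -> : ip x x - 2 * ((ip x x + 1) / 2 / ip x y) * ip x y = -1 by field.
  by lra.
have qp : 0 < ip y y by rewrite lt_neqAle eq_sym qn0.
have := Q (ip x y / ip y y); rewrite -(pmulr_rge0 _ qp).
have -> : ip y y * (ip x x - 2 * (ip x y / ip y y) * ip x y +
    (ip x y / ip y y) ^+ 2 * ip y y) = ip x x * ip y y - ip x y ^+ 2 by field.
by rewrite subr_ge0.
Qed.

Lemma ip_le_sqrt x y : X x -> X y ->
  `|ip x y| <= Num.sqrt (ip x x) * Num.sqrt (ip y y).
Proof.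
move=> Xx Xy; rewrite -sqrtrM ?(hilbert_ge0 H)// -sqrtr_sqr ler_wsqrtr//.
exact: ip_CauchySchwarz.
Qed.

Lemma ip_triangle x y : X x -> X y ->
  Num.sqrt (ip (x + y) (x + y)) <= Num.sqrt (ip x x) + Num.sqrt (ip y y).
Proof.
move=> Xx Xy; have s0 := addr_ge0 (sqrtr_ge0 (ip x x)) (sqrtr_ge0 (ip y y)).
rewrite -[leRHS]ger0_norm// -sqrtr_sqr ler_wsqrtr//.
rewrite ip_sqrD// sqrrD !sqr_sqrtr ?(hilbert_ge0 H)//.
have := le_trans (ler_norm _) (ip_le_sqrt Xx Xy).
move: (Num.sqrt _ * _) => q; rewrite mulr2n; lra.
Qed.

Lemma squeeze_sqr (u v : nat -> R) : (forall n, u n ^+ 2 <= v n) ->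
  v n @[n --> \oo] --> (0 : R) -> u n @[n --> \oo] --> (0 : R).
Proof.
move=> uv v0; apply/cvgrPdist_lt => e e0.
have e20 : 0 < e ^+ 2 by rewrite exprn_gt0.
move/cvgrPdist_lt : v0 => /(_ _ e20); apply: filterS => n.
rewrite !sub0r !normrN => vn.
have : `|u n| ^+ 2 < e ^+ 2.
  rewrite real_normK ?num_real//; apply: le_lt_trans vn.
  exact: le_trans (uv n) (ler_norm _).
by rewrite ltr_pXn2r ?nnegrE ?(ltW e0).
Qed.

Lemma strong_cvg_ip (x_ : nat -> E) x z : (forall n, X (x_ n)) -> X x -> X z ->
  ip (x_ n - x) (x_ n - x) @[n --> \oo] --> (0 : R) ->
  ip (x_ n) z @[n --> \oo] --> ip x z.
Proof.
move=> Xx_ Xx Xz x_x; apply/subr_cvg0.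
apply: (@squeeze_sqr _ (fun n => ip (x_ n - x) (x_ n - x) * ip z z)) => [n|].
  by rewrite -ipBl//; apply: ip_CauchySchwarz => //; exact: hilbertB.
by rewrite -[X in _ --> X](mul0r (ip z z)); apply: cvgMr_tmp.
Qed.

(** [V] is any linear subspace, closed or not: a minimising sequence is Cauchy by the parallelogram
    identity and its limit [p] lies in the closure of [V]. The sequence [v_] is returned so that
    properties stable under limits can be passed on to [p]. *)
Lemma hilbert_projection (V : set E) (f : E) : V `<=` X -> V 0 ->
  (forall a x y, V x -> V y -> V (a *: x + y)) -> X f ->
  exists p (v_ : nat -> E), [/\ X p, (forall n, V (v_ n)),
    ip (v_ n - p) (v_ n - p) @[n --> \oo] --> (0 : R) &
    forall v, V v -> ip (f - p) v = 0].
Proof.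
move=> VX V0 VP Xf.
pose D := [set ip (f - v) (f - v) | v in V].
have D0 : lbound D 0.
  by move=> _ [v Vv <-]; apply: (hilbert_ge0 H); apply/hilbertB/VX.
have infD : has_inf D by split; [exists (ip (f - 0) (f - 0)), 0|exists 0].
have dle v : V v -> inf D <= ip (f - v) (f - v).
  by move=> Vv; apply: ge_inf; [exists 0|exists v].
have /choice[v_ v_P] n : exists v, V v /\ ip (f - v) (f - v) < inf D + n.+1%:R^-1.
  have [|_ [v Vv <-] ?] := @inf_adherent _ D n.+1%:R^-1 _ infD; first by rewrite invr_gt0.
  by exists v.
have Vv_ n : V (v_ n) by case: (v_P n).
have Xfv n : X (f - v_ n) by apply/hilbertB/VX.
have v_lt n : ip (f - v_ n) (f - v_ n) < inf D + n.+1%:R^-1 by case: (v_P n).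
have [e e0|p Xp v_p] := hilbert_complete H (x_ := v_) (fun n => VX _ (Vv_ n)).
  (* The midpoint of [v_ m] and [v_ n] is in [V], so the parallelogram identity bounds their squared
     distance by 2 / (m + 1) + 2 / (n + 1); hence e / 4. *)
  have e40 : 0 < e / 4 by rewrite divr_gt0.
  have [n0 n0P] := natSinv_lt e40.
  exists n0 => m n m0 n0'.
  have := n0P m m0; have := n0P n n0' => /= nlt mlt.
  have := v_lt m; have := v_lt n.
  have := dle (2^-1 *: (v_ m + v_ n)) _.
  set h := f - 2^-1 *: _.
  have hE : (f - v_ n) + (f - v_ m) = 2 *: h.
    rewrite /h scalerBr scalerA divff ?pnatr_eq0// scale1r scaler_nat mulr2n opprD.
    by rewrite addrACA [- v_ n - v_ m]addrC.
  have VD x y : V x -> V y -> V (x + y) by move=> Vx Vy; rewrite -[x]scale1r; exact: VP.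
  have VZ a x : V x -> V (a *: x).
    by move=> Vx; rewrite -[_ *: _]addr0; exact: VP.
  have Xh : X h by apply/hilbertB => //; apply/VX/VZ/VD.
  move/(_ (VZ _ _ (VD _ _ (Vv_ m) (Vv_ n)))).
  have : ip (2 *: h) (2 *: h) = 4 * ip h h.
    by rewrite ipZl ?ipZr//; [ring|exact: hilbertZ].
  rewrite -hE (ip_sqrD (Xfv n) (Xfv m)).
  rewrite (_ : v_ m - v_ n = (f - v_ n) - (f - v_ m)); last first.
    by rewrite [RHS]addrC opprB addrA subrK.
  rewrite (ip_sqrB (Xfv n) (Xfv m)).
  move: (ip (f - v_ n) (f - v_ n)) (ip (f - v_ n) (f - v_ m))
    (ip (f - v_ m) (f - v_ m)) (ip h h) (inf D) (n.+1%:R^-1) (m.+1%:R^-1)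
    nlt mlt => p r q hh d a b; lra.
exists p, v_; split=> // v Vv.
have Xv := VX _ Vv.
apply/eqP; rewrite -sqrf_eq0 eq_le sqr_ge0 andbT.
(* Passing from [v_ n] to [a *: v + v_ n] lowers the squared distance by less than 1 / (n + 1); the
   best [a] turns this into a bound on the pairing with [v]. *)
have fin n : ip (f - v_ n) v ^+ 2 <= ip v v * n.+1%:R^-1.
  have Q a : 0 <= n.+1%:R^-1 - 2 * a * ip (f - v_ n) v + a ^+ 2 * ip v v.
    have := dle (a *: v + v_ n) (VP _ _ _ Vv (Vv_ n)).
    rewrite opprD addrA addrAC ip_sqrBZ//.
    by have := v_lt n; move: (n.+1%:R^-1) => r; lra.
  have q0 := hilbert_ge0 H Xv.
  have [q00|qn0] := eqVneq (ip v v) 0.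
    have := Q ((n.+1%:R^-1 + 1) / 2 / ip (f - v_ n) v).
    have [->|c0] := eqVneq (ip (f - v_ n) v) 0.
      by rewrite q00 mul0r expr0n.
    set r : R := n.+1%:R^-1; set c := ip _ _ in c0 *.
    have -> : r - 2 * ((r + 1) / 2 / c) * c + ((r + 1) / 2 / c) ^+ 2 * ip v v = -1.
      by rewrite q00; field.
    by lra.
  have qp : 0 < ip v v by rewrite lt_neqAle eq_sym qn0.
  have := Q (ip (f - v_ n) v / ip v v); rewrite -(pmulr_rge0 _ qp).
  set r : R := n.+1%:R^-1; set c := ip (f - v_ n) v; set q := ip v v in qn0 *.
  have -> : q * (r - 2 * (c / q) * c + (c / q) ^+ 2 * q) = q * r - c ^+ 2 by field.
  by rewrite subr_ge0.
have c1 : ip (f - v_ n) v @[n --> \oo] --> (0 : R).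
  apply: squeeze_sqr fin _.
  rewrite -[X in _ --> X](mulr0 (ip v v)); apply: cvgMl_tmp.
  exact: cvg_harmonic.
have c2 : ip (f - v_ n) v @[n --> \oo] --> ip (f - p) v.
  have e n : ip (f - v_ n) v = ip f v - ip (v_ n) v by rewrite ipBl//; exact: VX.
  rewrite ipBl//; under eq_fun do rewrite e.
  apply: cvgB; first exact: cvg_cst.
  by apply: strong_cvg_ip => // n; exact: VX.
by rewrite (cvg_unique _ c2 c1) ?expr0n.
Qed.

Lemma riesz_representation (l : E -> R) :
  (forall a x y, X x -> X y -> l (a *: x + y) = a * l x + l y) ->
  (exists C, forall x, X x -> `|l x| <= C * Num.sqrt (ip x x)) ->
  exists2 z, X z & forall x, X x -> l x = ip x z.
Proof.
move=> lP [C lC]; have X0 := hilbert0 H.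
have l0 : l 0 = 0.
  have := lP 1 0 0 X0 X0; rewrite scaler0 addr0 mul1r => /eqP.
  by rewrite -subr_eq0 opprD addNKr oppr_eq0 => /eqP.
have [l00|/existsNP[f /not_implyP[Xf /eqP lf0]]] :=
    pselect (forall x, X x -> l x = 0).
  by exists 0 => // x Xx; rewrite l00// (hilbertC H)// ip0l.
pose V := [set x | X x /\ l x = 0].
have [|||p [v_ [Xp Vv_ v_p orth]]] := @hilbert_projection V f _ _ _ Xf.
- by move=> x [].
- by [].
- by move=> a x y [Xx lx] [Xy ly]; split; [exact: hilbertP H _ _ _ _ _|rewrite lP// lx ly mulr0 addr0].
have Xv_ n : X (v_ n) by case: (Vv_ n).
(* [p] is a limit of points of the kernel of [l]; boundedness of [l] puts it in the kernel. *)
have lp : l p = 0.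
  have h : (fun _ : nat => l p) n @[n --> \oo] --> (0 : R).
    apply: (@squeeze_sqr _ (fun n => C ^+ 2 * ip (v_ n - p) (v_ n - p))) => [n|].
      have Xvp := hilbertB (Xv_ n) Xp.
      have lvp : l (v_ n - p) = - l p.
        by rewrite -scaleN1r addrC lP// mulN1r (Vv_ n).2 addr0.
      have := lC _ Xvp; rewrite lvp normrN => h.
      rewrite -(sqr_sqrtr (hilbert_ge0 H Xvp)) -exprMn -[leLHS]real_normK ?num_real//.
      by rewrite ler_pXn2r ?nnegrE// (le_trans _ h).
    by rewrite -[X in _ --> X](mulr0 (C ^+ 2)); apply: cvgMl_tmp.
  by apply: (cvg_unique _ _ h) => //; exact: cvg_cst.
pose z := f - p; have Xz : X z by exact: hilbertB.
have lz : l z = l f by rewrite /z -scaleN1r addrC lP// lp mulr0 add0r.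
(* The form is only semidefinite: it is the bound of [l] by the seminorm that excludes [ip z z = 0],
   because [l z = l f] is nonzero. *)
have zz0 : ip z z != 0.
  apply: contra lf0 => /eqP zz0; rewrite -lz.
  by have := lC _ Xz; rewrite zz0 sqrtr0 mulr0 normr_le0.
exists ((l z / ip z z) *: z) => [|x Xx]; first exact: hilbertZ.
have Vx : V (x - (l x / l z) *: z).
  split; first by apply/hilbertB/hilbertZ.
  rewrite -scaleNr addrC lP// mulNr mulrVK ?addNr//.
  by rewrite unitfE lz.
have := orth _ Vx; rewrite -/z ipBr//; last exact: hilbertZ.
rewrite !ipZr// (hilbertC H Xz Xx) => /eqP; rewrite subr_eq0 => /eqP ->.
by field; rewrite zz0 lz lf0.
Qed.

(** The values lie in a compact interval, where the image filter has a cluster point, and a cluster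
    point of an ultrafilter is a limit. *)
Lemma bounded_ultralimit (U : set_system nat) (u : nat -> R) (C : R) :
  UltraFilter U -> (forall n, `|u n| <= C) -> exists l : R, u @ U --> l.
Proof.
move=> UU uC.
have h : U (u @^-1` `[- C, C]).
  by apply: filterS filterT => n _; rewrite /= in_itv/= -ler_norml; exact: uC.
have [l [_ lU]] := @segment_compact R (- C) C (u @ U) _ h.
exists l => V Vl; rewrite /nbhs/=.
have [//|UnV] := in_ultra_setVsetC (u @^-1` V) UU.
by have [x [/= nVx Vx]] := lU (~` V) V UnV Vl.
Qed.

(* No separability is used: [x] is the weak limit along a free ultrafilter, [s]
   makes the pairings with every [x_ m] converge, and a general [z] is split by
   projecting it onto the closed subspace [V] of those [z] that behave well, its
   orthogonal part being orthogonal to every [x_ m]. *)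
Lemma weak_sequential_compactness (x_ : nat -> E) (C : R) :
  (forall n, X (x_ n)) -> (forall n, ip (x_ n) (x_ n) <= C) ->
  exists (s : nat -> nat) x, [/\ {homo s : i j / (i < j)%N}, X x &
    forall z, X z -> ip (x_ (s j)) z @[j --> \oo] --> ip x z].
Proof.
move=> Xx_ xC.
have C0 : 0 <= C by apply: le_trans (xC 0%N); exact: hilbert_ge0 H _ (Xx_ _).
have xzC n z : X z -> `|ip (x_ n) z| <= Num.sqrt C * Num.sqrt (ip z z).
  move=> Xz; apply: le_trans (ip_le_sqrt (Xx_ n) Xz) _.
  by rewrite ler_wpM2r ?sqrtr_ge0// ler_wsqrtr.
have [U [UU ooU]] := @ultraFilterLemma nat (nbhs \oo) _.
have /choice[l lP] z : exists l : R, X z -> ip (x_ n) z @[n --> U] --> l.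
  have [Xz|?] := pselect (X z); last by exists 0.
  have [l ?] := bounded_ultralimit UU (fun n => xzC n z Xz).
  by exists l.
have [||x Xx lx] := @riesz_representation l.
- move=> a y z Xy Xz; have Xayz := hilbertP H a Xy Xz.
  have c : ip (x_ n) (a *: y + z) @[n --> U] --> a * l y + l z.
    have e n : ip (x_ n) (a *: y + z) = a * ip (x_ n) y + ip (x_ n) z.
      by rewrite ipDr ?ipZr//; exact: hilbertZ.
    under eq_fun do rewrite e.
    by apply: cvgD; [apply: cvgMl_tmp|]; exact: lP.
  by apply: (cvg_unique _ (lP _ Xayz) c).
- exists (Num.sqrt C) => y Xy.
  have /(cvg_comp _ _)/(_ (@norm_continuous _ R _)) := lP y Xy.
  move=> h; apply: (cvgr_to_le h).
  by apply: filterS filterT => n _; exact: xzC.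
have {}lx z : X z -> ip (x_ n) z @[n --> U] --> ip x z.
  by move=> Xz; rewrite -(hilbertC H Xz Xx) -lx//; exact: lP.
(* Finitely many members of [U] meet in a member of [U], so a single index serves all [m < j]; [U]
   also contains the tails, whence [N < n]. *)
have step (N j : nat) : exists n, (N < n)%N /\
    forall m, (m < j)%N -> `|ip (x_ n) (x_ m) - ip x (x_ m)| < j.+1%:R^-1.
  have /(@filter_ex _ U _) [n [Nn nP]] : U [set n | (N < n)%N /\
      forall m, (m < j)%N -> `|ip (x_ n) (x_ m) - ip x (x_ m)| < j.+1%:R^-1].
    apply: filterI; first by apply: ooU; exact: nbhs_infty_gt.
    have e0 : 0 < j.+1%:R^-1 :> R by rewrite invr_gt0.
    move: (j.+1%:R^-1 : R) e0 => e e0.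
    elim: j => [|j IH]; first by apply: filterS filterT.
    have := lx _ (Xx_ j) => /cvgrPdistC_lt/(_ _ e0).
    move/(filterI IH); apply: filterS => n [IHn nj] m.
    by rewrite ltnS leq_eqVlt => /predU1P[->|/IHn].
  by exists n.
have /choice[f fP] : forall p : nat * nat, exists n, (p.1 < n)%N /\
    forall m, (m < p.2)%N -> `|ip (x_ n) (x_ m) - ip x (x_ m)| < p.2.+1%:R^-1.
  by move=> [N j]; exact: step.
pose s := fix s j := if j is i.+1 then f (s i, j) else f (0, 0)%N.
have sm i : (s i < s i.+1)%N by case: (fP (s i, i.+1)).
have sP j m : (m < j)%N -> `|ip (x_ (s j)) (x_ m) - ip x (x_ m)| < j.+1%:R^-1.
  by case: j => // j; case: (fP (s j, j.+1)) => _; exact.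
have sx m : ip (x_ (s j)) (x_ m) @[j --> \oo] --> ip x (x_ m).
  apply/cvgrPdistC_lt => e e0.
  have [n0 n0P] := natSinv_lt e0.
  exists (maxn m.+1 n0) => // j /=; rewrite geq_max => /andP[mj n0j].
  by apply: lt_trans (sP _ _ mj) _; exact: n0P.
exists s, x; split=> //; first exact: homo_ltn ltn_trans sm.
pose V := [set z | X z /\ ip (x_ (s j)) z @[j --> \oo] --> ip x z].
(* [V] is stable under strong limits: the error made by replacing [z] with [v_ n] is uniform along
   the sequence because the [x_ n] are bounded. *)
have CV z : (exists2 v_, (forall n, V (v_ n)) &
    X z /\ ip (v_ n - z) (v_ n - z) @[n --> \oo] --> (0 : R)) -> V z.
  move=> [v_ Vv_ [Xz vz]]; split=> //.
  have Xv n : X (v_ n) by case: (Vv_ n).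
  have ivz : Num.sqrt (ip (v_ n - z) (v_ n - z)) @[n --> \oo] --> (0 : R).
    rewrite -sqrtr0; apply: (cvg_comp _ _ vz); exact: sqrt_continuous.
  pose B := Num.sqrt C + Num.sqrt (ip x x) + 1.
  have B0 : 0 < B by rewrite ltr_wpDl// addr_ge0 ?sqrtr_ge0.
  apply/cvgrPdistC_lt => e e0.
  have e20 : 0 < e / 2 / B by rewrite !divr_gt0.
  move/cvgrPdistC_lt : ivz => /(_ _ e20)[n _ /(_ n (leqnn n))/=].
  rewrite subr0 ger0_norm ?sqrtr_ge0// ltr_pdivlMr// => nB.
  have e2 : 0 < e / 2 by rewrite divr_gt0.
  have := (Vv_ n).2 => /cvgrPdistC_lt/(_ _ e2); apply: filterS => j ej.
  have Xvz := hilbertB (Xv n) Xz.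
  have -> : ip (x_ (s j)) z - ip x z = (ip (x_ (s j)) (v_ n) - ip x (v_ n))
      - ip (x_ (s j)) (v_ n - z) + ip x (v_ n - z).
    by rewrite !ipBr//; ring.
  have := xzC (s j) _ Xvz; have := ip_le_sqrt Xx Xvz.
  move=> cq bq; apply: le_lt_trans (ler_normD _ _) _.
  apply: le_lt_trans (lerD (ler_normB _ _) (lexx _)) _.
  have := sqrtr_ge0 (ip (v_ n - z) (v_ n - z)).
  by move: nB ej cq bq; rewrite /B; lra.
move=> z Xz; apply: (proj2 (_ : V z)).
have VX : V `<=` X by move=> ? [].
have VP a u v : V u -> V v -> V (a *: u + v).
  move=> [Xu Vu] [Xv Vv]; split; first exact: hilbertP H _ _ _ _ _.
  have Xau := hilbertZ a Xu.
  under eq_fun do rewrite ipDr// ipZr//.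
  rewrite ipDr// ipZr//; apply: cvgD => //; exact: cvgMl_tmp.
have V0 : V 0.
  split; first exact: hilbert0 H.
  rewrite (hilbertC H)// ?ip0l//; last exact: hilbert0 H.
  under eq_fun do rewrite (hilbertC H (Xx_ _) (hilbert0 H)) ip0l//.
  exact: cvg_cst.
have [p [v_ [Xp Vv_ v_p orth]]] := hilbert_projection VX V0 VP Xz.
have Vp : V p by apply: CV; exists v_.
have Xzp := hilbertB Xz Xp.
have xq m : ip (x_ m) (z - p) = 0.
  by rewrite (hilbertC H)// orth.
have Vq : V (z - p).
  split=> //; have : ip x (z - p) = 0.
    apply: (cvg_unique _ (lx _ Xzp)) => //.
    rewrite (_ : (fun n => _) = cst 0); first exact: cvg_cst.
    by apply/funext => n; exact: xq.
  move=> ->; rewrite (_ : (fun j => _) = cst 0); first exact: cvg_cst.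
  by apply/funext => j; exact: xq.
by rewrite -(subrK p z) -[z - p]scale1r; exact: VP.
Qed.

End hilbert_theory.

(** * The space L^2 *)

Section L2_space.
Context d (T : measurableType d) (R : realType).
Variable mu : {measure set T -> \bar R}.
Implicit Types (f g h : T -> R).

Definition L2fun : set (T -> R) := [set f | f \in Lfun mu 2%:E].

Definition ipL2 f g : R := \int[mu]_x (f x * g x).

Lemma Lnorm2E h g : (forall x, h x ^+ 2 = g x) ->
  mu.-integrable setT (EFin \o g) ->
  Lnorm mu 2%:E (EFin \o h) = (Num.sqrt (\int[mu]_x g x))%:E.
Proof.
move=> hg ig; rewrite unlock.
have -> : (\int[mu]_x (`|(EFin \o h) x| `^ 2))%E = (\int[mu]_x (g x)%:E)%E.
  apply: eq_integral => x _.
  by rewrite /= powR_mulrn// real_normK ?num_real// hg.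
have <- : (\int[mu]_x g x)%:E = (\int[mu]_x (g x)%:E)%E.
  by rewrite /Rintegral fineK//; exact: integrable_fin_num.
by rewrite poweR_EFin powR12_sqrt// Rintegral_ge0// => x _; rewrite -hg sqr_ge0.
Qed.

Lemma L2funP f : L2fun f <->
  measurable_fun setT f /\ mu.-integrable setT (EFin \o (fun x => f x ^+ 2)).
Proof.
split=> [L2f|[mf if2]].
  split; last exact: Lfun2_integrable_sqr.
  by move: L2f; rewrite /L2fun/= inE => /andP[]; rewrite inE.
rewrite /L2fun/= inE; apply/andP; split; first by rewrite inE.
by rewrite inE/= /finite_norm (Lnorm2E (g := fun x => f x ^+ 2))// ltry.
Qed.

Lemma L2fun_measurable f : L2fun f -> measurable_fun setT f.
Proof. by move/L2funP => []. Qed.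

Lemma L2fun_sqr f : L2fun f ->
  mu.-integrable setT (EFin \o (fun x => f x ^+ 2)).
Proof. by move/L2funP => []. Qed.

Lemma le_Rintegrable (D : set T) f g : measurable D -> measurable_fun D f ->
  (forall x, D x -> `|f x| <= g x) ->
  mu.-integrable D (EFin \o g) -> mu.-integrable D (EFin \o f).
Proof.
move=> mD mf fg; apply: le_integrable => //; first exact/measurable_EFinP.
by move=> x Dx /=; rewrite lee_fin (le_trans (fg x Dx))// ler_norm.
Qed.

Lemma L2fun_dom f g c : L2fun g -> measurable_fun setT f ->
  (forall x, f x ^+ 2 <= c * g x ^+ 2) -> L2fun f.
Proof.
move=> L2g mf fg; apply/L2funP; split=> //.
apply: (@le_Rintegrable _ _ (fun x => c * g x ^+ 2)) => //.
- exact: measurable_funX.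
- by move=> x _; rewrite ger0_norm ?sqr_ge0.
- have := integrableZl measurableT c (L2fun_sqr L2g).
  by apply: eq_integrable => // x _ /=; rewrite EFinM.
Qed.

Lemma L2funM_integrable f g : L2fun f -> L2fun g ->
  mu.-integrable setT (EFin \o (fun x => f x * g x)).
Proof. by move=> L2f L2g; apply/Lfun1_integrable; exact: Lfun2_mul_Lfun1. Qed.

Lemma L2fun0 : L2fun (fun=> 0).
Proof.
apply/L2funP; split; first exact: measurable_cst.
apply: (@eq_integrable _ _ _ mu setT measurableT (cst 0%E)) => //.
  by move=> x _ /=; rewrite expr0n.
exact: integrable0.
Qed.

Lemma L2funZD a f g : L2fun f -> L2fun g -> L2fun (fun x => a * f x + g x).
Proof.
move=> L2f L2g; have mf := L2fun_measurable L2f; have mg := L2fun_measurable L2g.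
have mfg : measurable_fun setT (fun x => a * f x + g x).
  by apply: measurable_funD => //; exact: measurable_funM.
apply/L2funP; split=> //.
apply: (@le_Rintegrable _ _ (fun x => (2 * a ^+ 2) * f x ^+ 2 + 2 * g x ^+ 2)) => //.
- exact: measurable_funX.
- move=> x _; rewrite ger0_norm ?sqr_ge0//.
  by have := sqr_ge0 (a * f x - g x); nra.
- have := integrableD measurableT (integrableZl measurableT (2 * a ^+ 2) (L2fun_sqr L2f))
    (integrableZl measurableT 2 (L2fun_sqr L2g)).
  by apply: eq_integrable => // x _ /=; rewrite EFinD !EFinM.
Qed.

Lemma L2funD f g : L2fun f -> L2fun g -> L2fun (fun x => f x + g x).
Proof.
by move=> L2f /(L2funZD 1 L2f); under eq_fun do rewrite mul1r.
Qed.

Lemma L2funB f g : L2fun f -> L2fun g -> L2fun (fun x => f x - g x).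
Proof.
move=> L2f L2g; have := L2funZD (-1) L2g L2f.
by under eq_fun do rewrite mulN1r addrC.
Qed.

Lemma L2fun_mul_bounded h f c : measurable_fun setT h -> (forall x, `|h x| <= c) ->
  L2fun f -> L2fun (fun x => h x * f x).
Proof.
move=> mh hc L2f; apply: (@L2fun_dom _ f (c ^+ 2)) => //.
  by apply: measurable_funM => //; exact: L2fun_measurable.
move=> x; rewrite exprMn ler_wpM2r ?sqr_ge0//.
by rewrite -[leLHS]real_normK ?num_real// lerXn2r ?nnegrE// (le_trans _ (hc x)).
Qed.

Lemma L2fun_patch (D : set T) f : measurable D -> L2fun f -> L2fun (f \_ D).
Proof.
move=> mD L2f; apply: (@L2fun_dom _ f 1) => //.
  apply/(measurable_restrictT _ mD); apply: measurable_funTS.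
  exact: L2fun_measurable.
by move=> x; rewrite mul1r patchE; case: ifP => // _; rewrite expr0n sqr_ge0.
Qed.

Lemma L2fun_indic (D : set T) : measurable D -> (mu D < +oo)%E -> L2fun \1_D.
Proof.
move=> mD Doo; apply/L2funP; split; first exact: measurable_indic.
apply: (@eq_integrable _ _ _ mu setT measurableT (EFin \o \1_D)) => //.
  by move=> x _ /=; rewrite indicE; case: (x \in D); rewrite ?expr1n ?expr0n.
apply/integrableP; split; first exact/measurable_EFinP/measurable_indic.
rewrite (eq_integral (fun x => (\1_D x)%:E)).
  by rewrite integral_indic// setIT.
by move=> x _; rewrite gee0_abs// lee_fin.
Qed.

Lemma ipL2_ge0 f : 0 <= ipL2 f f.
Proof. by apply: Rintegral_ge0 => x _; rewrite -expr2 sqr_ge0. Qed.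

Lemma ipL2E f : L2fun f -> (ipL2 f f)%:E = (\int[mu]_x (f x ^+ 2)%:E)%E.
Proof.
move=> L2f; rewrite /ipL2; under eq_Rintegral do rewrite -expr2.
by rewrite /Rintegral fineK//; apply: integrable_fin_num => //; exact: L2fun_sqr.
Qed.

Lemma geometric_cvg (u : nat -> R) c :
  (forall k, `|u k.+1 - u k| <= c * 2^-1 ^+ k) -> cvgn u.
Proof.
move=> uc.
suff : cvgn (series (telescope u)).
  move=> cu; rewrite (_ : u = (fun n => u 0%N + series (telescope u) n)).
    by apply: is_cvgD => //; exact: is_cvg_cst.
  by apply/funext => n; exact: eq_sum_telescope.
apply: normed_cvg; apply: (series_le_cvg (v_ := geometric c 2^-1)).
- by move=> n; exact: normr_ge0.
- by move=> n; apply: le_trans (uc n).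
- by move=> n; exact: uc.
- by apply: is_cvg_geometric_series; rewrite ger0_norm// invf_lt1// ltr1n.
Qed.

(** The weights [4 ^+ k] against the rate [8^-1 ^+ k] leave a geometric series, so the sum S of 4^k
    (u_(k+1) - u_k)^2 is integrable and finite almost everywhere; there the increments are at most
    sqrt(S) 2^(-k). *)
Lemma fast_cauchy_ae_cvg (u : nat -> T -> R) : (forall k, L2fun (u k)) ->
  (forall k, ipL2 (u k.+1 \- u k) (u k.+1 \- u k) <= 8^-1 ^+ k) ->
  {ae mu, forall x, cvgn (fun k => u k x)}.
Proof.
move=> L2u uk.
have L2du k : L2fun (u k.+1 \- u k) by exact: L2funB.
pose a k x : \bar R := (4 ^+ k * (u k.+1 x - u k x) ^+ 2)%:E.
have a0 k x : (0 <= a k x)%E by rewrite lee_fin mulr_ge0// ?sqr_ge0// exprn_ge0.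
have ma k : measurable_fun setT (a k).
  apply/measurable_EFinP/measurable_funM => //.
  by apply/measurable_funX/L2fun_measurable/L2du.
have ia k : (\int[mu]_x a k x <= (1 / (2 ^ (k + 0))%:R)%:E)%E.
  rewrite /a; under eq_integral do rewrite EFinM.
  rewrite ge0_integralZl_EFin; last 4 first.
  - exact: measurableT.
  - by move=> x _; rewrite lee_fin sqr_ge0.
  - by apply/measurable_EFinP/measurable_funX/L2fun_measurable/L2du.
  - by rewrite exprn_ge0.
  rewrite -(ipL2E (L2du k)) -EFinM lee_fin.
  apply: le_trans (ler_wpM2l _ (uk k)) _; first by rewrite exprn_ge0.
  rewrite -exprMn (_ : 4 / 8 = 2^-1 :> R); last by lra.
  by rewrite addn0 natrX exprVn div1r.
have Soo : (\int[mu]_x (\sum_(k <oo) a k x) < +oo)%E.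
  rewrite integral_nneseries//.
  apply: (@le_lt_trans _ _ (\sum_(k <oo) (1 / (2 ^ (k + 0))%:R)%:E)%E).
    apply: lee_nneseries => [k _ _|k _]; last exact: ia.
    by apply: integral_ge0 => x _; exact: a0.
  have := @cvg_geometric_eseries_half R 2 0.
  under eq_fun do rewrite addn1 expnS natrM invfM mulrA divff ?pnatr_eq0//.
  under [in X in _ -> X]eq_eseriesr do rewrite addn0.
  by move/cvg_lim => -> //; rewrite ltry.
have mS : measurable_fun setT (fun x => \sum_(k <oo) a k x)%E.
  exact: ge0_emeasurable_sum.
have S0 x : (0 <= \sum_(k <oo) a k x)%E by exact: nneseries_ge0.
have iS : mu.-integrable setT (fun x => \sum_(k <oo) a k x)%E.
  apply/integrableP; split=> //.
  by under eq_integral do rewrite gee0_abs//.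
have := integrable_ae measurableT iS; apply: filterS => x /(_ I) Sfin.
set S := (\sum_(k <oo) a k x)%E in Sfin.
have fS0 : 0 <= fine S by rewrite fine_ge0// S0.
apply: (@geometric_cvg _ (Num.sqrt (fine S))) => k.
have akS : 4 ^+ k * (u k.+1 x - u k x) ^+ 2 <= fine S.
  rewrite -lee_fin fineK//.
  have := @nneseries_lim_ge R (a ^~ x) xpredT 0 k.+1 (fun n _ _ => a0 n x).
  apply: le_trans; rewrite big_nat_recr//=.
  by rewrite leeDr// sume_ge0.
rewrite -sqrtr_sqr -[2^-1 ^+ k]ger0_norm ?exprn_ge0// -sqrtr_sqr -sqrtrM//.
rewrite ler_wsqrtr// -exprM mulnC exprM.
rewrite (_ : 2^-1 ^+ 2 = 4^-1 :> R); last by field.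
by rewrite exprVn ler_pdivlMr ?exprn_gt0// mulrC.
Qed.

(** Riesz-Fischer: a fast subsequence converges almost everywhere, and Fatou's lemma, with [f_ n]
    fixed and the subsequence running, shows that [f_ n - f] is in L^2 and bounds its norm. *)
Lemma L2_complete (f_ : nat -> T -> R) : (forall n, L2fun (f_ n)) ->
  (forall e : R, 0 < e -> exists n0, forall m n, (n0 <= m)%N -> (n0 <= n)%N ->
     ipL2 (f_ m - f_ n) (f_ m - f_ n) <= e) ->
  exists2 f, L2fun f & ipL2 (f_ n - f) (f_ n - f) @[n --> \oo] --> (0 : R).
Proof.
move=> L2f cf.
have /choice[N NP] : forall k, exists n0, forall m n, (n0 <= m)%N -> (n0 <= n)%N ->
    ipL2 (f_ m - f_ n) (f_ m - f_ n) <= 8^-1 ^+ k.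
  by move=> k; apply: cf; rewrite exprn_gt0.
(* The running maximum makes the indices nondecreasing, so that [u k.+1] is also past the threshold
   [N k]. *)
pose M k := (\max_(i < k.+1) N i)%N.
have NM k : (N k <= M k)%N by rewrite /M (leq_bigmax (@ord_max k)).
have MM k : (M k <= M k.+1)%N by rewrite /M [leqRHS]big_ord_recr /= leq_maxl.
pose u k := f_ (M k).
have L2u k : L2fun (u k) by exact: L2f.
have := @fast_cauchy_ae_cvg u L2u _.
have uk k : ipL2 (u k.+1 \- u k) (u k.+1 \- u k) <= 8^-1 ^+ k.
  by apply: NP => //; exact: leq_trans (NM k) (MM k).
move=> /(_ uk) ucvg.
(* An upper limit is measurable whether or not the subsequence converges; where it diverges, on a
   null set, the value does not matter. *)
pose f x := fine (limn_esup (fun k => (u k x)%:E)).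
have mf : measurable_fun setT f.
  apply: measurableT_comp => //.
  apply: measurable_fun_limn_esup => k.
  by apply/measurable_EFinP/L2fun_measurable.
have uf : {ae mu, forall x, u k x @[k --> \oo] --> f x}.
  apply: filterS ucvg => x /cvg_ex[l ul].
  have ul' : (u k x)%:E @[k --> \oo] --> l%:E by apply: cvg_EFin => //; exact: nearW.
  by rewrite /f (cvg_limn_einf_sup ul').2.
have key k n : (N k <= n)%N -> L2fun (f_ n - f) /\
    ipL2 (f_ n - f) (f_ n - f) <= 8^-1 ^+ k.
  move=> kn.
  have mg : measurable_fun setT (fun x => (f_ n x - f x) ^+ 2).
    apply/measurable_funX/measurable_funB => //; exact: L2fun_measurable.
  have h : (\int[mu]_x ((f_ n x - f x) ^+ 2)%:E <= (8^-1 ^+ k)%:E)%E.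
    have mj j : measurable_fun setT (fun x => ((f_ n x - u j x) ^+ 2)%:E).
      by apply/measurable_EFinP/measurable_funX/measurable_funB; exact: L2fun_measurable.
    have e : {ae mu, forall x, setT x ->
        limn_einf (fun j => ((f_ n x - u j x) ^+ 2)%:E) = ((f_ n x - f x) ^+ 2)%:E}.
      apply: filterS uf => x ux _.
      have c : ((f_ n x - u j x) ^+ 2)%:E @[j --> \oo] --> ((f_ n x - f x) ^+ 2)%:E.
        apply: cvg_EFin; first exact: nearW.
        under eq_fun do rewrite expr2.
        by rewrite expr2; apply: cvgM; apply: cvgB => //; exact: cvg_cst.
      by rewrite (cvg_limn_einf_sup c).1.
    rewrite -(ae_eq_integral _ _ _ _ _ e)//; last 2 first.
    - apply: measurableT_comp => //; apply: measurable_fun_limn_esup => j.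
      exact: measurableT_comp.
    - exact/measurable_EFinP.
    apply: le_trans (fatou _ _ _ _) _ => //.
      by move=> j x _; rewrite lee_fin sqr_ge0.
    rewrite limn_einf_lim; apply: lime_le; first exact: is_cvg_einfs.
    exists k => // j /= kj.
    apply: le_trans (ereal_inf_lbound _) _; first by exists j => //=.
    rewrite -ipL2E ?lee_fin; last exact: L2funB.
    apply: NP => //; apply: leq_trans (NM k) _.
    by elim: j kj => [|j IH]; [rewrite leqn0 => /eqP ->|
       rewrite leq_eqVlt => /predU1P[->//|/IH/leq_trans]; apply].
  have L2d : L2fun (f_ n - f).
    apply/L2funP; split.
      by apply: measurable_funB => //; exact: L2fun_measurable.
    apply/integrableP; split; first exact/measurable_EFinP.
    apply: le_lt_trans (ltry (8^-1 ^+ k)); apply: le_trans h.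
    by under eq_integral do rewrite gee0_abs ?lee_fin ?sqr_ge0//.
  by split => //; rewrite -lee_fin ipL2E.
have L2f' : L2fun f.
  have [L2d _] := key 0%N _ (leqnn _).
  have := L2funB (L2f (N 0%N)) L2d.
  by rewrite (_ : (fun x => _) = f)//; apply/funext => x; rewrite !fctE/= opprB addrC subrK.
exists f => //; apply/cvgrPdistC_lt => e e0.
have g8 : `|8^-1| < 1 :> R by rewrite ger0_norm// invf_lt1// ltr1n.
have /cvgrPdistC_lt/(_ _ e0)[k _ /(_ k (leqnn k))/=] := cvg_geometric 1 g8.
rewrite subr0 /geometric/= mul1r ger0_norm ?exprn_ge0// => ke.
exists (N k) => // n /= kn; rewrite subr0 ger0_norm ?ipL2_ge0//.
by apply: le_lt_trans ke; exact: (key _ _ kn).2.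
Qed.

Lemma hilbert_L2 : hilbert_on L2fun ipL2.
Proof.
split.
- exact: L2fun0.
- by move=> a f g; exact: L2funZD.
- by move=> f g _ _; rewrite /ipL2; under eq_Rintegral do rewrite mulrC.
- move=> a f g h L2f L2g L2h; rewrite /ipL2.
  under eq_Rintegral do rewrite !fctE mulrDl -mulrA.
  rewrite RintegralD//; last 2 first.
  + have := integrableZl measurableT a (L2funM_integrable L2f L2h).
    by apply: eq_integrable => // x _ /=; rewrite EFinM.
  + exact: L2funM_integrable.
  by rewrite RintegralZl//; exact: L2funM_integrable.
- by move=> f _; exact: ipL2_ge0.
- exact: L2_complete.
Qed.

End L2_space.

(** * Lebesgue measure on row vectors *)

Section lebesgue_translation.
Context {R : realType}.

Lemma measurable_addr_R (a : R) :
  measurable_fun [set: measurableTypeR R] (fun x : measurableTypeR R => (x + a : measurableTypeR R)%R).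
Proof. exact: measurable_funD. Qed.

(** A measure that agrees with Lebesgue measure on bounded half-open intervals is Lebesgue measure,
    and a shift preserves lengths. *)
Lemma lebesgue_measure_addr (a : R) (A : set (measurableTypeR R)) :
  measurable A ->
  pushforward (@lebesgue_measure R) (fun x : measurableTypeR R => (x + a : measurableTypeR R)%R) A
  = lebesgue_measure A.
Proof.
move=> mA; apply/esym.
pose m := measure_function_pushforward__canonical__measure_function_Measure
  (@lebesgue_measure R) (measurable_addr_R a).
apply: (@lebesgue_measure_unique R m) => // _ [[u v]] _ <-.
rewrite /m /= /pushforward.
rewrite (_ : _ @^-1` _ = `]u - a, v - a]%classic); last first.
  by apply/seteqP; split=> x /=; rewrite !in_itv/= ltrBlDr lerBrDr.
rewrite !lebesgue_measure_itv/= !lte_fin ltrD2r -!EFinB.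
by rewrite opprB addrA subrK.
Qed.

Lemma ge0_integral_addr_R (a : R) (f : R -> \bar R) :
  measurable_fun [set: measurableTypeR R] f -> (forall x, (0 <= f x)%E) ->
  (\int[@lebesgue_measure R]_x f (x + a)%R = \int[@lebesgue_measure R]_x f x)%E.
Proof.
move=> mf f0.
transitivity (\int[pushforward (@lebesgue_measure R)
    (fun x : measurableTypeR R => (x + a : measurableTypeR R)%R)]_x f x)%E.
  rewrite ge0_integral_pushforward//.
  exact: measurable_addr_R.
apply: eq_measure_integral => [|? A mA _]; first exact: measurable_addr_R.
exact: lebesgue_measure_addr.
Qed.

Lemma rV_consD n (p : R * 'rV[R]_n) (a : 'rV[R]_n.+1) :
  rV_cons p + a = rV_cons (p.1 + a ord0 ord0, p.2 + \row_i a ord0 (lift ord0 i)).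
Proof.
apply/rowP => i; rewrite mxE.
have [k ->|->] := unliftP ord0 i; last by rewrite !rV_cons0.
by rewrite !rV_consS/= !mxE.
Qed.

Lemma measurable_rV_add n (a : 'rV[R]_n) :
  measurable_fun setT (fun x : 'rV[R]_n => x + a).
Proof.
apply: measurable_fun_mxP => i j; under eq_fun do rewrite mxE.
by apply: measurable_funD => //; exact: measurable_mx_coord.
Qed.

(** Induction on the dimension: the measure is a product by construction and integrates the measures
    of the slices. The slices are shifted by the induction hypothesis, the first coordinate by
    invariance on the line. *)
Lemma lebesgue_rV_addr n (a : 'rV[R]_n) (A : set 'rV[R]_n) : measurable A ->
  lebesgue_rV R n ((fun x => x + a) @^-1` A) = lebesgue_rV R n A.
Proof.
elim: n a A => [|n IH] a A mA.
  rewrite (_ : _ @^-1` _ = A)//.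
  by apply/seteqP; split=> x /=; rewrite (_ : x + a = x)//; apply/rowP => -[].
pose B := @rV_cons R n @^-1` A.
have mB : measurable B by rewrite -[B]setTI; exact: measurable_rV_cons.
pose a' : 'rV[R]_n := \row_i a ord0 (lift ord0 i).
rewrite /= /lebesgue_cons /pushforward /product_measure1.
pose F (t : measurableTypeR R) := lebesgue_rV R n (xsection B t).
transitivity (\int[@lebesgue_measure R]_t F (t + a ord0 ord0)%R)%E.
  apply: eq_integral => t _; rewrite /F /=.
  have mBt : measurable (xsection B (t + a ord0 ord0)) by apply: measurable_xsection.
  rewrite -(IH a' _ mBt).
  congr (lebesgue_rV R n _); apply/seteqP; split=> y;
    by rewrite /xsection /= !inE /= rV_consD.
rewrite ge0_integral_addr_R//.
exact: measurable_fun_xsection.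
Qed.

Lemma ge0_integral_rV_addr n (a : 'rV[R]_n) (f : 'rV[R]_n -> \bar R) :
  measurable_fun setT f -> (forall x, (0 <= f x)%E) ->
  (\int[lebesgue_rV R n]_x f (x + a)%R = \int[lebesgue_rV R n]_x f x)%E.
Proof.
move=> mf f0.
transitivity (\int[pushforward (lebesgue_rV R n) (fun x : 'rV[R]_n => x + a)%R]_x f x)%E.
  rewrite ge0_integral_pushforward//.
  exact: measurable_rV_add.
apply: eq_measure_integral => [|? A mA _]; first exact: measurable_rV_add.
exact: lebesgue_rV_addr.
Qed.

Lemma integrable_rV_addr n (a : 'rV[R]_n) (f : 'rV[R]_n -> R) :
  (lebesgue_rV R n).-integrable setT (EFin \o f) ->
  (lebesgue_rV R n).-integrable setT (EFin \o (fun x => f (x + a))).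
Proof.
move=> /integrableP[mf foo]; apply/integrableP; split.
  apply/measurable_EFinP.
  by apply: measurableT_comp (measurable_rV_add a); exact/measurable_EFinP.
rewrite (ge0_integral_rV_addr a (f := fun x => `|(f x)%:E|%E))//.
exact: measurableT_comp.
Qed.

Lemma Rintegral_rV_addr n (a : 'rV[R]_n) (f : 'rV[R]_n -> R) :
  (lebesgue_rV R n).-integrable setT (EFin \o f) ->
  \int[lebesgue_rV R n]_x f (x + a)%R = \int[lebesgue_rV R n]_x f x.
Proof.
move=> fi; rewrite /Rintegral; congr fine.
have mf : measurable_fun setT (EFin \o f) by exact: measurable_int fi.
transitivity (\int[pushforward (lebesgue_rV R n) (fun x : 'rV[R]_n => x + a)%R]_x (f x)%:E)%E.
  rewrite integral_pushforward//; first exact: measurable_rV_add.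
  exact: integrable_rV_addr.
apply: eq_measure_integral => [|? A mA _]; first exact: measurable_rV_add.
exact: lebesgue_rV_addr.
Qed.

End lebesgue_translation.

(** * Borel sets of row vectors *)

Section borel_rV.
Context {R : realType} {n : nat}.
Local Notation mu := (lebesgue_rV R n).
Implicit Types U A : set 'rV[R]_n.

Lemma continuous_coord_rV (j : 'I_n) : continuous (fun x : 'rV[R]_n => x ord0 j).
Proof. exact: coord_continuous. Qed.

(** The generating family of open sets is stable under intersection, as Dynkin's theorem
    requires. *)
Lemma measurable_rVE : @measurable _ 'rV[R]_n = <<s [set U : set 'rV[R]_n | open U] >>.
Proof.
apply/seteqP; split; last first.
  apply: smallest_sub; first exact: sigma_algebra_measurable.
  by move=> U; exact: measurable_mx_open.
apply: smallest_sub; first exact: smallest_sigma_algebra.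
move=> _ [[i j] _ [B mB <-]]; rewrite setTI (ord1 i) /mx_coord/=.
suff : measurable_fun [set: g_sigma_algebraType [set U : set 'rV[R]_n | open U]]
    (fun x : 'rV[R]_n => (x ord0 j : measurableTypeR R)).
  by move=> /(_ measurableT _ mB); rewrite setTI.
apply: (measurability (@RGenOpens.G R)) => [|_ [_ [u [v ->]] <-]].
  exact: RGenOpens.measurableE.
rewrite setTI; apply: sub_sigma_algebra.
have := @continuous_coord_rV j; move/continuousP; apply.
exact: itv_open.
Qed.

Lemma continuous_measurable_rV (f : 'rV[R]_n -> R) :
  continuous f -> measurable_fun setT f.
Proof.
move=> /continuousP cf.
apply: (measurability (@RGenOpens.G R)) => [|_ [_ [u [v ->]] <-]].
  exact: RGenOpens.measurableE.
by rewrite setTI; apply: measurable_mx_open; apply: cf; exact: itv_open.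
Qed.

Lemma closed_measurable_rV A : closed A -> measurable A.
Proof.
move=> cA; rewrite -[A]setCK; apply: measurableC; apply: measurable_mx_open.
exact: closed_openC.
Qed.

(** The sets over which the integral vanishes form a Dynkin class, and it contains the open sets, a
    pi-system generating all measurable sets; so the integral vanishes over every measurable part of
    [U]. *)
Lemma integrable_ae_eq0 U (f : 'rV[R]_n -> R) : measurable U ->
  mu.-integrable U (EFin \o f) ->
  (forall O, open O -> \int[mu]_(x in U `&` O) f x = 0) ->
  {ae mu, forall x, U x -> f x = 0}.
Proof.
move=> mU fi f0.
have fi' A : measurable A -> mu.-integrable (U `&` A) (EFin \o f).
  by move=> mA; apply: integrableS fi => //; exact: measurableI.
have h A : measurable A -> (\int[mu]_(x in U `&` A) (f x)%:E = 0)%E.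
  rewrite measurable_rVE.
  apply: (@dynkin_induction _ _ [set U : set 'rV[R]_n | open U]
     (fun A => (\int[mu]_(x in U `&` A) (f x)%:E = 0)%E)).
  - exact: measurable_rVE.
  - by move=> A1 A2 /= o1 o2; exact: openI.
  - have := congr1 (@EFin R) (f0 _ openT); rewrite /Rintegral fineK//.
    by apply: integrable_fin_num (fi' _ _) => //; exact: measurableI.
  - move=> O oO; have := congr1 (@EFin R) (f0 _ oO); rewrite /Rintegral fineK//.
    apply: integrable_fin_num (fi' _ _) => //; last exact: measurable_mx_open.
    by apply: measurableI => //; exact: measurable_mx_open.
  - move=> S mS S0.
    have fU : (\int[mu]_(x in U) (f x)%:E = 0)%E.
      have := congr1 (@EFin R) (f0 _ openT); rewrite setIT /Rintegral fineK//.
      exact: integrable_fin_num.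
    have := fU; rewrite -{1}(setUIDK U S) integral_setU_EFin//.
    + by rewrite S0 add0e.
    + exact: measurableI.
    + exact: measurableD.
    + by apply/measurable_EFinP; rewrite setUIDK; exact: measurable_int fi.
    + by rewrite disj_set2E; apply/eqP/seteqP; split=> x //= [[_ ?] [_]].
  - move=> F mF tF F0; rewrite setI_bigcupr integral_bigcup.
    + by apply: eseries0 => i _ _; exact: F0.
    + exact: trivIset_setIl.
    + by move=> k; exact: measurableI.
    + by rewrite -setI_bigcupr; apply: fi'; exact: bigcupT_measurable.
have : ae_eq mu U (EFin \o f) (cst 0%E).
  apply: integral_ae_eq => //.
  move=> E EU mE; rewrite -(setIidr EU) h// integral0_eq//.
by apply: filterS => x fx Ux; have [] := fx Ux.
Qed.

Lemma bounded_lebesgue_lty A : bounded_set A -> measurable A -> (mu A < +oo)%E.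
Proof.
move=> bA mA.
have [M [M0 MA]] : exists M, 0 < M /\ forall x, A x -> `|x| <= M.
  have [M0 [_ h]] := bA; exists (`|M0| + 1); split; first by rewrite ltr_wpDl.
  by move=> x Ax; apply: h => //; rewrite (le_lt_trans (ler_norm _))// ltrDl.
pose B := [set x : 'rV[R]_n | forall i, x ord0 i \in
  `[(const_mx (- M) : 'rV[R]_n) ord0 i, (const_mx M : 'rV[R]_n) ord0 i]].
have mB : measurable B.
  rewrite (_ : B = \bigcap_(i in [set: 'I_n])
      (fun x : 'rV[R]_n => x ord0 i) @^-1` `[- M, M]%classic).
    apply: fin_bigcap_measurable => [|i _]; first exact: finite_finset.
    rewrite -[X in measurable X]setTI.
    by apply: measurable_mx_coord => //; exact: measurable_itv.
  by apply/seteqP; split=> [x /= h i _ /=|x h i]; [have := h i|have := h i I];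
    rewrite /= !mxE.
apply: (@le_lt_trans _ _ (mu B)).
  apply: le_measure; rewrite ?inE// => x /MA xM i; rewrite !mxE in_itv/= -ler_norml.
  apply: le_trans xM; rewrite /Num.Def.normr/= mx_normrE.
  by apply: (le_bigmax _ (fun ij => `|x ij.1 ij.2|) (ord0, i)).
rewrite lebesgue_rV_box ?ltry// => i; rewrite !mxE.
by rewrite (@le_trans _ _ 0)// ?oppr_le0 ltW.
Qed.

End borel_rV.

(** * Smooth cutoff functions *)

Section flat.
Context {R : realType}.

(** For [k = 0] this is the classical function exp(-1/y), flat at 0. Powers of 1/y are carried along
    so that derivatives of members of the family are combinations of members. *)
Definition flat (k : nat) (y : R) : R :=
  if 0 < y then y^-1 ^+ k * expR (- y^-1) else 0.

Lemma flat_pos k y : 0 < y -> flat k y = y^-1 ^+ k * expR (- y^-1).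
Proof. by rewrite /flat => ->. Qed.

Lemma flat_npos k y : y <= 0 -> flat k y = 0.
Proof. by rewrite /flat ltNge => ->. Qed.

Lemma flat_ge0 k y : 0 <= flat k y.
Proof.
rewrite /flat; case: ifPn => // y0.
by rewrite mulr_ge0 ?expR_ge0// exprn_ge0// invr_ge0 ltW.
Qed.

Lemma flat_gt0 k y : 0 < y -> 0 < flat k y.
Proof. by move=> y0; rewrite flat_pos// mulr_gt0 ?expR_gt0// exprn_gt0 ?invr_gt0. Qed.

(** With z = 1/y, the inequality exp z >= 1 + z^(k+1) / (k+1)! gives z^k exp(-z) <= (k+1)! / z. *)
Lemma flat_le k y : flat k y <= k.+1`!%:R * `|y|.
Proof.
have [y0|y0] := ltP 0 y; last by rewrite flat_npos// mulr_ge0.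
rewrite flat_pos// (gtr0_norm y0) expRN.
have z0 : 0 < y^-1 by rewrite invr_gt0.
rewrite ler_pdivrMr ?expR_gt0//.
apply: (@le_trans _ _ (k.+1`!%:R * y * (1 + y^-1 ^+ k.+1 / k.+1`!%:R))).
  rewrite mulrDr mulr1.
  have -> : k.+1`!%:R * y * (y^-1 ^+ k.+1 / k.+1`!%:R) = y^-1 ^+ k.
    have fn0 : k.+1`!%:R != 0 :> R by rewrite pnatr_eq0 -lt0n fact_gt0.
    have yn0 : y != 0 by rewrite gt_eqF.
    by rewrite exprS; field; rewrite yn0 fn0.
  by rewrite lerDr mulr_ge0// ltW.
rewrite ler_wpM2l ?mulr_ge0 ?(ltW y0)//.
by apply: expR_ge1Dxn; exact: ltW.
Qed.

Lemma is_derive_flat k (y : R) :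
  is_derive y 1 (flat k) (flat k.+2 y - k%:R * flat k.+1 y).
Proof.
have [y0|y0|->] := ltgtP y 0.
- rewrite !flat_npos ?ltW// mulr0 subr0.
  apply: (@near_eq_is_derive _ _ _ (cst 0)).
  by near=> z; rewrite flat_npos//; near: z; exact: lt_le_nbhsl.
- have yn0 : y != 0 by rewrite gt_eqF.
  apply: (@near_eq_is_derive _ _ _ (fun z : R => z^-1 ^+ k * expR (- z^-1))).
    by near=> z; rewrite flat_pos//; near: z; exact: lt_nbhsr.
  have vy : is_derive y 1 (fun z : R => z^-1) (- y ^- 2).
    have := is_deriveV yn0 (is_derive_id y (1 : R)).
    by rewrite /GRing.scale/= mulr1.
  have ny : is_derive y 1 (fun z : R => - z^-1) (y ^- 2).
    by have := is_deriveN vy; rewrite opprK.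
  have ey : is_derive y 1 (fun z : R => expR (- z^-1)) (expR (- y^-1) * y ^- 2).
    have d1 : derivable (fun z : R => - z^-1) y 1 by have [] := ny.
    apply: DeriveDef.
      apply/derivable1_diffP.
      apply: (@differentiable_comp _ _ _ _ (fun z : R => - z^-1) expR).
        exact/derivable1_diffP.
      exact/derivable1_diffP/derivable_expR.
    rewrite -derive1E (derive1_comp (f := fun z : R => - z^-1) (g := expR))//.
    rewrite !derive1E (@derive_val _ _ _ _ _ _ _ ny).
    by rewrite (@derive_val _ _ _ _ _ _ _ (is_derive_expR _)).
  have py : is_derive y 1 (fun z : R => z^-1 ^+ k) (- (k%:R * y^-1 ^+ k.+1)).
    have := is_deriveX k vy; rewrite /GRing.scale/=.
    rewrite (_ : (fun z : R => z^-1) ^+ k = (fun z : R => z^-1 ^+ k)); last exact/exprfctE.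
    rewrite (_ : _ * - _ = - (k%:R * y^-1 ^+ k.+1))//.
    rewrite mulrN; congr (- _); case: (k) => [|m]; first by rewrite !mul0r.
    by rewrite -mulrA -exprVn -exprD addn2.
  have := is_deriveM py ey.
  rewrite !flat_pos// /GRing.scale/=.
  set E := expR _; rewrite (_ : _ + _ = y^-1 ^+ k.+2 * E - k%:R * (y^-1 ^+ k.+1 * E))//.
  by rewrite !exprS; field.
- rewrite !flat_npos// mulr0 subr0.
  have h : h^-1 *: ((flat k \o shift 0) (h *: (1 : R)) - flat k 0) @[h --> (0 : R)^'] --> (0 : R).
    rewrite (flat_npos k (lexx 0)).
    apply/cvgr0Pnorm_lt => e e0.
    (* For h > 0 the difference quotient of [flat k] at 0 is [flat k.+1 h], so the factorial bound
       is taken at index k + 1. *)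
    pose C := k.+2`!%:R : R.
    have C0 : 0 < C by rewrite ltr0n fact_gt0.
    near=> h; have hn0 : h != 0 by near: h; exact: nbhs_dnbhs_neq.
    rewrite subr0 /= addr0 [h *: 1]mulr1 normrM.
    apply: (@le_lt_trans _ _ (C * `|h|)).
      have [h0|h0] := ltP 0 h; last first.
        by rewrite flat_npos// normr0 mulr0 mulr_ge0// ltW.
      have := flat_le k.+1 h; rewrite !flat_pos// exprS -mulrA.
      rewrite [`|_ ^+ k * _|]ger0_norm ?mulr_ge0 ?expR_ge0 ?exprn_ge0 ?invr_ge0 ?(ltW h0)//.
      by rewrite normfV (gtr0_norm h0).
    rewrite mulrC -ltr_pdivlMr//.
    near: h; apply: dnbhs0_lt; exact: divr_gt0.
  apply: DeriveDef; first by apply/cvg_ex; exists 0.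
  exact: cvg_lim h.
Unshelve. all: by end_near. Qed.

Lemma differentiable_flat k (y : R) : differentiable (flat k) y.
Proof. by apply/derivable1_diffP; have [] := is_derive_flat k y. Qed.

End flat.

Section smooth_algebra.
Context {R : realType} {N : nat}.
Local Notation T := 'rV[R]_N.
Local Notation e_ i := (delta_mx (ord0 : 'I_1) i : T).

(* A class of differentiable functions closed under [partial]. *)
Inductive elementary_smooth : (T -> R) -> Prop :=
| es_smooth f : smooth f -> elementary_smooth f
| es_cst c : elementary_smooth (fun=> c)
| es_coord i : elementary_smooth (fun x => x ord0 i)
| es_add f g : elementary_smooth f -> elementary_smooth g ->
    elementary_smooth (fun x => f x + g x)
| es_mul f g : elementary_smooth f -> elementary_smooth g ->
    elementary_smooth (fun x => f x * g x)
| es_flat k f : elementary_smooth f -> elementary_smooth (fun x => flat k (f x))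
| es_inv f : elementary_smooth f -> (forall x, f x != 0) ->
    elementary_smooth (fun x => (f x)^-1).

Lemma es_differentiable f : elementary_smooth f -> forall x, differentiable f x.
Proof.
elim=> {f} [f sf|c|i|f g _ df _ dg|f g _ df _ dg|k f _ df|f _ df f0] x.
- exact: (sf [::] x).
- exact: differentiable_cst.
- exact: differentiable_coord.
- exact: differentiableD.
- exact: differentiableM.
- by apply: (@differentiable_comp _ _ _ _ f (flat k)) => //; exact: differentiable_flat.
- exact: differentiableV.
Qed.

Lemma partial_cst (c : R) i : partial i (fun=> c) = (fun=> 0) :> (T -> R).
Proof. by apply/funext => x; rewrite /partial derive_cst. Qed.

Lemma partialD (f g : T -> R) i : (forall x, differentiable f x) ->
  (forall x, differentiable g x) ->
  partial i (fun x => f x + g x) = (fun x => partial i f x + partial i g x).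
Proof.
by move=> df dg; apply/funext => x; rewrite /partial deriveD//; exact: diff_derivable.
Qed.

Lemma partialM (f g : T -> R) i : (forall x, differentiable f x) ->
  (forall x, differentiable g x) ->
  partial i (fun x => f x * g x) =
  (fun x => f x * partial i g x + g x * partial i f x).
Proof.
by move=> df dg; apply/funext => x; rewrite /partial deriveM//; exact: diff_derivable.
Qed.

Lemma partial_coord i j : partial i (fun x : T => x ord0 j) = (fun=> (j == i)%:R).
Proof.
apply/funext => x; rewrite /partial deriveE; last exact: differentiable_coord.
have @f : {linear T -> R}.
  by exists (fun M : T => M ord0 j); do 2![eexists]; do ?[constructor];
     rewrite ?mxE// => ? *; rewrite ?mxE//; move=> ?; rewrite !mxE.
rewrite (_ : (fun x => _) = f) // diff_lin; last exact: coord_continuous.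
by rewrite /= mxE eqxx.
Qed.

Lemma partial_flat k (f : T -> R) i : (forall x, differentiable f x) ->
  partial i (fun x => flat k (f x)) =
  (fun x => (flat k.+2 (f x) + (- k%:R) * flat k.+1 (f x)) * partial i f x).
Proof.
move=> df; apply/funext => x.
rewrite /partial (_ : (fun x => _) = flat k \o f)// deriveE; last first.
  by apply: differentiable_comp => //; exact: differentiable_flat.
rewrite diff_comp//; last exact: differentiable_flat.
rewrite /= diff1E; last exact: differentiable_flat.
rewrite -deriveE// derive1E (@derive_val _ _ _ _ _ _ _ (is_derive_flat k (f x))).
by rewrite /GRing.scale/= mulrC mulNr.
Qed.

Lemma partial_inv (f : T -> R) i : (forall x, differentiable f x) ->
  (forall x, f x != 0) ->
  partial i (fun x => (f x)^-1) =
  (fun x => (-1) * ((f x)^-1 * (f x)^-1 * partial i f x)).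
Proof.
move=> df f0; apply/funext => x; rewrite /partial deriveV//; last exact: diff_derivable.
by rewrite /GRing.scale/= expr2 invfM !mulNr mul1r.
Qed.

Lemma smooth_partial (f : T -> R) i : smooth f -> smooth (partial i f).
Proof. by move=> sf s x; rewrite -foldr_rcons; exact: sf. Qed.

Lemma es_partial f i : elementary_smooth f -> elementary_smooth (partial i f).
Proof.
elim=> {f} [f sf|c|j|f g sf pf sg pg|f g sf pf sg pg|k f sf pf|f sf pf f0].
- by apply: es_smooth; exact: smooth_partial.
- by rewrite partial_cst; exact: es_cst.
- by rewrite partial_coord; exact: es_cst.
- rewrite partialD; [exact: es_add|exact: es_differentiable..].
- rewrite partialM; [|exact: es_differentiable..].
  by apply: es_add; exact: es_mul.
- rewrite partial_flat; last exact: es_differentiable.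
  apply: es_mul => //; apply: es_add; first exact: es_flat.
  by apply: es_mul; [exact: es_cst|exact: es_flat].
- rewrite partial_inv//; last exact: es_differentiable.
  apply: es_mul; first exact: es_cst.
  by apply: es_mul => //; apply: es_mul; exact: es_inv.
Qed.

Lemma elementary_smooth_smooth f : elementary_smooth f -> smooth f.
Proof.
move=> ef s; apply: es_differentiable.
by elim: s => //= i s; exact: es_partial.
Qed.

Lemma smooth_differentiable (f : T -> R) : smooth f -> forall x, differentiable f x.
Proof. by move=> sf x; exact: (sf [::] x). Qed.

Lemma smooth_continuous (f : T -> R) : smooth f -> continuous f.
Proof. by move=> sf x; apply: differentiable_continuous; exact: smooth_differentiable. Qed.

Lemma smoothM (f g : T -> R) : smooth f -> smooth g -> smooth (fun x => f x * g x).
Proof.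
by move=> sf sg; apply: elementary_smooth_smooth; apply: es_mul; exact: es_smooth.
Qed.

Lemma es_sum (I : Type) (r : seq I) (F : I -> T -> R) :
  (forall i, elementary_smooth (F i)) -> elementary_smooth (fun x => \sum_(i <- r) F i x).
Proof.
move=> eF; elim: r => [|i r IH].
  by under eq_fun do rewrite big_nil; exact: es_cst.
by under eq_fun do rewrite big_cons; exact: es_add.
Qed.

(** The bump is exp(-1/y) at y = r^2 - |x - x0|^2 for the squared Euclidean distance, a polynomial.
    It vanishes off the closed ball of the sup norm, since one coordinate larger than r already
    makes y nonpositive. *)
Lemma smooth_bump (U : set T) (x0 : T) : open U -> U x0 ->
  exists (b : T -> R) (Z : set T), [/\ elementary_smooth b, forall x, 0 <= b x, 0 < b x0,
    compact Z & Z `<=` U /\ forall x, b x != 0 -> Z x].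
Proof.
move=> oU Ux0.
have /nbhs_closedballP[r rU] : nbhs x0 U by exact: open_nbhs_nbhs.
pose q (x : T) := \sum_i (x ord0 i - x0 ord0 i) ^+ 2.
exists (fun x => flat 0 (r%:num ^+ 2 - q x)), (closed_ball x0 r%:num); split.
- apply: es_flat; apply: es_add; first exact: es_cst.
  rewrite (_ : (fun x => _) = (fun x => -1 * q x)); last by apply/funext => x; rewrite mulN1r.
  apply: es_mul; first exact: es_cst.
  apply: es_sum => i; under eq_fun do rewrite expr2.
  by apply: es_mul; apply: es_add; by [exact: es_coord|exact: es_cst].
- by move=> x; exact: flat_ge0.
- apply: flat_gt0; rewrite /q big1 ?subr0 ?exprn_gt0// => i _.
  by rewrite subrr expr0n.
- apply: bounded_closed_compact; last exact: closed_ball_closed.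
  exists (`|x0| + r%:num); split; first exact: num_real.
  move=> M rM x; rewrite closed_ballE// /closed_ball_ /= => xr.
  apply/ltW/(le_lt_trans _ rM); rewrite -[x](subrK x0) addrC.
  by rewrite (le_trans (ler_normD _ _))// lerD2l distrC.
- split; first exact: rU.
  move=> x; apply: contraNP; rewrite closed_ballE// /closed_ball_ /= => /negP.
  rewrite -ltNge => rx; rewrite flat_npos// subr_le0.
  have [i xi] : exists i, r%:num < `|x0 ord0 i - x ord0 i|.
    apply: contrapT => /forallNP nx; move: rx; apply/negP; rewrite -leNgt.
    rewrite /Num.Def.normr/= mx_normrE; apply: bigmax_le => // -[i j] _ /=.
    by rewrite (ord1 i) !mxE leNgt; apply/negP/nx.
  apply: (@le_trans _ _ ((x ord0 i - x0 ord0 i) ^+ 2)).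
    rewrite -[leRHS]real_normK ?num_real// lerXn2r ?nnegrE// distrC ltW//.
  by rewrite /q (bigD1 i)//= lerDl sumr_ge0// => j _; rewrite sqr_ge0.
Qed.

Lemma compact_cover_seq (S : set T) (f : T -> set T) : compact S ->
  (forall x, S x -> open (f x)) -> (forall x, S x -> f x x) ->
  exists s : seq T, (forall x, x \in s -> S x) /\
    forall x, S x -> exists2 y, y \in s & f y x.
Proof.
rewrite compact_cover => cS of_ fx.
have [x Sx|D DS Dcov] := cS T S f of_; first by exists x => //; exact: fx.
exists (finmap.enum_fset D); split => [x xD|x /Dcov[y yD fyx]]; last by exists y.
by have := DS _ xD; rewrite inE.
Qed.

(** A finite sum [B] of bumps is at least some c > 0 on [S]. With [B' = B / c], the quotient
    flat(B') / (flat(B') + flat(1 - B')) is 1 where B >= c and 0 where B = 0. *)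
Lemma smooth_cutoff (S U : set T) : compact S -> open U -> S `<=` U ->
  exists chi, [/\ test_function U chi, forall x, 0 <= chi x <= 1 &
    forall x, S x -> chi x = 1].
Proof.
move=> cS oU SU.
have /choice[bZ bZP] x0 : exists bZ : (T -> R) * set T, S x0 ->
   [/\ elementary_smooth bZ.1, forall x, 0 <= bZ.1 x, 0 < bZ.1 x0,
    compact bZ.2 & bZ.2 `<=` U /\ forall x, bZ.1 x != 0 -> bZ.2 x].
  have [Sx0|?] := pselect (S x0); last by exists (cst 0, set0).
  by have [b [Z [? ? ? ? ?]]] := smooth_bump oU (SU _ Sx0); exists (b, Z).
pose b x0 : T -> R := if `[< S x0 >] then (bZ x0).1 else cst 0.
have eb x0 : elementary_smooth (b x0).
  rewrite /b; case: asboolP => [Sx0|_]; last exact: es_cst.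
  by have [] := bZP _ Sx0.
have b0 x0 x : 0 <= b x0 x.
  rewrite /b; case: asboolP => //= Sx0.
  by have [] := bZP _ Sx0.
have [x0 _|x Sx|D [DS Dcov]] :=
    compact_cover_seq (f := fun x0 => [set x | 0 < b x0 x]) cS.
- have /continuousP : continuous (b x0).
    by move=> x; apply: differentiable_continuous; exact: es_differentiable.
  move=> /(_ [set y | 0 < y]); rewrite /preimage/=; apply.
  exact: open_gt.
- rewrite /= /b; case: asboolP => // Sx'.
  by have [] := bZP _ Sx'.
pose B x := \sum_(x0 <- D) b x0 x.
have eB : elementary_smooth B by exact: es_sum.
have B0 x : 0 <= B x by exact: sumr_ge0.
have Bpos x : S x -> 0 < B x.
  move=> /Dcov[x0 x0D /= bx]; rewrite /B (big_rem x0)//=.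
  by rewrite ltr_pwDl// sumr_ge0.
have cB : continuous B.
  by move=> x; apply: differentiable_continuous; exact: es_differentiable.
have [c c0 Sc] : exists2 c, 0 < c & forall x, S x -> c <= B x.
  have [[s Ss]|S0] := pselect (S !=set0); last first.
    by exists 1 => // x Sx; exfalso; apply: S0; exists x.
  have [||c cS' cP] := @EVT_min_rV R N B S _ cS.
  - by exists s.
  - exact: continuous_subspaceT.
  exists (B c); first by apply: Bpos; exact: set_mem.
  by move=> x Sx; apply: cP; exact: mem_set.
pose Z := \bigcup_(x0 in [set` D]) (bZ x0).2.
have cZ : compact Z.
  rewrite /Z bigcup_seq big_seq; apply: big_ind => [|A B'|x0 x0D].
  - exact: compact0.
  - exact: compactU.
  by have /bZP[] := DS _ x0D.
have ZU : Z `<=` U.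
  by move=> x [x0 /DS /bZP[_ _ _ _ [ZU _]]]; exact: ZU.
have BZ x : B x != 0 -> Z x.
  apply: contraNP => nZ; rewrite /B big_seq big1// => x0 x0D.
  have Sx0 := DS _ x0D; rewrite /b; case: asboolP => // Sx0'.
  have [_ _ _ _ [_ h]] := bZP _ Sx0.
  by apply/eqP; apply: contra_notT nZ => /h ?; exists x0.
pose B' x := c^-1 * B x.
(* [B'] and [1 - B'] are never both nonpositive, so the denominator is positive everywhere. *)
pose den x := flat 0 (B' x) + flat 0 (1 + (-1) * B' x).
have den0 x : 0 < den x.
  rewrite /den; have [h|h] := ltP 0 (B' x).
    by rewrite ltr_pwDl ?flat_gt0 ?flat_ge0.
  by rewrite ltr_wpDl ?flat_ge0// flat_gt0// mulN1r subr_gt0 (le_lt_trans h).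
pose chi x := flat 0 (B' x) * (den x)^-1.
have eB' : elementary_smooth B' by apply: es_mul => //; exact: es_cst.
have schi : smooth chi.
  apply: elementary_smooth_smooth; apply: es_mul; first exact: es_flat.
  apply: es_inv => [|x]; last by rewrite gt_eqF.
  apply: es_add; first exact: es_flat.
  apply: es_flat; apply: es_add; first exact: es_cst.
  by apply: es_mul => //; exact: es_cst.
have chiZ : closure [set x | chi x != 0] `<=` Z.
  have clZ : closed Z by apply: compact_closed => //; exact: norm_hausdorff.
  rewrite [X in _ `<=` X]((closure_id Z).1 clZ); apply: closureS => x /= chix; apply: BZ.
  apply: contra chix => /eqP Bx; rewrite /chi /B' Bx mulr0 flat_npos// mul0r.
  by [].
exists chi; split.
- split=> //; last exact: subset_trans chiZ ZU.
  by apply: subclosed_compact chiZ => //; exact: closed_closure.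
- move=> x; rewrite /chi mulr_ge0 ?flat_ge0 ?invr_ge0 ?(ltW (den0 _))//=.
  by rewrite ler_pdivrMr// mul1r /den lerDl flat_ge0.
- move=> x Sx; rewrite /chi /den [X in _ + X]flat_npos ?addr0 ?divff// ?gt_eqF//.
    apply: flat_gt0; by rewrite mulr_gt0 ?invr_gt0// Bpos.
  by rewrite mulN1r subr_le0 /B' mulrC ler_pdivlMr// mul1r Sc.
Qed.

(** [U] is exhausted by the compact sets of points of norm at most j whose distance to the
    complement is at least 1 / (j + 1); each of them receives a cutoff. *)
Lemma cutoff_sequence (U : set T) : open U ->
  exists chi : nat -> T -> R, [/\ forall j, test_function U (chi j),
    forall j x, 0 <= chi j x <= 1 &
    forall x, U x -> \forall j \near \oo, chi j x = 1].
Proof.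
move=> oU.
pose S (j : nat) := [set x : T | `|x| <= j%:R] `&`
  \bigcap_(y in ~` U) [set x : T | j.+1%:R^-1 <= `|x - y|].
have cS j : compact (S j).
  apply: bounded_closed_compact.
    exists j%:R; split; first exact: num_real.
    by move=> M jM x [/= xj _]; apply: ltW; exact: le_lt_trans jM.
  apply: closedI.
    apply: (@closed_comp _ _ (fun x : T => `|x|) [set y : R | y <= j%:R]).
      by move=> x _; exact: norm_continuous.
    exact: closed_le.
  apply: closed_bigI => y _.
  apply: (@closed_comp _ _ (fun x : T => `|x - y|) [set z : R | j.+1%:R^-1 <= z]).
    move=> x _; apply: (@continuous_comp _ _ _ (fun x : T => x - y) (fun z : T => `|z|)).
      by apply: continuousB; [exact: id|exact: cst_continuous].
    exact: norm_continuous.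
  exact: closed_ge.
have SU j : S j `<=` U.
  move=> x [_ h]; apply: contrapT => nUx.
  by have := h x nUx; rewrite /= subrr normr0 leNgt invr_gt0 ltr0n.
have /choice[chi chiP] j := smooth_cutoff (cS j) oU (@SU j).
exists chi; split=> [j|j|x Ux]; [by case: (chiP j)..|].
have /nbhs_ballP[e /= e0 eU] : nbhs x U by exact: open_nbhs_nbhs.
have [n0 n0P] := natSinv_lt e0.
have [n1 xn1] : exists n1 : nat, `|x| <= n1%:R.
  by exists (Num.truncn `|x|).+1; apply: ltW; exact: truncnS_gt.
exists (maxn n0 n1) => // j /=; rewrite geq_max => /andP[n0j n1j].
have [_ _] := chiP j; apply; split=> [|y nUy] /=.
  by apply: le_trans xn1 _; rewrite ler_nat.
rewrite leNgt; apply: contra_notN nUy => xy.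
by apply: eU; rewrite /ball_ /= -ball_normE/= (lt_trans xy)// n0P.
Qed.

End smooth_algebra.

(** * Weak gradients *)

Section Rintegral_dominated.
Context d (T : measurableType d) (R : realType).
Variable mu : {measure set T -> \bar R}.

Lemma Rintegral_dominated_cvg (D : set T) (f_ : nat -> T -> R) (f g : T -> R) :
  measurable D -> (forall n, measurable_fun D (f_ n)) -> measurable_fun D f ->
  {ae mu, forall x, D x -> f_ n x @[n --> \oo] --> f x} ->
  mu.-integrable D (EFin \o g) -> (forall n x, D x -> `|f_ n x| <= g x) ->
  \int[mu]_(x in D) f_ n x @[n --> \oo] --> \int[mu]_(x in D) f x.
Proof.
move=> mD mf_ mf f_f ig fg.
have [||||| fi _ c] := @dominated_convergence _ _ _ mu D mD
  (fun n x => (f_ n x)%:E) (EFin \o f) (EFin \o g).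
- by move=> n; exact/measurable_EFinP.
- exact/measurable_EFinP.
- apply: filterS f_f => x fx Dx; apply: cvg_EFin; first exact: nearW.
  exact: fx.
- exact: ig.
- by apply: aeW => x n Dx /=; rewrite lee_fin fg.
apply: fine_cvg; rewrite /Rintegral fineK//.
exact: integrable_fin_num.
Qed.

End Rintegral_dominated.

Section test_functions.
Context {R : realType} {N : nat}.
Local Notation T := 'rV[R]_N.
Local Notation mu := (lebesgue_rV R N).
Implicit Types (U V D : set T) (f g h phi psi chi : T -> R).

Lemma ext0E D f : ext0 D f = f \_ D. Proof. by []. Qed.

Lemma ext0_in (V' : zmodType) D (f : T -> V') x : D x -> ext0 D f x = f x.
Proof. by move=> Dx; rewrite /ext0 /patch mem_set. Qed.

Lemma ext0_out (V' : zmodType) D (f : T -> V') x : ~ D x -> ext0 D f x = 0.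
Proof. by move=> Dx; rewrite /ext0 /patch memNset. Qed.

Lemma near_eq_partial f g i (x : T) :
  (\forall y \near x, f y = g y) -> \forall y \near x, partial i f y = partial i g y.
Proof.
by move=> /near_join; apply: filterS => y fg; exact: near_eq_derive.
Qed.

Lemma near_eq_partials f g s (x : T) : (\forall y \near x, f y = g y) ->
  \forall y \near x, foldr partial f s y = foldr partial g s y.
Proof. by move=> fg; elim: s => //= i s; exact: near_eq_partial. Qed.

(** The first-order expansion at [x] involves only values near [x], so the differential of [g]
    serves for [f]. *)
Lemma near_eq_differentiable f g (x : T) : (\forall y \near x, f y = g y) ->
  differentiable g x -> differentiable f x.
Proof.
move=> fg dg.
have fgx : f x = g x := nbhs_singleton fg.
have cdg : continuous ('d g x) by have /diff_locallyP[] := dg.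
have e : f \o shift x = cst (f x) + 'd g x +o_ (0 : T) id.
  have /diff_locallyP[_ /eqaddoP h] := dg.
  have fg0 : \forall y \near (0 : T), f (y + x) = g (y + x).
    have /nbhs_ballP[e /= e0 eP] := fg.
    apply/nbhs_ballP; exists e => // y; rewrite -ball_normE /ball_ /= sub0r normrN => ye.
    by apply: eP; rewrite -ball_normE /ball_ /= opprD addrCA subrr addr0 normrN.
  apply/eqaddoP => eps eps0; have := h eps eps0; apply: filterS2 fg0 => y.
  by rewrite !fctE /= => -> ; rewrite fgx.
apply/diff_locallyP; rewrite (diff_unique cdg e); split => //.
Qed.

Lemma smooth_local f : (forall x : T, exists2 g, smooth g & \forall y \near x, f y = g y) ->
  smooth f.
Proof.
move=> fl s x; have [g sg fg] := fl x.
have h := near_eq_partials s fg.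
have dg := sg s x.
exact: near_eq_differentiable h dg.
Qed.

Lemma test_functionS U V phi : U `<=` V -> test_function U phi -> test_function V phi.
Proof. by move=> UV [s c UU]; split=> //; exact: subset_trans UU UV. Qed.

Lemma test_function_out U phi x : test_function U phi -> ~ U x -> phi x = 0.
Proof.
move=> [_ _ h] nUx; apply: contra_notP nUx => /eqP px; apply: h.
exact: subset_closure.
Qed.

Lemma near_support0 phi x : ~ closure [set y | phi y != 0] x ->
  \forall y \near x, phi y = 0.
Proof.
move=> nc; have : nbhs x (~` closure [set y | phi y != 0]).
  by apply: open_nbhs_nbhs; split => //; apply: closed_openC; exact: closed_closure.
by apply: filterS => y ncy; apply: contra_notP ncy => /eqP py; exact: subset_closure.
Qed.

Lemma closure_sub_support phi f : (forall x, ~ closure [set y | phi y != 0] x -> f x = 0) ->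
  closure [set y | f y != 0] `<=` closure [set y | phi y != 0].
Proof.
move=> h; rewrite [X in _ `<=` X]((closure_id _).1 (@closed_closure _ _)).
by apply: closureS => x /= /eqP fx; apply: contrapT => /h.
Qed.

Lemma test_function_sub U phi f : smooth f ->
  (forall x, ~ closure [set y | phi y != 0] x -> f x = 0) ->
  test_function U phi -> test_function U f.
Proof.
move=> sf h [_ cphi phiU]; have hs := closure_sub_support h.
split=> //; last exact: subset_trans hs phiU.
by apply: subclosed_compact hs => //; exact: closed_closure.
Qed.

Lemma test_functionM U phi h : smooth h -> test_function U phi ->
  test_function U (fun x => h x * phi x).
Proof.
move=> sh tphi; apply: (test_function_sub _ _ tphi).
  by apply: smoothM => //; case: tphi.
by move=> x /near_support0/nbhs_singleton ->; rewrite mulr0.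
Qed.

Lemma test_function_partial U phi i : test_function U phi ->
  test_function U (partial i phi).
Proof.
move=> tphi; apply: (test_function_sub _ _ tphi).
  by apply: smooth_partial; case: tphi.
move=> x /near_support0 px; rewrite /partial (near_eq_derive _ (g := cst 0))//.
exact: derive_cst.
Qed.

Lemma test_function_bounded U phi : test_function U phi ->
  exists2 M, 0 <= M & forall x, `|phi x| <= M.
Proof.
move=> [sphi cphi _].
have cc : continuous phi := smooth_continuous sphi.
have [[x0 x0S]|S0] := pselect (closure [set x | phi x != 0] !=set0); last first.
  exists 0 => // x; rewrite normr_le0; apply: contra_notT S0 => px.
  by exists x; exact: subset_closure.
have [||c _ cP] := @EVT_max_rV R N (fun x => `|phi x|) _ _ cphi.
- by exists x0.
- apply: continuous_subspaceT => x.
  by apply: continuous_comp; [exact: cc|exact: norm_continuous].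
exists `|phi c| => // x.
have [px|px] := pselect (closure [set x | phi x != 0] x); first exact/cP/mem_set.
by rewrite (nbhs_singleton (near_support0 px)) normr0.
Qed.

Lemma test_function_measurable U phi : test_function U phi -> measurable_fun setT phi.
Proof. by move=> [sphi _ _]; apply: continuous_measurable_rV; exact: smooth_continuous. Qed.

Lemma test_function_L2 U phi : test_function U phi -> L2fun mu phi.
Proof.
move=> tphi; have [M M0 phiM] := test_function_bounded tphi.
pose S := closure [set x | phi x != 0].
have mS : measurable S by apply: closed_measurable_rV; exact: closed_closure.
have Soo : (mu S < +oo)%E.
  by apply: bounded_lebesgue_lty => //; apply: compact_bounded; case: tphi.
apply: (L2fun_dom (g := \1_S) (c := M ^+ 2)).
- exact: L2fun_indic.
- exact: test_function_measurable tphi.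
- move=> x; rewrite indicE; have [Sx|Sx] := pselect (S x).
    rewrite mem_set// expr1n mulr1 -[leLHS]real_normK ?num_real//.
    by rewrite lerXn2r ?nnegrE.
  by rewrite memNset// (nbhs_singleton (near_support0 Sx)) expr0n mulr0.
Qed.

(** For open [O], cutoffs inside the intersection of [U] and [O] converge pointwise to its
    indicator; by dominated convergence the integral of [f] over this intersection vanishes. *)
Lemma fundamental_lemma U f : open U -> mu.-integrable U (EFin \o f) ->
  (forall psi, test_function U psi -> \int[mu]_(x in U) (f x * psi x) = 0) ->
  {ae mu, forall x, U x -> f x = 0}.
Proof.
move=> oU fi f0; have mU := measurable_mx_open oU.
have mf : measurable_fun U f by apply/measurable_EFinP; exact: measurable_int fi.
apply: integrable_ae_eq0 => // O oO; have mO := measurable_mx_open oO.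
have [chi [tchi chi01 chi1]] := cutoff_sequence (openI oU oO).
have c : \int[mu]_(x in U) (f x * chi j x) @[j --> \oo] -->
    \int[mu]_(x in U) (f x * \1_O x).
  apply: (Rintegral_dominated_cvg mU _ _ _ (integrable_norm fi)).
  - move=> n; apply: measurable_funM => //; apply: measurable_funTS.
    exact: test_function_measurable (tchi n).
  - by apply: measurable_funM => //; apply: measurable_funTS; exact: measurable_indic.
  - apply: aeW => x Ux; rewrite indicE; have [Ox|Ox] := pselect (O x).
      rewrite mem_set//; apply: cvgMl_tmp.
      apply: cvg_near_cst; exact: chi1.
    rewrite memNset//; apply: cvgMl_tmp; apply: cvg_near_cst.
    by apply: nearW => j; rewrite (test_function_out (tchi j))// => -[].
  - move=> n x Ux; rewrite normrM ler_piMr//.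
    by have /andP[? ?] := chi01 n x; rewrite ger0_norm.
rewrite (@Rintegral_mkcondr _ _ _ mu).
transitivity (\int[mu]_(x in U) (f x * \1_O x)).
  apply: eq_Rintegral => x _; rewrite patchE indicE.
  by case: (x \in O); rewrite ?mulr1 ?mulr0.
apply: (cvg_unique _ c) => //.
rewrite (_ : (fun j => _) = cst 0); first exact: cvg_cst.
apply/funext => j; apply: f0; apply: test_functionS (tchi j).
exact: subIsetl.
Qed.

Lemma L2fun_Rintegrable D f : measurable D -> (mu D < +oo)%E -> L2fun mu (f \_ D) ->
  mu.-integrable D (EFin \o f).
Proof.
move=> mD Doo L2f; apply/(integrable_mkcond _ mD).
have := L2funM_integrable L2f (L2fun_indic mD Doo).
apply: eq_integrable => // x _ /=.
by rewrite restrict_EFin /= !patchE indicE; case: (x \in D); rewrite ?mulr1 ?mulr0.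
Qed.

Lemma integrable_ext0M U (v : T -> R) psi V : measurable U -> test_function V psi ->
  L2fun mu (ext0 U v) -> mu.-integrable U (EFin \o (fun x => v x * psi x)).
Proof.
move=> mU tpsi L2v; apply/(integrable_mkcond _ mU).
have := L2funM_integrable L2v (test_function_L2 tpsi).
apply: eq_integrable => // x _ /=.
by rewrite restrict_EFin ext0E /= !patchE; case: (x \in U); rewrite ?mul0r.
Qed.

(** The weak gradient is tested with [h * phi]. The disjunction provides one compactly supported
    factor, which makes both terms of the product rule test functions; it allows a cutoff on the
    whole space with [phi] in [U], as well as a cutoff in [U] with [phi] on the whole space. *)
Lemma weak_leibniz U (u : T -> R) (Du : T -> T) h phi i : open U ->
  L2fun mu (ext0 U u) -> L2fun mu (ext0 U (fun x => Du x ord0 i)) ->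
  weak_gradient U u Du -> smooth h -> smooth phi ->
  test_function U (fun x => h x * phi x) ->
  (test_function setT h \/ test_function setT phi) ->
  \int[mu]_(x in U) (h x * u x * partial i phi x) =
  - \int[mu]_(x in U) ((h x * Du x ord0 i + partial i h x * u x) * phi x).
Proof.
move=> oU L2u L2Du wg sh sphi thphi tt.
have mU := measurable_mx_open oU.
have dh := smooth_differentiable sh; have dphi := smooth_differentiable sphi.
have t1 : test_function setT (fun x => h x * partial i phi x).
  case: tt => [th|tphi]; last first.
    by apply: test_functionM => //; exact: test_function_partial.
  under eq_fun do rewrite mulrC; apply: test_functionM => //; exact: smooth_partial.
have t2 : test_function setT (fun x => phi x * partial i h x).
  case: tt => [th|tphi].
    by apply: test_functionM => //; exact: test_function_partial.
  under eq_fun do rewrite mulrC; apply: test_functionM => //; exact: smooth_partial.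
have itest v psi V tpsi L2v := @integrable_ext0M U v psi V mU tpsi L2v.
have := wg i _ thphi; rewrite partialM//.
have -> : \int[mu]_(x in U) (u x * (h x * partial i phi x + phi x * partial i h x)) =
    \int[mu]_(x in U) (h x * u x * partial i phi x) +
    \int[mu]_(x in U) (u x * (phi x * partial i h x)).
  rewrite -RintegralD//.
  - by apply: eq_Rintegral => x _; rewrite mulrDr mulrA [u x * h x]mulrC.
  - have := itest _ _ _ t1 L2u; apply: eq_integrable => // x _ /=.
    by rewrite mulrA [u x * h x]mulrC.
  - exact: itest t2 L2u.
have -> : \int[mu]_(x in U) ((h x * Du x ord0 i + partial i h x * u x) * phi x) =
    \int[mu]_(x in U) (Du x ord0 i * (h x * phi x)) +
    \int[mu]_(x in U) (u x * (phi x * partial i h x)).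
  rewrite -RintegralD//.
  - by apply: eq_Rintegral => x _; ring.
  - exact: itest thphi L2Du.
  - exact: itest t2 L2u.
by move=> e; rewrite opprD -e addrK.
Qed.

Lemma weak_gradient_restrict U V u Du : V `<=` U ->
  weak_gradient U u Du -> weak_gradient V u Du.
Proof.
move=> VU wg i phi tphi.
have tpi := test_function_partial i tphi.
have e (F psi : T -> R) : test_function V psi ->
    \int[mu]_(x in V) (F x * psi x) = \int[mu]_(x in U) (F x * psi x).
  move=> tpsi; rewrite Rintegral_mkcond [RHS]Rintegral_mkcond.
  apply: eq_Rintegral => x _; rewrite !patchE.
  have [Vx|Vx] := pselect (V x); first by rewrite !mem_set//; exact: VU.
  by rewrite memNset//; case: ifP => // _; rewrite (test_function_out tpsi Vx) mulr0.
by rewrite !e//; apply: wg; exact: test_functionS tphi.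
Qed.

(** The part in [U] of the compact support of [phi] is again closed, because [V] is open and
    disjoint from [U]; so [phi \_ U] is locally either [phi] or 0. *)
Lemma test_function_patch U V phi : open U -> open V -> U `&` V = set0 ->
  test_function (U `|` V) phi ->
  test_function U (phi \_ U) /\
  forall i x, U x -> partial i (phi \_ U) x = partial i phi x.
Proof.
move=> oU oV UV0 tphi.
have inU x : U x -> \forall y \near x, (phi \_ U) y = phi y.
  move=> Ux; have : nbhs x U by exact: open_nbhs_nbhs.
  by apply: filterS => y Uy; rewrite patchE mem_set.
have outU x : ~ (U x /\ closure [set x | phi x != 0] x) ->
    \forall y \near x, (phi \_ U) y = 0.
  move=> nx; have [[Ux|Vx]|nUV] := pselect ((U `|` V) x).
  - have /near_support0 : ~ closure [set x | phi x != 0] x by move=> cx; apply: nx.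
    by apply: filterS => y py; rewrite patchE; case: ifP.
  - have : nbhs x V by exact: open_nbhs_nbhs.
    apply: filterS => y Vy; rewrite patchE memNset// => Uy.
    by have : (U `&` V) y by []; rewrite UV0.
  - have /near_support0 : ~ closure [set x | phi x != 0] x.
      by move=> cx; apply: nUV; case: tphi => _ _; apply.
    by apply: filterS => y py; rewrite patchE; case: ifP.
have hs : closure [set x | (phi \_ U) x != 0] `<=`
    U `&` closure [set x | phi x != 0].
  move=> x cx; apply: contrapT => /outU near0.
  by have [y [/= /eqP]] := cx _ near0.
split; last first.
  by move=> i x Ux; apply: near_eq_derive; exact: inU.
split.
- apply: smooth_local => x; have [[Ux cx]|nx] := pselect (U x /\ closure [set x | phi x != 0] x).
    by exists phi; [case: tphi|exact: inU].
  exists (cst 0); last exact: outU.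
  by apply: elementary_smooth_smooth; exact: es_cst.
- case: tphi => _ cphi _.
  apply: subclosed_compact cphi _; first exact: closed_closure.
  by move=> x /hs[].
- by move=> x /hs[].
Qed.

(** A test function of the union, cut down to [U], is a test function of [U], and on [V] both
    integrands vanish. *)
Lemma weak_gradient_ext0 U V u (Du : T -> T) : open U -> open V -> U `&` V = set0 ->
  weak_gradient U u Du -> weak_gradient (U `|` V) (ext0 U u) (ext0 U Du).
Proof.
move=> oU oV UV0 wg i phi tphi.
have [tU pU] := test_function_patch oU oV UV0 tphi.
have e (F H : T -> R) : (forall x, U x -> F x = H x) ->
    (forall x, ~ U x -> F x = 0) ->
    \int[mu]_(x in U `|` V) F x = \int[mu]_(x in U) H x.
  move=> FH F0; rewrite Rintegral_mkcond [RHS]Rintegral_mkcond.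
  apply: eq_Rintegral => x _; rewrite !patchE.
  have [Ux|Ux] := pselect (U x); first by rewrite !mem_set//; [exact: FH|left].
  by rewrite [in RHS]memNset//; case: ifP => // _; exact: F0.
rewrite (e _ (fun x => u x * partial i (phi \_ U) x)); last 2 first.
- by move=> x Ux; rewrite ext0_in// pU.
- by move=> x Ux; rewrite ext0_out// mul0r.
rewrite (e _ (fun x => Du x ord0 i * (phi \_ U) x)); last 2 first.
- by move=> x Ux; rewrite ext0_in// patchE mem_set.
- by move=> x Ux; rewrite ext0_out// mxE mul0r.
exact: wg.
Qed.

(** Both gradients have the same integrals against test functions. Finite measure turns their L^2
    difference into an L^1 function, to which the fundamental lemma applies. *)
Lemma weak_gradient_unique U u u' (Du Du' : T -> T) : open U -> (mu U < +oo)%E ->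
  (forall i, L2fun mu (ext0 U (fun x => Du x ord0 i))) ->
  (forall i, L2fun mu (ext0 U (fun x => Du' x ord0 i))) ->
  L2fun mu (ext0 U u) -> L2fun mu (ext0 U u') ->
  weak_gradient U u Du -> weak_gradient U u' Du' ->
  {ae mu, forall x, U x -> u x = u' x} ->
  forall i, {ae mu, forall x, U x -> Du x ord0 i = Du' x ord0 i}.
Proof.
move=> oU Uoo L2D L2D' L2u L2u' wg wg' uu' i.
have mU := measurable_mx_open oU.
suff : {ae mu, forall x, U x -> Du x ord0 i - Du' x ord0 i = 0}.
  by apply: filterS => x h /h /eqP; rewrite subr_eq0 => /eqP.
apply: fundamental_lemma => //.
  have := integrableB mU (L2fun_Rintegrable mU Uoo (L2D i)) (L2fun_Rintegrable mU Uoo (L2D' i)).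
  by apply: eq_integrable => // x _ /=; rewrite EFinB.
move=> psi tpsi.
under eq_Rintegral do rewrite mulrBl.
rewrite RintegralB//; [|exact: integrable_ext0M tpsi _..].
apply/eqP; rewrite subr_eq0 -eqr_opp -(wg _ _ tpsi) -(wg' _ _ tpsi); apply/eqP.
rewrite /Rintegral; congr fine; apply: ae_eq_integral => //.
- apply/measurable_int/(integrable_ext0M mU (test_function_partial i tpsi) L2u).
- apply/measurable_int/(integrable_ext0M mU (test_function_partial i tpsi) L2u').
- by apply: filterS uu' => x h /h ->.
Qed.

End test_functions.

(** * Rellich's theorem *)

Section translations.
Context {R : realType} {N : nat}.
Local Notation T := 'rV[R]_N.
Local Notation mu := (lebesgue_rV R N).
Local Notation e_ i := (delta_mx (ord0 : 'I_1) i : T).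
Implicit Types (f g w psi : T -> R) (a : T).

Lemma L2fun_translate f a : L2fun mu f -> L2fun mu (fun x => f (x + a)).
Proof.
move=> /L2funP[mf if2]; apply/L2funP; split.
  exact: measurableT_comp (measurable_rV_add a).
exact: (integrable_rV_addr (f := fun x => f x ^+ 2) a if2).
Qed.

Lemma ipL2_translate f g a : L2fun mu f -> L2fun mu g ->
  ipL2 mu (fun x => f (x + a)) (fun x => g (x + a)) = ipL2 mu f g.
Proof.
by move=> L2f L2g; rewrite /ipL2 (Rintegral_rV_addr a (L2funM_integrable L2f L2g)).
Qed.

Lemma ipL2_translatel f g a : L2fun mu f -> L2fun mu g ->
  ipL2 mu (fun x => f (x + a)) g = ipL2 mu f (fun x => g (x - a)).
Proof.
move=> L2f L2g; rewrite -(ipL2_translate a L2f (L2fun_translate _ L2g)).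
by congr ipL2; apply/funext => x; rewrite addrK.
Qed.

Lemma partial_translate f a i :
  partial i (fun x => f (x + a)) = (fun x => partial i f (x + a)).
Proof.
apply/funext => x; rewrite /partial /derive.
apply: (congr1 (fun F : R -> R => lim (F @ (0 : R)^'))).
by apply/funext => h; rewrite /= addrA.
Qed.

Lemma smooth_translate f a : smooth f -> smooth (fun x => f (x + a)).
Proof.
move=> sf s x.
have -> : foldr partial (fun x => f (x + a)) s = (fun x => foldr partial f s (x + a)).
  by elim: s => //= i s ->; rewrite partial_translate.
apply: (@differentiable_comp _ _ _ _ (fun x => x + a) (foldr partial f s)) => //.
Qed.

Lemma test_function_translate psi a : test_function setT psi ->
  test_function setT (fun x => psi (x + a)).
Proof.
move=> [spsi cpsi _]; split => //; first exact: smooth_translate.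
pose S := closure [set x | psi x != 0].
have cS : compact [set x - a | x in S].
  apply: continuous_compact => //; apply: continuous_subspaceT => x.
  by apply: continuousB; [exact: id|exact: cst_continuous].
have clS : closed [set x - a | x in S] by apply: compact_closed => //; exact: norm_hausdorff.
apply: (subclosed_compact _ cS); first exact: closed_closure.
rewrite [X in _ `<=` X]((closure_id _).1 clS); apply: closureS => x /= px.
by exists (x + a); [exact: subset_closure|rewrite addrK].
Qed.

Lemma test_function_lincomb U c f g : test_function U f -> test_function U g ->
  test_function U (fun x => c * f x + g x).
Proof.
move=> [sf cf fU] [sg cg gU].
have hs : closure [set x | c * f x + g x != 0] `<=`
    closure [set x | f x != 0] `|` closure [set x | g x != 0].
  rewrite -closureU; apply: closureS => x /= h; apply: contrapT.
  by move=> /not_orP[/negP/negPn/eqP fx /negP/negPn/eqP gx]; rewrite fx gx mulr0 addr0 eqxx in h.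
split.
- apply: elementary_smooth_smooth; apply: es_add; last exact: es_smooth.
  by apply: es_mul; [exact: es_cst|exact: es_smooth].
- apply: (subclosed_compact _ _ hs); first exact: closed_closure.
  exact: compactU.
- by move=> x /hs[/fU|/gU].
Qed.

Lemma test_function0 U : test_function U (0 : T -> R).
Proof.
have e : [set x | (0 : T -> R) x != 0] = set0 by apply/seteqP; split=> x //=; rewrite eqxx.
split; rewrite ?e ?closure0 //; last exact: compact0.
exact: (elementary_smooth_smooth (es_cst 0)).
Qed.

Lemma test_function_vanishing_far psi : test_function setT psi ->
  exists2 r, 0 < r & forall x : T, r < `|x| -> psi x = 0.
Proof.
move=> [_ cpsi _]; have [M [Mr MP]] := compact_bounded cpsi.
exists (`|M| + 1); first by rewrite ltr_wpDl.
move=> x Mx; apply: contrapT => /eqP px.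
have := MP (`|M| + 1); rewrite (le_lt_trans (ler_norm M)) ?ltrDl// => /(_ isT x).
by move=> /(_ (@subset_closure _ [set x | psi x != 0] x px)) /=; rewrite leNgt Mx.
Qed.

Lemma is_derive_line psi (y : T) i (s : R) : smooth psi ->
  is_derive s 1 (fun s : R => psi (y - s *: e_ i)) (- partial i psi (y - s *: e_ i)).
Proof.
move=> spsi; have dpsi := smooth_differentiable spsi.
pose h : R -> T := cst y - *:%R ^~ (e_ i).
have dh : differentiable h s by exact: differentiableB.
have d : differentiable (psi \o h) s by exact: differentiable_comp.
apply: DeriveDef; first exact: diff_derivable.
transitivity ('D_(- e_ i) psi (y - s *: e_ i)).
  apply: (congr1 (fun F : R -> R => lim (F @ (0 : R)^'))); apply/funext => c /=.
  congr (c^-1 *: (psi _ - _)).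
  by rewrite [c *: 1]mulr1 scalerDl opprD scalerN addrCA.
by rewrite /partial !deriveE// linearN.
Qed.

Lemma ball_indicator_L2 (r : R) : L2fun mu \1_[set x : T | `|x| <= r].
Proof.
have mS : measurable [set x : T | `|x| <= r].
  apply: closed_measurable_rV.
  apply: (@closed_comp _ _ (fun x : T => `|x|) [set y : R | y <= r]).
    by move=> x _; exact: norm_continuous.
  exact: closed_le.
apply: L2fun_indic => //; apply: bounded_lebesgue_lty => //.
by exists r; split; [exact: num_real|move=> M rM x /= xr; exact/ltW/(le_lt_trans xr)].
Qed.

(** The translation sits on the smooth factor, so one may differentiate under the integral sign
    although [w] is only in L^2. *)
Lemma is_derive_translate w psi i (t : R) : L2fun mu w -> test_function setT psi ->
  is_derive t 1 (fun s : R => ipL2 mu w (fun y => psi (y - s *: e_ i)))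
    (- ipL2 mu w (fun y => partial i psi (y - t *: e_ i))).
Proof.
move=> L2w tpsi; have spsi : smooth psi by case: tpsi.
have tp := test_function_partial i tpsi.
have [M M0 pM] := test_function_bounded tp.
have [r r0 pr] := test_function_vanishing_far tp.
(* For |s - t| < 1 the shift [s *: e_ i] has sup norm at most |t| + 1, so this ball contains the
   supports of all translates involved, and M |w| restricted to it dominates. *)
pose S := [set x : T | `|x| <= r + `|t| + 1].
pose f (s : R) y := w y * psi (y - s *: e_ i).
pose G y := M * (`|w y| * \1_S y).
have ene : `|e_ i : T| <= 1.
  rewrite /Num.Def.normr/= mx_normrE; apply: bigmax_le => // -[j k] _ /=.
  by rewrite mxE normr_nat; case: (_ && _).
have It : `](t - 1), (t + 1)[%classic t by rewrite /= in_itv/= ltrBlDr ltrDl ltr01.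
have intf (s : R) : `](t - 1), (t + 1)[%classic s -> mu.-integrable setT (EFin \o f s).
  move=> _; apply: L2funM_integrable => //; apply: L2fun_translate.
  exact: test_function_L2 tpsi.
have derf (s : R) y : is_derive s 1 (f ^~ y) (- (w y * partial i psi (y - s *: e_ i))).
  have := is_deriveZ (w y) (is_derive_line y i s spsi).
  by rewrite /GRing.scale/= mulrN.
have dE (s : R) y : partial1of2 f s y = - (w y * partial i psi (y - s *: e_ i)).
  by rewrite partial1of2E; have [_] := derf s y.
have intG : mu.-integrable setT (EFin \o G).
  have := integrableZl measurableT M (integrable_norm (L2funM_integrable L2w (ball_indicator_L2 (r + `|t| + 1)))).
  apply: eq_integrable => // x _ /=.
  by rewrite /G EFinM normrM [`|\1__ x|]ger0_norm// indicE.
have Gub (s : R) y : `](t - 1), (t + 1)[%classic s -> setT y -> `|partial1of2 f s y| <= G y.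
  rewrite /= in_itv/= => /andP[s1 s2] _; rewrite dE normrN normrM /G indicE.
  have [Sy|Sy] := pselect (S y).
    by rewrite mem_set// mulr1 mulrC ler_wpM2r.
  rewrite memNset// !mulr0 pr ?normr0 ?mulr0//.
  move/negP: Sy; rewrite -ltNge => Sy.
  have se : `|s *: e_ i : T| <= `|t| + 1.
    rewrite normrZ (le_trans (ler_piMr _ ene))//.
    have : `|s - t| < 1 by rewrite ltr_norml; apply/andP; split; lra.
    have := ler_distD t s 0; rewrite !subr0; lra.
  have := ler_distD (s *: e_ i) y 0; rewrite !subr0; lra.
have derf1 (s : R) y : `](t - 1), (t + 1)[%classic s -> setT y -> derivable (f ^~ y) s 1.
  by move=> _ _; have [] := derf s y.
have G0 y : 0 <= G y by rewrite /G mulr_ge0// mulr_ge0// indicE.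
apply: DeriveDef.
  exact: (derivable_under_integral measurableT It intf derf1 G0 intG Gub).
rewrite -derive1E (differentiation_under_integral measurableT It intf derf1 G0 intG Gub).
under eq_Rintegral do rewrite dE -mulN1r.
rewrite RintegralZl//; first by rewrite mulN1r.
apply: L2funM_integrable => //; apply: L2fun_translate.
exact: test_function_L2 tp.
Qed.

(** The integral of a translate of [psi] does not depend on the translation, so its derivative is 0.
    The indicator of a ball containing the supports after all shifts of length below 1 stands in for
    the constant 1, so as to remain in L^2. *)
Lemma Rintegral_partial0 psi i : test_function setT psi -> \int[mu]_x partial i psi x = 0.
Proof.
move=> tpsi; have tp := test_function_partial i tpsi.
have [r1 r10 pr1] := test_function_vanishing_far tpsi.
have [r2 r20 pr2] := test_function_vanishing_far tp.
pose r := r1 + r2.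
have pr x : r < `|x| -> psi x = 0 by move=> rx; apply: pr1; apply: lt_trans rx; rewrite ltrDl.
pose S := [set x : T | `|x| <= r + 1].
have L2S : L2fun mu \1_S := ball_indicator_L2 (r + 1).
have ene : `|e_ i : T| <= 1.
  rewrite /Num.Def.normr/= mx_normrE; apply: bigmax_le => // -[j k] _ /=.
  by rewrite mxE normr_nat; case: (_ && _).
have psiE : (fun x => \1_S x * psi x) = psi.
  apply/funext => x; rewrite indicE; have [Sx|Sx] := pselect (S x).
    by rewrite mem_set// mul1r.
  rewrite memNset// mul0r pr//; move/negP: Sx; rewrite -ltNge; apply: lt_trans.
  by rewrite ltrDl.
have ipsi : mu.-integrable setT (EFin \o psi).
  have := L2funM_integrable L2S (test_function_L2 tpsi).
  by apply: eq_integrable => // x _ /=; rewrite -[in RHS]psiE.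
have ipS (s : R) : `|s| < 1 ->
    ipL2 mu \1_S (fun y => psi (y - s *: e_ i)) = \int[mu]_x psi x.
  move=> s1; rewrite -(Rintegral_rV_addr (- (s *: e_ i)) ipsi).
  apply: eq_Rintegral => x _; rewrite indicE; have [Sx|Sx] := pselect (S x).
    by rewrite mem_set// mul1r.
  rewrite memNset// mul0r pr//; move/negP: Sx; rewrite -ltNge => Sx.
  have se : `|s *: e_ i : T| <= 1.
    by rewrite normrZ (le_trans (ler_piMr _ ene))// ltW.
  have := ler_distD (s *: e_ i) x 0; rewrite !subr0; lra.
have [_] := is_derive_translate i 0 L2S tpsi.
rewrite (near_eq_derive _ (g := cst (\int[mu]_x psi x))); last first.
  apply/nbhs_ballP; exists 1 => //= s.
  by rewrite -ball_normE /ball_ /= sub0r normrN; exact: ipS.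
rewrite derive_cst => /esym/eqP; rewrite oppr_eq0 => /eqP <-.
rewrite /ipL2; apply: eq_Rintegral => x _; rewrite scale0r subr0 indicE.
have [Sx|Sx] := pselect (S x); first by rewrite mem_set// mul1r.
rewrite memNset// mul0r pr2//; move/negP: Sx; rewrite -ltNge /r; lra.
Qed.

(** Project [f] on the subspace of test functions: the remainder is orthogonal to all of them, hence
    0 almost everywhere by the fundamental lemma, applied on balls of finite measure that exhaust
    the space. *)
Lemma test_function_dense f : L2fun mu f ->
  exists2 v_ : nat -> T -> R, forall n, test_function setT (v_ n) &
    ipL2 mu (v_ n - f) (v_ n - f) @[n --> \oo] --> (0 : R).
Proof.
move=> L2f; have H := hilbert_L2 mu.
have [|||p [v_ [L2p tv vp orth]]] :=
    hilbert_projection H (V := test_function setT) _ _ _ L2f.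
- by move=> g tg; exact: test_function_L2 tg.
- exact: test_function0.
- by move=> c g h tg th; exact: test_function_lincomb.
have L2fp : L2fun mu (f - p) by exact: L2funB.
suff fp0 : {ae mu, forall x, (f - p) x = 0}.
  exists v_ => //; rewrite (_ : (fun n => _) =
    (fun n => ipL2 mu (v_ n - p) (v_ n - p)))//.
  apply/funext => n; rewrite /ipL2 /Rintegral; congr fine; apply: ae_eq_integral => //.
  - have L2vf := L2funB (test_function_L2 (tv n)) L2f.
    exact: measurable_int (L2funM_integrable L2vf L2vf).
  - have L2vp := L2funB (test_function_L2 (tv n)) L2p.
    exact: measurable_int (L2funM_integrable L2vp L2vp).
  - by apply: filterS fp0 => x /eqP; rewrite !fctE subr_eq0 => /eqP ->.
pose B (k : nat) := ball (0 : T) k.+1%:R.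
have oB k : open (B k) by exact: ball_open.
have : {ae mu, forall x, forall k, B k x -> (f - p) x = 0}.
  apply: ae_foralln => k; have mB := measurable_mx_open (oB k).
  have Boo : (mu (B k) < +oo)%E.
    apply: bounded_lebesgue_lty => //; exists k.+1%:R; split; first exact: num_real.
    by move=> M kM x; rewrite /B -ball_normE /ball_ /= sub0r normrN => xk; exact/ltW/(lt_trans xk).
  apply: fundamental_lemma => //.
    by apply: L2fun_Rintegrable => //; exact: L2fun_patch.
  move=> psi tpsi; rewrite -[RHS](orth psi); last exact: test_functionS tpsi.
  rewrite Rintegral_mkcond; apply: eq_Rintegral => x _; rewrite patchE.
  have [Bx|Bx] := pselect (B k x); first by rewrite mem_set.
  by rewrite memNset// (test_function_out tpsi Bx) mulr0.
apply: filterS => x h; apply: (h (Num.truncn `|x|)).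
by rewrite /B -ball_normE /ball_ /= sub0r normrN; exact: truncnS_gt.
Qed.

(** A norm bound by duality in which only test functions are tried: [f] is a limit of them, so the
    inequality passes to the limit at psi = f and is divided by the squared norm of [f]. *)
Lemma ipL2_le_dense f K : 0 <= K -> L2fun mu f ->
  (forall psi, test_function setT psi -> ipL2 mu f psi ^+ 2 <= K * ipL2 mu psi psi) ->
  ipL2 mu f f <= K.
Proof.
move=> K0 L2f fK; have H := hilbert_L2 mu.
have [v_ tv vf] := test_function_dense L2f.
have L2v n : L2fun mu (v_ n) by exact: test_function_L2 (tv n).
have c1 : ipL2 mu (v_ n) f @[n --> \oo] --> ipL2 mu f f by exact: (strong_cvg_ip H).
have c2 : ipL2 mu (v_ n) (v_ n) @[n --> \oo] --> ipL2 mu f f.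
  have e n : ipL2 mu (v_ n) (v_ n) =
      ipL2 mu (v_ n - f) (v_ n - f) + 2 * ipL2 mu (v_ n) f - ipL2 mu f f.
    by rewrite (ip_sqrB H)//; ring.
  under eq_fun do rewrite e.
  have c1' : 2 * ipL2 mu (v_ n) f @[n --> \oo] --> 2 * ipL2 mu f f by exact: cvgMl_tmp.
  have l : 0 + 2 * ipL2 mu f f - ipL2 mu f f = ipL2 mu f f by ring.
  suff : ipL2 mu (v_ n - f) (v_ n - f) + 2 * ipL2 mu (v_ n) f - ipL2 mu f f
    @[n --> \oo] --> 0 + 2 * ipL2 mu f f - ipL2 mu f f by rewrite l.
  by apply: cvgB; [exact: cvgD|exact: cvg_cst].
have h : ipL2 mu f f ^+ 2 <= K * ipL2 mu f f.
  have c3 : ipL2 mu (v_ n) f ^+ 2 @[n --> \oo] --> ipL2 mu f f ^+ 2.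
    under eq_fun do rewrite expr2.
    by rewrite expr2; exact: cvgM.
  have c4 : K * ipL2 mu (v_ n) (v_ n) @[n --> \oo] --> K * ipL2 mu f f by exact: cvgMl_tmp.
  apply: (ler_cvg_to c3 c4); apply: nearW => n.
  by rewrite (hilbertC H)//; exact: fK.
have : 0 <= ipL2 mu f f by exact: ipL2_ge0.
rewrite le_eqVlt => /predU1P[f0|f0].
  by rewrite -f0.
by move: h; rewrite expr2 ler_pM2r.
Qed.

End translations.

Section rellich.
Context {R : realType} {N : nat}.
Local Notation T := 'rV[R]_N.
Local Notation mu := (lebesgue_rV R N).
Local Notation e_ i := (delta_mx (ord0 : 'I_1) i : T).
Implicit Types (d w : T -> R) (g : 'I_N -> T -> R).

Definition global_weak_gradient w g :=
  forall i psi, test_function setT psi ->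
    ipL2 mu w (partial i psi) = - ipL2 mu (g i) psi.

(** By duality it is enough to pair with a test function psi. With the shift moved onto psi, the
    pairing is a function of the length of the shift whose derivative pairs [g i] with a translate
    of psi; the mean value theorem on [0, t] and Cauchy-Schwarz conclude. *)
Lemma translation_estimate w g i (t : R) : L2fun mu w -> L2fun mu (g i) ->
  global_weak_gradient w g -> 0 <= t ->
  ipL2 mu (fun x => w (x + t *: e_ i) - w x) (fun x => w (x + t *: e_ i) - w x)
    <= t ^+ 2 * ipL2 mu (g i) (g i).
Proof.
move=> L2w L2g wg t0; have H := hilbert_L2 mu.
have L2tw := L2fun_translate (t *: e_ i) L2w.
apply: ipL2_le_dense; [by rewrite mulr_ge0 ?ipL2_ge0 ?sqr_ge0|exact: L2funB|].
move=> psi tpsi; have L2psi := test_function_L2 tpsi.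
pose f (s : R) := ipL2 mu w (fun y => psi (y - s *: e_ i)).
have df (s : R) : is_derive s 1 f (- ipL2 mu w (fun y => partial i psi (y - s *: e_ i))).
  exact: is_derive_translate.
have -> : ipL2 mu (fun x => w (x + t *: e_ i) - w x) psi = f t - f 0.
  rewrite (ipBl H)// ipL2_translatel// /f scale0r.
  by congr (_ - ipL2 _ _ _); apply/funext => x; rewrite subr0.
have [|c _ ->] := MVT_segment t0 (fun s _ => df s).
  apply: continuous_subspaceT => s; apply: differentiable_continuous.
  by apply/derivable1_diffP; have [] := df s.
have tc := test_function_translate (- (c *: e_ i)) tpsi.
rewrite subr0 -(partial_translate psi (- (c *: e_ i)) i) (wg _ _ tc) opprK.
rewrite exprMn [leLHS]mulrC -[leRHS]mulrA ler_wpM2l ?sqr_ge0//.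
rewrite -(ipL2_translate (- (c *: e_ i)) L2psi L2psi).
by apply: (ip_CauchySchwarz H) => //; exact: test_function_L2 tc.
Qed.

(** The shift is performed one coordinate at a time. Each costs at most [h] times the norm of one
    partial derivative, and translation invariance removes the shifts already made. *)
Lemma translation_estimate_box w g (z : T) (h : R) : L2fun mu w ->
  (forall i, L2fun mu (g i)) -> global_weak_gradient w g ->
  (forall i, 0 <= z ord0 i <= h) ->
  Num.sqrt (ipL2 mu (fun x => w (x + z) - w x) (fun x => w (x + z) - w x))
    <= h * \sum_i Num.sqrt (ipL2 mu (g i) (g i)).
Proof.
move=> L2w L2g wg zh; have H := hilbert_L2 mu.
rewrite [in leLHS](row_sum_delta z) mulr_sumr.
elim: (index_enum _) => [|i r IH].
  rewrite !big_nil; under eq_fun do rewrite addr0 subrr.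
  rewrite (ip0l H) ?sqrtr0//; exact: (hilbert0 H).
rewrite !big_cons; set a := z ord0 i *: e_ i; set b : T := \sum_(j <- r) _ in IH *.
have -> : (fun x => w (x + (a + b)) - w x) =
    (fun x => (fun y => w (y + a) - w y) (x + b)) + (fun x => w (x + b) - w x).
  by apply/funext => x; rewrite !fctE /= [a + b]addrC (addrA x) [RHS]addrA subrK.
have L2a : L2fun mu (fun y => w (y + a) - w y).
  by apply: L2funB => //; exact: L2fun_translate.
apply: le_trans (ip_triangle H _ _) _.
- exact: (L2fun_translate b L2a).
- by apply: L2funB => //; exact: L2fun_translate.
apply: lerD => //; rewrite (ipL2_translate b L2a L2a).
have /andP[z0 zih] := zh i.
apply: (@le_trans _ _ (Num.sqrt (z ord0 i ^+ 2 * ipL2 mu (g i) (g i)))).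
  by rewrite ler_wsqrtr//; apply: translation_estimate.
rewrite sqrtrM ?sqr_ge0// sqrtr_sqr ger0_norm// ler_wpM2r ?sqrtr_ge0//.
Qed.

Definition cube (h : R) := [set z : T | forall i, z ord0 i \in `[0, h]].

Lemma measurable_cube h : measurable (cube h).
Proof.
rewrite (_ : cube h = \bigcap_(i in [set: 'I_N])
    (fun x : T => x ord0 i) @^-1` `[0, h]%classic).
  apply: fin_bigcap_measurable => [|i _]; first exact: finite_finset.
  rewrite -[X in measurable X]setTI.
  by apply: measurable_mx_coord => //; exact: measurable_itv.
by apply/seteqP; split => [x xc i _|x xc i]; [exact: xc|exact: (xc i I)].
Qed.

Lemma lebesgue_cube h : 0 <= h ->
  (mu : {measure set T -> \bar R}) (cube h) = (h ^+ N)%:E.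
Proof.
move=> h0.
have -> : cube h = [set x : T | forall i, x ord0 i \in
    `[(const_mx 0 : T) ord0 i, (const_mx h : T) ord0 i]].
  by apply/seteqP; split => x xc i; have := xc i; rewrite !mxE.
apply: (etrans (@lebesgue_rV_box R N (const_mx 0) (const_mx h) _)).
  by move=> i; rewrite !mxE.
under eq_bigr do rewrite !mxE subr0.
by rewrite prodr_const card_ord.
Qed.

Lemma L2fun_cube h : 0 <= h -> L2fun mu \1_(cube h).
Proof.
by move=> h0; apply: L2fun_indic; [exact: measurable_cube|rewrite lebesgue_cube// ltry].
Qed.

Lemma ipL2_cube h : 0 <= h -> ipL2 mu \1_(cube h) \1_(cube h) = h ^+ N.
Proof.
move=> h0; apply: EFin_inj; rewrite ipL2E; last exact: L2fun_cube.
transitivity (\int[mu]_x (\1_(cube h) x)%:E)%E.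
  by apply: eq_integral => x _; rewrite indicE; case: (_ \in _); rewrite ?expr1n ?expr0n.
by rewrite integral_indic ?setIT ?lebesgue_cube//; exact: measurable_cube.
Qed.

Lemma measurable_rV_addp : measurable_fun [set: T * T] (fun p : T * T => p.1 + p.2).
Proof.
apply: measurable_fun_mxP => i j; under eq_fun do rewrite mxE.
apply: measurable_funD.
  exact: (measurableT_comp (measurable_mx_coord i j) measurable_fst).
exact: (measurableT_comp (measurable_mx_coord i j) measurable_snd).
Qed.

(* With m the measure of the cube Q of side h, J x the integral of d over
   x + Q and P x that of (d (x + z) - d x)^2 over z in Q, expanding the square
   gives m (d x)^2 <= 2 (P x) + 4 (J x)^2 / m; the function a below is
   the positive part of m d^2 - 2 P. *)
Lemma cube_average_estimate d g (B : set T) h : 0 < h -> measurable B ->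
  L2fun mu d -> (forall i, L2fun mu (g i)) -> global_weak_gradient d g ->
  (forall x, ~ B x -> d x = 0) ->
  exists a : T -> R, [/\ measurable_fun setT a,
    forall x, 0 <= a x <= 4 / h ^+ N * ipL2 mu d (fun y => \1_(cube h) (y - x)) ^+ 2 &
    h ^+ N * ipL2 mu d d <= \int[mu]_(x in B) a x +
      2 * (h ^+ N * (h * \sum_i Num.sqrt (ipL2 mu (g i) (g i))) ^+ 2)].
Proof.
move=> h0 mB L2d L2g wg dB; have H := hilbert_L2 mu.
pose Q := cube h; pose m := h ^+ N; pose G := \sum_i Num.sqrt (ipL2 mu (g i) (g i)).
have m0 : 0 < m by rewrite exprn_gt0.
have L2Q : L2fun mu \1_Q by apply: L2fun_cube; exact: ltW.
have mQ : measurable Q := measurable_cube h.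
have md := L2fun_measurable L2d.
pose F (p : T * T) : \bar R := (\1_Q p.2 * (d (p.1 + p.2) - d p.1) ^+ 2)%:E.
have mF : measurable_fun setT F.
  apply/measurable_EFinP; apply: measurable_funM.
    apply: (@measurableT_comp _ _ _ _ _ _ (\1_Q : T -> R)).
      exact: measurable_indic.
    exact: measurable_snd.
  apply: measurable_funX; apply: measurable_funB.
    exact: (measurableT_comp md measurable_rV_addp).
  exact: (measurableT_comp md measurable_fst).
have F0 p : (0 <= F p)%E by rewrite lee_fin mulr_ge0 ?sqr_ge0// indicE.
have mP := measurable_fun_fubini_tonelli_F (m2 := mu) _ mF F0.
(* The increment z |-> d (x + z) - d x cut off to the cube; [P x] is its squared norm, which the
   Hilbert space identities expand. *)
pose k x : T -> R := (fun z => \1_Q z * d (z + x)) - d x *: (\1_Q : T -> R).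
have L2Qd x : L2fun mu (fun z => \1_Q z * d (z + x)).
  apply: (@L2fun_mul_bounded _ _ _ _ _ _ 1).
  - exact: measurable_indic.
  - by move=> z; rewrite indicE normr_nat; case: (_ \in _).
  - exact: L2fun_translate.
have L2k x : L2fun mu (k x) by apply: (hilbertB H) => //; exact: (hilbertZ H).
have PE x : (\int[mu]_z F (x, z) = (ipL2 mu (k x) (k x))%:E)%E.
  rewrite ipL2E//; apply: eq_integral => z _; congr (_%:E).
  rewrite /k !fctE /= [z + x]addrC indicE; case: (_ \in _).
    by rewrite !mul1r [_ *: _]mulr1.
  by rewrite !mul0r [_ *: _]mulr0 subr0 expr0n.
pose P x := ipL2 mu (k x) (k x).
have P0 x : 0 <= P x by exact: ipL2_ge0.
have mPr : measurable_fun setT P.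
  apply/measurable_EFinP; apply: (eq_measurable_fun (fubini_F mu F)) mP.
  by move=> x _; rewrite /fubini_F PE.
pose J x := ipL2 mu d (fun y => \1_Q (y - x)).
have PJ x : m * d x ^+ 2 <= 2 * P x + 4 / m * J x ^+ 2.
  have -> : P x = ipL2 mu (fun z => \1_Q z * d (z + x)) (fun z => \1_Q z * d (z + x))
      - 2 * d x * J x + d x ^+ 2 * m.
    rewrite /P /k (ip_sqrBZ H)// (ipL2_cube (ltW h0)); congr (_ - _ * _ + _).
    rewrite /J -ipL2_translatel//; apply: eq_Rintegral => z _.
    by rewrite indicE; case: (_ \in _); rewrite ?mul1r ?mulr1 ?mul0r ?mulr0.
  have := ipL2_ge0 mu (fun z => \1_Q z * d (z + x)).
  move: (ipL2 _ _ _) (J x) (d x) => q j c q0.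
  (* Young's inequality: the cross term 4 c j is absorbed by m c^2 at the price of 4 j^2 / m. *)
  have : 0 <= (m * c - 2 * j) ^+ 2 / m by rewrite divr_ge0 ?sqr_ge0 ?ltW.
  have -> : (m * c - 2 * j) ^+ 2 / m = m * c ^+ 2 - 4 * c * j + 4 / m * j ^+ 2.
    by field; rewrite gt_eqF.
  nra.
pose a x := Num.max 0 (m * d x ^+ 2 - 2 * P x).
have a0 x : 0 <= a x by rewrite /a le_max lexx.
have md2 : measurable_fun setT (fun x => d x ^+ 2) by exact: measurable_funX.
have ma : measurable_fun setT a.
  apply: measurable_maxr; first exact: measurable_cst.
  by apply: measurable_funB; apply: measurable_funM.
exists a; split => //.
  move=> x; rewrite a0 /= /a ge_max; apply/andP; split.
    by rewrite mulr_ge0 ?sqr_ge0// divr_ge0// ltW.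
  by rewrite lerBlDl; exact: PJ.
have ia : mu.-integrable B (EFin \o a).
  apply: (@le_Rintegrable _ _ _ mu B a (fun x => m * d x ^+ 2)) => //.
  - exact: measurable_funTS.
  - move=> x _; rewrite ger0_norm// /a ge_max; apply/andP; split.
      by rewrite mulr_ge0 ?sqr_ge0// ltW.
    by rewrite lerBlDl lerDr mulr_ge0.
  - apply: (integrableS measurableT) => //.
    have := integrableZl measurableT m (L2fun_sqr L2d).
    by apply: eq_integrable => // x _ /=; rewrite EFinM.
(* After exchanging the integrals, the inner one is, for each z in the cube, a squared translation
   error; the outer one contributes the volume m. *)
have intP : (\int[mu]_(x in B) (P x)%:E <= (m * (h * G) ^+ 2)%:E)%E.
  apply: (@le_trans _ _ (\int[mu]_x (P x)%:E)%E).
    apply: ge0_subset_integral => //; first exact/measurable_EFinP.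
    by move=> x _; rewrite lee_fin.
  under eq_integral do rewrite -PE.
  rewrite (fubini_tonelli F mF F0).
  apply: (@le_trans _ _ (\int[mu]_z (((h * G) ^+ 2)%:E * (\1_Q z)%:E))%E).
    apply: ge0_le_integral => //.
    - by move=> z _; exact: integral_ge0.
    - exact: measurable_fun_fubini_tonelli_G.
    - by apply/measurable_EFinP/measurable_funM => //; exact: measurable_indic.
    move=> z _; rewrite indicE; have [Qz|Qz] := pselect (Q z); last first.
      rewrite memNset// mule0 integral0_eq// => x _.
      by rewrite /F /= indicE memNset// mul0r.
    rewrite mem_set// mule1.
    have L2dz : L2fun mu (fun x => d (x + z) - d x).
      by apply: L2funB => //; exact: L2fun_translate.
    under eq_integral do rewrite /F /= indicE mem_set// mul1r.
    rewrite -(ipL2E L2dz) lee_fin.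
    rewrite -(sqr_sqrtr (ipL2_ge0 mu _)) lerXn2r ?nnegrE ?sqrtr_ge0//.
      by rewrite mulr_ge0 ?(ltW h0)// sumr_ge0// => i _; rewrite sqrtr_ge0.
    exact: (translation_estimate_box (g := g)).
  rewrite ge0_integralZl_EFin ?sqr_ge0//; last first.
    by apply/measurable_EFinP; exact: measurable_indic.
  rewrite integral_indic// setIT lebesgue_cube ?(ltW h0)//.
  by rewrite -EFinM mulrC.
rewrite -lee_fin EFinM ipL2E//.
have dBE : (\int[mu]_x (d x ^+ 2)%:E = \int[mu]_(x in B) (d x ^+ 2)%:E)%E.
  rewrite [RHS]integral_mkcond; apply: eq_integral => x _; rewrite patchE.
  case: ifPn => // /negP Bx; rewrite dB ?expr0n//.
  by apply: contra_not Bx => /mem_set.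
rewrite dBE -ge0_integralZl_EFin ?(ltW m0)//; last 2 first.
- by move=> x _; rewrite lee_fin sqr_ge0.
- by apply/measurable_EFinP; exact: measurable_funTS.
apply: (@le_trans _ _ (\int[mu]_(x in B) ((a x)%:E + 2%:E * (P x)%:E))%E).
  apply: ge0_le_integral => //.
  - by move=> x _; rewrite mule_ge0 ?lee_fin ?sqr_ge0 ?(ltW m0).
  - by apply/measurable_EFinP/measurable_funM => //; exact: measurable_funTS.
  - apply/measurable_EFinP/measurable_funD; first exact: measurable_funTS.
    by apply: measurable_funM => //; exact: measurable_funTS.
  move=> x _; rewrite -!EFinM -EFinD lee_fin /a.
  by rewrite -lerBlDr le_max lexx orbT.
rewrite ge0_integralD; last 5 first.
- exact: mB.
- by move=> x _; rewrite lee_fin.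
- by apply/measurable_EFinP; exact: measurable_funTS.
- by move=> x _; rewrite mule_ge0 ?lee_fin.
- by apply/measurable_EFinP/measurable_funM => //; exact: measurable_funTS.
rewrite [leRHS]EFinD; apply: leeD.
  by rewrite /Rintegral fineK//; exact: integrable_fin_num.
rewrite ge0_integralZl_EFin; last 4 first.
- exact: mB.
- by move=> x _; rewrite lee_fin.
- by apply/measurable_EFinP; exact: measurable_funTS.
- exact: ler0n.
by rewrite EFinM lee_wpmul2l.
Qed.

(** For fixed h, weak convergence sends the integral of [d_ n] over each cube to 0, and
    Cauchy-Schwarz bounds these integrals uniformly, so their contribution vanishes by dominated
    convergence on [B]. The rest is of order h^2 uniformly in n. *)
Lemma rellich (B : set T) (d_ : nat -> T -> R) (g_ : nat -> 'I_N -> T -> R) (C : R) :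
  bounded_set B -> measurable B ->
  (forall n, L2fun mu (d_ n)) -> (forall n i, L2fun mu (g_ n i)) ->
  (forall n, global_weak_gradient (d_ n) (g_ n)) ->
  (forall n x, ~ B x -> d_ n x = 0) ->
  (forall n, ipL2 mu (d_ n) (d_ n) <= C) ->
  (forall n i, ipL2 mu (g_ n i) (g_ n i) <= C) ->
  (forall z, L2fun mu z -> ipL2 mu (d_ n) z @[n --> \oo] --> (0 : R)) ->
  ipL2 mu (d_ n) (d_ n) @[n --> \oo] --> (0 : R).
Proof.
move=> bB mB L2d L2g wg dB dC gC dw; have H := hilbert_L2 mu.
have Boo : (mu B < +oo)%E by exact: bounded_lebesgue_lty.
have C0 : 0 <= C := le_trans (ipL2_ge0 mu (d_ 0%N)) (dC 0%N).
pose G : R := \sum_(i < N) Num.sqrt C.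
have G0 : 0 <= G by apply: sumr_ge0 => i _; exact: sqrtr_ge0.
apply/cvgrPdistC_lt => e e0.
(* As h <= 1, one has 2 h^2 G^2 <= 2 h G^2 <= e / 2, the share of the gradient term; the summand 1
   keeps the denominator positive. *)
pose h : R := Num.min 1 (e / (4 * (G ^+ 2 + 1))).
have G21 : 0 < 4 * (G ^+ 2 + 1) by rewrite mulr_gt0// ltr_wpDl ?sqr_ge0.
have h0 : 0 < h by rewrite /h lt_min ltr01 divr_gt0.
have h1 : h <= 1 by rewrite /h ge_min lexx.
have hG : 2 * (h * G) ^+ 2 <= e / 2.
  have : h <= e / (4 * (G ^+ 2 + 1)) by rewrite /h ge_min lexx orbT.
  rewrite ler_pdivlMr// => he; have h2 : h ^+ 2 <= h by rewrite expr2 ler_piMr// ltW.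
  have := sqr_ge0 G; rewrite exprMn; move: (G ^+ 2) he => q he q0.
  have : h ^+ 2 * q <= h * q by rewrite ler_wpM2r.
  nra.
pose m := h ^+ N; have m0 : 0 < m by rewrite exprn_gt0.
pose J n x := ipL2 mu (d_ n) (fun y => \1_(cube h) (y - x)).
have L2Qx (x : T) : L2fun mu (fun y : T => \1_(cube h) (y - x)).
  by apply: L2fun_translate; apply: L2fun_cube; exact: ltW.
have /choice[a_ aP] n := cube_average_estimate h0 mB (L2d n) (L2g n) (wg n) (dB n).
have J2 n x : J n x ^+ 2 <= C * m.
  apply: le_trans (ip_CauchySchwarz H (L2d n) (L2Qx x)) _.
  rewrite (ipL2_translate (- x)); [|by apply: L2fun_cube; exact: ltW..].
  by rewrite ipL2_cube ?(ltW h0)// ler_wpM2r ?(ltW m0).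
have ca : \int[mu]_(x in B) a_ n x @[n --> \oo] --> \int[mu]_(x in B) (cst 0 : T -> R) x.
  apply: (Rintegral_dominated_cvg mB (g := cst (4 / m * (C * m)))).
  - by move=> n; apply: measurable_funTS; case: (aP n).
  - exact: measurable_cst.
  - apply: aeW => x _; have Jx : J n x @[n --> \oo] --> (0 : R) by exact: dw.
    have c : 4 / m * J n x ^+ 2 @[n --> \oo] --> (0 : R).
      rewrite -[X in _ --> X](mulr0 (4 / m)); apply: cvgMl_tmp.
      rewrite -[X in _ --> X](mulr0 0); under eq_fun do rewrite expr2.
      exact: cvgM.
    apply: (squeeze_cvgr _ (cvg_cst 0) c); apply: nearW => n.
    by have [_ + _] := aP n; apply.
  - apply: measurable_bounded_integrable => //.
    by exists `|4 / m * (C * m)|; split=> [|M cM x _]; [exact: num_real|exact: ltW].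
  - move=> n x _; have [_ /(_ x)/andP[ax0 ax] _] := aP n.
    rewrite ger0_norm// (le_trans ax)//.
    by rewrite ler_wpM2l ?divr_ge0 ?(ltW m0)//; exact: J2.
have z0 : \int[mu]_(x in B) (cst 0 : T -> R) x = 0.
  by rewrite Rintegral_cst// mul0r.
rewrite z0 in ca.
have me : 0 < m * (e / 2) by rewrite mulr_gt0// divr_gt0.
move/cvgrPdistC_lt : ca => /(_ _ me); apply: filterS => n.
rewrite !subr0 => an; rewrite ger0_norm ?ipL2_ge0//.
have [_ _ est] := aP n.
have Gn : \sum_i Num.sqrt (ipL2 mu (g_ n i) (g_ n i)) <= G.
  by apply: ler_sum => i _; rewrite ler_wsqrtr.
have Gn2 : (h * \sum_i Num.sqrt (ipL2 mu (g_ n i) (g_ n i))) ^+ 2 <= (h * G) ^+ 2.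
  rewrite lerXn2r ?nnegrE ?mulr_ge0 ?(ltW h0)//.
    by apply: sumr_ge0 => i _; exact: sqrtr_ge0.
  by rewrite ler_wpM2l// ltW.
rewrite -(ltr_pM2l m0); apply: (le_lt_trans est).
have := le_lt_trans (ler_norm _) an.
have : m * (h * \sum_i Num.sqrt (ipL2 mu (g_ n i) (g_ n i))) ^+ 2 <= m * (e / 4).
  by rewrite ler_wpM2l ?(ltW m0)//; lra.
rewrite -/m; lra.
Qed.

End rellich.

Lemma cvgr_sum (R : realType) (I : Type) (r : seq I) (u : nat -> I -> R) (l : I -> R) :
  (forall i, u n i @[n --> \oo] --> l i) ->
  \sum_(i <- r) u n i @[n --> \oo] --> \sum_(i <- r) l i.
Proof.
move=> ul; elim: r => [|i r IH].
  by rewrite big_nil; under eq_fun do rewrite big_nil; exact: cvg_cst.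
by rewrite big_cons; under eq_fun do rewrite big_cons; exact: cvgD.
Qed.

(** * Graphs of Sobolev functions *)

Section L2_vectors.
Context {R : realType} {N : nat}.
Local Notation T := 'rV[R]_N.
Local Notation mu := (lebesgue_rV R N).

Definition component m (D : set T) (F : T -> 'rV[R]_m) (i : 'I_m) : T -> R :=
  ext0 D (fun x => F x ord0 i).

Definition ipV m (D : set T) (F G : T -> 'rV[R]_m) : R :=
  \sum_i ipL2 mu (component D F i) (component D G i).

Lemma component_in m D (F : T -> 'rV[R]_m) i x : D x -> component D F i x = F x ord0 i.
Proof. by move=> Dx; rewrite /component ext0_in. Qed.

Lemma component_out m D (F : T -> 'rV[R]_m) i x : ~ D x -> component D F i x = 0.
Proof. by move=> Dx; rewrite /component ext0_out. Qed.

Lemma componentP m D (F G : T -> 'rV[R]_m) a i :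
  component D (a *: F + G) i = a *: component D F i + component D G i.
Proof.
apply/funext => x; have [Dx|Dx] := pselect (D x).
  by rewrite !fctE !component_in// !mxE.
by rewrite !fctE !component_out// scaler0 addr0.
Qed.

Lemma componentB m D (F G : T -> 'rV[R]_m) i :
  component D (F - G) i = component D F i - component D G i.
Proof. by rewrite -scaleN1r addrC componentP scaleN1r addrC. Qed.

Lemma L2_component m (D : set T) (F : T -> 'rV[R]_m) i :
  L2 D F -> L2fun mu (component D F i).
Proof. exact. Qed.

Lemma ipL2_patch_le (D : set T) (f : T -> R) : measurable D -> L2fun mu f ->
  ipL2 mu (f \_ D) (f \_ D) <= ipL2 mu f f.
Proof.
move=> mD L2f; have L2D := L2fun_patch mD L2f.
rewrite -lee_fin !ipL2E//; apply: ge0_le_integral => //.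
- by move=> x _; rewrite lee_fin sqr_ge0.
- by apply/measurable_EFinP/measurable_funX; exact: L2fun_measurable L2D.
- by apply/measurable_EFinP/measurable_funX; exact: L2fun_measurable L2f.
- by move=> x _; rewrite lee_fin patchE; case: ifP => // _; rewrite expr0n sqr_ge0.
Qed.

(** Completeness is obtained componentwise: the limit of each component is cut down to [D], which
    does not increase its distance to functions vanishing outside [D]. *)
Lemma hilbert_L2vec m (D : set T) : measurable D -> hilbert_on (@L2 R N m D) (ipV D).
Proof.
move=> mD; have H := hilbert_L2 mu.
split.
- move=> i; rewrite (_ : ext0 D _ = (fun=> 0)); first exact: L2fun0.
  apply/funext => x; have [Dx|Dx] := pselect (D x); last by rewrite ext0_out.
  by rewrite ext0_in// mxE.
- move=> a F G L2F L2G i; rewrite -[ext0 D _]/(component D (a *: F + G) i) componentP.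
  by apply: (hilbertP H); exact: L2_component.
- move=> F G L2F L2G; apply: eq_bigr => i _; apply: (hilbertC H).
    exact: L2_component.
  exact: L2_component.
- move=> a F G K L2F L2G L2K; rewrite /ipV mulr_sumr -big_split/=.
  apply: eq_bigr => i _; rewrite componentP (hilbert_linear H)//; exact: L2_component.
- by move=> F _; apply: sumr_ge0 => i _; exact: ipL2_ge0.
move=> F_ L2F cF.
have comp_le (F : T -> 'rV[R]_m) i :
    ipL2 mu (component D F i) (component D F i) <= ipV D F F.
  by rewrite /ipV (bigD1 i)//= lerDl sumr_ge0// => j _; exact: ipL2_ge0.
have /choice[f fP] i : exists f, L2fun mu f /\
    ipL2 mu (component D (F_ n) i - f) (component D (F_ n) i - f) @[n --> \oo] --> (0 : R).
  have [|e e0|f L2f cf] := hilbert_complete H (x_ := fun n => component D (F_ n) i).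
  - by move=> n; exact: L2_component.
  - have [n0 n0P] := cF e e0; exists n0 => m1 n1 m1n n1n.
    by rewrite -componentB; apply: le_trans (comp_le _ _) (n0P _ _ m1n n1n).
  - by exists f.
pose F x : 'rV[R]_m := \row_i f i x.
have cE i : component D F i = f i \_ D.
  apply/funext => x; rewrite patchE; have [Dx|Dx] := pselect (D x).
    by rewrite component_in// mem_set// mxE.
  by rewrite component_out// memNset.
exists F.
  move=> i; rewrite -[ext0 D _]/(component D F i) cE.
  by apply: L2fun_patch => //; case: (fP i).
suff : ipV D (F_ n - F) (F_ n - F) @[n --> \oo] --> \sum_(i < m) (0 : R).
  by rewrite big1.
apply: (@cvgr_sum _ _ _ (fun n i => ipL2 mu (component D (F_ n - F) i)
  (component D (F_ n - F) i)) (fun=> 0)) => i; have [L2f cf] := fP i.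
have L2Fn n : L2fun mu (component D (F_ n) i) by exact: L2_component.
apply: (squeeze_cvgr _ (cvg_cst 0) cf); apply: nearW => n.
rewrite ipL2_ge0/= componentB cE.
have -> : component D (F_ n) i - f i \_ D = (component D (F_ n) i - f i) \_ D.
  apply/funext => x; rewrite !fctE !patchE; case: ifPn => // /negP Dx.
  by rewrite component_out ?subr0// => /mem_set.
apply: ipL2_patch_le => //; exact: (hilbertB H).
Qed.

(** The extended real norm is finite on [L2 D], so [L2_norm], its real part, is the norm attached to
    [ipV]. *)
Lemma L2_normE m (D : set T) (F : T -> 'rV[R]_m) : L2 D F ->
  Lp_norm D 2 (enorm \o F) = (Num.sqrt (ipV D F F))%:E /\
  L2_norm D F = Num.sqrt (ipV D F F).
Proof.
move=> L2F.
suff h : Lp_norm D 2 (enorm \o F) = (Num.sqrt (ipV D F F))%:E.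
  by split => //; rewrite /L2_norm h.
pose g x := \sum_i component D F i x ^+ 2.
have ig : mu.-integrable setT (EFin \o g).
  have := @integrable_sum _ _ _ mu setT measurableT 'I_m (index_enum _) xpredT
    (fun i x => (component D F i x ^+ 2)%:E).
  have h i : mu.-integrable setT (fun x => (component D F i x ^+ 2)%:E).
    exact: L2fun_sqr (L2_component i L2F).
  move=> /(_ (fun i _ => h i)); apply: eq_integrable => // x _ /=.
  by rewrite sumEFin.
rewrite /Lp_norm (Lnorm2E (g := g))//; last first.
  move=> x; rewrite /g; have [Dx|Dx] := pselect (D x).
    rewrite ext0_in//= /enorm sqr_sqrtr; last first.
      by rewrite /dot sumr_ge0// => i _; rewrite -expr2 sqr_ge0.
    by apply: eq_bigr => i _; rewrite component_in.
  by rewrite ext0_out// expr0n big1// => i _; rewrite component_out// expr0n.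
congr ((Num.sqrt _)%:E); apply: EFin_inj.
rewrite /ipV -sumEFin /Rintegral fineK; last exact: integrable_fin_num.
under eq_integral do rewrite /g -sumEFin.
rewrite ge0_integral_sum//; last 2 first.
- move=> i; apply/measurable_EFinP/measurable_funX; apply: L2fun_measurable.
  exact: L2_component.
- by move=> i x _; rewrite lee_fin sqr_ge0.
by apply: eq_bigr => i _; rewrite ipL2E//; exact: L2_component.
Qed.

(** By the Riesz representation every continuous functional on [L2 D] is a pairing with one of its
    elements. *)
Lemma weak_cvg_ipV m (D : set T) (F_ : nat -> T -> 'rV[R]_m) F : measurable D ->
  (forall n, L2 D (F_ n)) -> L2 D F ->
  (forall G, L2 D G -> ipV D (F_ n) G @[n --> \oo] --> ipV D F G) ->
  weak_cvg (@L2 R N m D) (L2_norm D) F_ F.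
Proof.
move=> mD L2F_ L2F FG l [ll [C lC]]; have H := @hilbert_L2vec m D mD.
have [|G L2G lG] := riesz_representation H ll.
  by exists C => G L2G; rewrite -(L2_normE L2G).2; exact: lC.
rewrite lG//; under eq_fun do rewrite lG//.
exact: FG.
Qed.

Lemma strong_cvg_ipV m (D : set T) (F_ : nat -> T -> 'rV[R]_m) F : measurable D ->
  (forall n, L2 D (F_ n)) -> L2 D F -> strong_cvg (L2_norm D) F_ F ->
  ipV D (F_ n - F) (F_ n - F) @[n --> \oo] --> (0 : R).
Proof.
move=> mD L2F_ L2F sF; have H := @hilbert_L2vec m D mD.
have e n : ipV D (F_ n - F) (F_ n - F) = L2_norm D (F_ n - F) * L2_norm D (F_ n - F).
  have L2B := hilbertB H (L2F_ n) L2F.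
  by rewrite (L2_normE L2B).2 -expr2 sqr_sqrtr// (hilbert_ge0 H).
rewrite -[X in _ --> X](mulr0 0); under eq_fun do rewrite e.
exact: cvgM.
Qed.

Lemma graph0 u (Du : T -> T) x : graph u Du x ord0 ord0 = u x.
Proof. exact: rV_cons0. Qed.

Lemma graphS u (Du : T -> T) x i : graph u Du x ord0 (lift ord0 i) = Du x ord0 i.
Proof. exact: rV_consS. Qed.

Lemma L2_graphP (D : set T) u Du : L2 D (graph u Du) <->
  L2fun mu (ext0 D u) /\ forall i, L2fun mu (ext0 D (fun x => Du x ord0 i)).
Proof.
have e0 : (fun x => graph u Du x ord0 ord0) = u by apply/funext => x; rewrite graph0.
have eS i : (fun x => graph u Du x ord0 (lift ord0 i)) = (fun x => Du x ord0 i).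
  by apply/funext => x; rewrite graphS.
split=> [L2g|[L2u L2Du] i].
  by split=> [|i]; [have := L2g ord0; rewrite e0|have := L2g (lift ord0 i); rewrite eS].
have [j ->|->] := unliftP ord0 i; last by rewrite e0.
by rewrite eS; exact: L2Du.
Qed.

Lemma ext0_graph (D : set T) u (Du : T -> T) :
  ext0 D (graph u Du) = graph (ext0 D u) (ext0 D Du).
Proof.
apply/funext => x; apply/rowP => i; have [j ->|->] := unliftP ord0 i.
  rewrite graphS; have [Dx|Dx] := pselect (D x); first by rewrite !ext0_in// graphS.
  by rewrite !ext0_out// !mxE.
rewrite graph0; have [Dx|Dx] := pselect (D x); first by rewrite !ext0_in// graph0.
by rewrite !ext0_out// mxE.
Qed.

(** Each point of [D] off the support has a neighbourhood where [phi] vanishes almost everywhere,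
    but these exceptional null sets are uncountably many. Testing against psi calls for finitely
    many neighbourhoods only, those covering the compact support of psi. *)
Lemma ess_support_ae0 (D : set T) (phi : T -> R) (S : set T) : open D -> closed S ->
  (mu D < +oo)%E -> L2fun mu (ext0 D phi) -> ess_support D phi `<=` S ->
  {ae mu, forall x, D x -> ~ S x -> phi x = 0}.
Proof.
move=> oD cS Doo L2phi eS; have mD := measurable_mx_open oD.
have oDS : open (D `\` S) by apply: openI => //; exact: closed_openC.
have mDS := measurable_mx_open oDS.
have phiD : mu.-integrable D (EFin \o phi) by exact: L2fun_Rintegrable.
suff : {ae mu, forall x, (D `\` S) x -> phi x = 0}.
  by apply: filterS => x h Dx Sx; exact: h.
apply: fundamental_lemma => //.
  by apply: integrableS phiD => //; exact: subDsetl.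
move=> psi tpsi; have [_ cpsi psiDS] := tpsi.
have /choice[V VP] (x : T) : exists V : set T, closure [set y | psi y != 0] x ->
    [/\ open V, V x & {ae mu, forall y, V y -> D y -> phi y = 0}].
  have [cx|?] := pselect (closure [set y | psi y != 0] x); last by exists setT.
  have [Dx nSx] := psiDS _ cx.
  have : ~ ess_support D phi x by move=> /eS.
  move=> /existsNP[V /not_implyP[oV /not_implyP[Vx /contrapT ae0]]].
  by exists V.
have [x cx|x cx|s [sS scov]] := compact_cover_seq (f := V) cpsi.
- by have [] := VP _ cx.
- by have [] := VP _ cx.
have : {ae mu, forall y, D y -> psi y != 0 -> phi y = 0}.
  have : {ae mu, forall y x, x \in s -> V x y -> D y -> phi y = 0}.
    elim: s {scov} sS => [_|x s IH sS]; first exact: aeW.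
    have /IH : forall x', x' \in s -> closure [set y | psi y != 0] x'.
      by move=> x' x's; apply: sS; rewrite inE x's orbT.
    have [_ _] := VP _ (sS _ (mem_head x s)); apply: filterS2 => y h1 h2 x'.
    by rewrite inE => /predU1P[->|/h2].
  apply: filterS => y h Dy py.
  have [x xs Vxy] : exists2 x, x \in s & V x y by apply: scov; exact: subset_closure.
  exact: h xs Vxy Dy.
move=> ae0; rewrite /Rintegral.
have -> : (\int[mu]_(x in D `\` S) (phi x * psi x)%:E = \int[mu]_(x in D `\` S) 0)%E.
  apply: ae_eq_integral => //.
    apply/measurable_EFinP/measurable_funM.
      apply: measurable_funS mD _ _; first exact: subDsetl.
      by apply/measurable_EFinP; exact: measurable_int phiD.
    by apply: measurable_funTS; exact: test_function_measurable tpsi.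
  apply: filterS ae0 => y h [Dy _]; have [->|py] := eqVneq (psi y) 0; first by rewrite mulr0.
  by rewrite h// mul0r.
by rewrite integral0.
Qed.

End L2_vectors.

(** * Inequalities in L^2 and truncation at a level *)

Section L2_estimates.
Context {R : realType} {N : nat}.
Local Notation T := 'rV[R]_N.
Local Notation mu := (lebesgue_rV R N).
Implicit Types (f g h : T -> R).

Lemma ipL2_add_le f g : L2fun mu f -> L2fun mu g ->
  ipL2 mu (f + g) (f + g) <= 2 * ipL2 mu f f + 2 * ipL2 mu g g.
Proof.
move=> L2f L2g; have H := hilbert_L2 mu.
have := ipL2_ge0 mu (f - g); rewrite (ip_sqrB H)// (ip_sqrD H)//; lra.
Qed.

Lemma ipL2_sub_le f g : L2fun mu f -> L2fun mu g ->
  ipL2 mu (f - g) (f - g) <= 2 * ipL2 mu f f + 2 * ipL2 mu g g.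
Proof.
move=> L2f L2g; have H := hilbert_L2 mu.
have := ipL2_ge0 mu (f + g); rewrite (ip_sqrB H)// (ip_sqrD H)//; lra.
Qed.

Lemma ipL2_le_pointwise f g : L2fun mu f -> L2fun mu g ->
  (forall x, f x ^+ 2 <= g x ^+ 2) -> ipL2 mu f f <= ipL2 mu g g.
Proof.
move=> L2f L2g fg; rewrite -lee_fin !ipL2E//; apply: ge0_le_integral => //.
- by move=> x _; rewrite lee_fin sqr_ge0.
- by apply/measurable_EFinP/measurable_funX; exact: L2fun_measurable L2f.
- by apply/measurable_EFinP/measurable_funX; exact: L2fun_measurable L2g.
- by move=> x _; rewrite lee_fin.
Qed.

Lemma ipL2_mul_le h f c : measurable_fun setT h -> (forall x, `|h x| <= c) ->
  L2fun mu f -> ipL2 mu (fun x => h x * f x) (fun x => h x * f x) <= c ^+ 2 * ipL2 mu f f.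
Proof.
move=> mh hc L2f; have H := hilbert_L2 mu.
have -> : c ^+ 2 * ipL2 mu f f = ipL2 mu (c *: f) (c *: f).
  by rewrite (ipZl H) ?(ipZr H)// ?mulrA -?expr2//; exact: (hilbertZ H).
apply: ipL2_le_pointwise; [exact: L2fun_mul_bounded hc L2f|exact: (hilbertZ H)|].
move=> x; rewrite !fctE /GRing.scale/= !exprMn ler_wpM2r ?sqr_ge0//.
by rewrite -[leLHS]real_normK ?num_real// lerXn2r ?nnegrE// (le_trans _ (hc x)).
Qed.

Lemma ipL2_mulA h f g : ipL2 mu (fun x => h x * f x) g = ipL2 mu f (fun x => h x * g x).
Proof. by apply: eq_Rintegral => x _; ring. Qed.

Lemma ae_eq_ipL2 f f' g : L2fun mu f -> L2fun mu f' -> L2fun mu g ->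
  {ae mu, forall x, f x = f' x} -> ipL2 mu f g = ipL2 mu f' g.
Proof.
move=> L2f L2f' L2g ff'; rewrite /ipL2 /Rintegral; congr fine.
apply: ae_eq_integral => //.
- exact: measurable_int (L2funM_integrable L2f L2g).
- exact: measurable_int (L2funM_integrable L2f' L2g).
- by apply: filterS ff' => x ->.
Qed.

(** With y = f x, y^2 <= M^2 where |y| <= M, and y^2 <= M^(2-p) |y|^p elsewhere because p > 2. The
    first part is weighted by the squared remainder of the cutoff; the second is small for large
    M. *)
Lemma cutoff_remainder f (chi : T -> R) (A : set T) (p M : R) (P : \bar R) : 2 < p -> 0 < M ->
  L2fun mu f -> measurable_fun setT chi -> (forall x, 0 <= chi x <= 1) ->
  measurable A -> (forall x, ~ A x -> f x = 0) ->
  (\int[mu]_x (`|f x| `^ p)%:E <= P)%E ->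
  (\int[mu]_x (((1 - chi x) * f x) ^+ 2)%:E <=
    (M ^+ 2)%:E * \int[mu]_(x in A) ((1 - chi x) ^+ 2)%:E + (M `^ (2 - p))%:E * P)%E.
Proof.
move=> p2 M0 L2f mchi chi01 mA fA fP.
have mf := L2fun_measurable L2f.
have mc2 : measurable_fun setT (fun x => (1 - chi x) ^+ 2).
  by apply: measurable_funX; apply: measurable_funB.
have mfp : measurable_fun setT (fun x => `|f x| `^ p).
  apply: (measurableT_comp (measurable_powR _)) => //.
  exact: measurableT_comp.
have key (y : R) : y ^+ 2 <= M ^+ 2 + M `^ (2 - p) * `|y| `^ p.
  have [yM|My] := leP `|y| M.
    rewrite -[y ^+ 2]real_normK ?num_real//; apply: (@le_trans _ _ (M ^+ 2)).
      by rewrite lerXn2r ?nnegrE// ltW.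
    by rewrite lerDl mulr_ge0 ?powR_ge0.
  have y0 : 0 < `|y| := lt_trans M0 My.
  apply: (@le_trans _ _ (M `^ (2 - p) * `|y| `^ p)); last by rewrite lerDr sqr_ge0.
  rewrite -[y ^+ 2]real_normK ?num_real// -powR_mulrn//.
  have -> : `|y| `^ 2%:R = `|y| `^ (2 - p) * `|y| `^ p.
    by rewrite -powRD ?subrK// gt_eqF// implybT.
  rewrite ler_wpM2r ?powR_ge0//.
  have np : 2 - p = - (p - 2) by rewrite opprB.
  rewrite np !powRN lef_pV2 ?posrE ?powR_gt0//.
  by rewrite ge0_ler_powR ?nnegrE ?ltW// subr_gt0.
rewrite [X in (_ <= _ * X + _)%E]integral_mkcond.
apply: (@le_trans _ _ (\int[mu]_x ((M ^+ 2)%:E * ((fun x => ((1 - chi x) ^+ 2)%:E) \_ A) x +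
    (M `^ (2 - p))%:E * (`|f x| `^ p)%:E))%E).
  apply: ge0_le_integral => //.
  - by move=> x _; rewrite lee_fin sqr_ge0.
  - apply/measurable_EFinP/measurable_funX/measurable_funM => //.
    exact: measurable_funB.
  - apply: emeasurable_funD; apply: measurable_funeM.
      apply/(measurable_restrictT _ mA); apply: measurable_funTS.
      exact/measurable_EFinP.
    exact/measurable_EFinP.
  move=> x _; rewrite patchE; have [Ax|Ax] := pselect (A x).
    rewrite mem_set// -!EFinM -EFinD lee_fin exprMn.
    have /andP[c0 c1] := chi01 x; have := key (f x).
    have f0 : 0 <= M `^ (2 - p) * `|f x| `^ p by rewrite mulr_ge0 ?powR_ge0.
    have k0 : 0 <= (1 - chi x) ^+ 2 by exact: sqr_ge0.
    have k1 : (1 - chi x) ^+ 2 <= 1 by rewrite expr_le1//; lra.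
    move: f0 k0 k1; move: (M `^ _ * _) ((1 - chi x) ^+ 2) (M ^+ 2) (f x ^+ 2) => a k m y a0 k0 k1 h.
    nra.
  rewrite memNset// fA// mulr0 expr0n mule0 add0e -EFinM lee_fin.
  by rewrite mulr_ge0 ?powR_ge0.
rewrite ge0_integralD; last 5 first.
- exact: measurableT.
- move=> x _; rewrite mule_ge0 ?lee_fin ?sqr_ge0//.
  by rewrite patchE; case: ifP => // _; rewrite lee_fin sqr_ge0.
- apply: measurable_funeM; apply/(measurable_restrictT _ mA); apply: measurable_funTS.
  exact/measurable_EFinP.
- by move=> x _; rewrite mule_ge0 ?lee_fin ?powR_ge0.
- by apply: measurable_funeM; exact/measurable_EFinP.
rewrite ge0_integralZl_EFin; last 4 first.
- exact: measurableT.
- by move=> x _; rewrite patchE; case: ifP => // _; rewrite lee_fin sqr_ge0.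
- apply/(measurable_restrictT _ mA); apply: measurable_funTS.
  exact/measurable_EFinP.
- exact: sqr_ge0.
rewrite ge0_integralZl_EFin; last 4 first.
- exact: measurableT.
- by move=> x _; rewrite lee_fin powR_ge0.
- exact/measurable_EFinP.
- exact: powR_ge0.
by rewrite leeD2l// lee_wpmul2l// lee_fin powR_ge0.
Qed.

Lemma powR_small (p e : R) : 2 < p -> 0 < e -> exists2 M, 0 < M & M `^ (2 - p) = e.
Proof.
move=> p2 e0; exists (e `^ (2 - p)^-1); first by rewrite powR_gt0.
rewrite -powRrM mulVf ?powRr1//; first exact: ltW.
by rewrite subr_eq0 lt_eqF.
Qed.

End L2_estimates.

(** * Cutoffs of Sobolev functions and local strong convergence *)

Section sobolev_calculus.
Context {R : realType} {N : nat}.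
Local Notation T := 'rV[R]_N.
Local Notation mu := (lebesgue_rV R N).
Implicit Types (U W : set T) (u v chi : T -> R) (Du Dv : T -> T).

Definition mul_gradient chi u Du : T -> T :=
  fun x => \row_i (chi x * Du x ord0 i + partial i chi x * u x).

Lemma ext0M U (f g : T -> R) : ext0 U (fun x => f x * g x) = fun x => f x * ext0 U g x.
Proof.
apply/funext => x; have [Ux|Ux] := pselect (U x); first by rewrite !ext0_in.
by rewrite !ext0_out// mulr0.
Qed.

Lemma ext0D U (f g : T -> R) :
  ext0 U (fun x => f x + g x) = fun x => ext0 U f x + ext0 U g x.
Proof.
apply/funext => x; have [Ux|Ux] := pselect (U x); first by rewrite !ext0_in.
by rewrite !ext0_out// addr0.
Qed.

Lemma L2fun_test_mul chi V f : test_function V chi -> L2fun mu f ->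
  L2fun mu (fun x => chi x * f x).
Proof.
move=> tchi L2f; have [M M0 cM] := test_function_bounded tchi.
exact: L2fun_mul_bounded (test_function_measurable tchi) cM L2f.
Qed.

Lemma H1_cst1 W : open W -> bounded_set W -> H1 W (cst 1) (cst 0).
Proof.
move=> oW bW; have mW := measurable_mx_open oW.
have Woo : (mu W < +oo)%E by exact: bounded_lebesgue_lty.
split.
  apply/L2_graphP; split.
    rewrite (_ : ext0 W _ = \1_W); first exact: L2fun_indic.
    apply/funext => x; rewrite indicE; have [Wx|Wx] := pselect (W x).
      by rewrite ext0_in// mem_set.
    by rewrite ext0_out// memNset.
  move=> i; rewrite (_ : ext0 W _ = (fun=> 0)); first exact: L2fun0.
  apply/funext => x; have [Wx|Wx] := pselect (W x); last by rewrite ext0_out.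
  by rewrite ext0_in// mxE.
move=> i phi tphi.
under eq_Rintegral do rewrite mul1r.
under [in RHS]eq_Rintegral do rewrite mxE mul0r.
rewrite [in RHS]Rintegral_cst// mul0r oppr0.
rewrite -(Rintegral_partial0 i (test_functionS (@subsetT _ _) tphi)).
rewrite Rintegral_mkcond; apply: eq_Rintegral => x _; rewrite patchE.
have [Wx|Wx] := pselect (W x); first by rewrite mem_set.
by rewrite memNset// (test_function_out (test_function_partial i tphi) Wx).
Qed.

Lemma H1_restrict U W u Du : open U -> U `<=` W -> H1 W u Du -> H1 U u Du.
Proof.
move=> oU UW [/L2_graphP[L2u L2Du] wg]; have mU := measurable_mx_open oU.
have e (f : T -> R) : ext0 U f = (ext0 W f) \_ U.
  apply/funext => x; rewrite patchE; have [Ux|Ux] := pselect (U x).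
    by rewrite mem_set// !ext0_in//; exact: UW.
  by rewrite memNset// ext0_out.
split; last exact: weak_gradient_restrict wg.
by apply/L2_graphP; split=> [|i]; rewrite e; exact: L2fun_patch.
Qed.

Lemma H1_ext0 U V u Du : open U -> open V -> U `&` V = set0 ->
  H1 U u Du -> H1 (U `|` V) (ext0 U u) (ext0 U Du).
Proof.
move=> oU oV UV0 [/L2_graphP[L2u L2Du] wg].
split; last exact: weak_gradient_ext0.
have e (f : T -> R) : ext0 (U `|` V) (ext0 U f) = ext0 U f.
  apply/funext => x; have [Ux|Ux] := pselect (U x).
    by rewrite ext0_in//; left.
  have [UVx|UVx] := pselect ((U `|` V) x); first by rewrite ext0_in.
  by rewrite !ext0_out.
apply/L2_graphP; split=> [|i]; first by rewrite e.
rewrite (_ : (fun x => ext0 U Du x ord0 i) = ext0 U (fun x => Du x ord0 i)) ?e//.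
apply/funext => x; have [Ux|Ux] := pselect (U x); first by rewrite !ext0_in.
by rewrite !ext0_out// mxE.
Qed.

Lemma H1_mul U chi u Du : open U -> test_function setT chi -> H1 U u Du ->
  H1 U (fun x => chi x * u x) (mul_gradient chi u Du).
Proof.
move=> oU tchi [/L2_graphP[L2u L2Du] wg]; have schi : smooth chi by case: tchi.
have tp i := test_function_partial i tchi.
split.
  apply/L2_graphP; split=> [|i].
    by rewrite ext0M; exact: L2fun_test_mul tchi L2u.
  rewrite (_ : (fun x => _) = (fun x => chi x * Du x ord0 i + partial i chi x * u x)).
    rewrite ext0D !ext0M; apply: L2funD; first exact: L2fun_test_mul tchi (L2Du i).
    exact: L2fun_test_mul (tp i) L2u.
  by apply/funext => x; rewrite mxE.
move=> i phi tphi; under [in RHS]eq_Rintegral do rewrite mxE.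
apply: weak_leibniz => //; first by case: tphi.
- exact: test_functionM.
- by left.
Qed.

(** [chi] is compactly supported in [W], so [chi * psi] may be tested in [W] for every [psi]; the
    truncated function acquires a weak gradient on the whole space, the setting of the translation
    estimates. *)
Lemma cutoff_global_gradient W chi v Dv : open W -> test_function W chi -> H1 W v Dv ->
  global_weak_gradient (fun x => chi x * ext0 W v x)
    (fun i x => chi x * ext0 W (fun y => Dv y ord0 i) x + partial i chi x * ext0 W v x).
Proof.
move=> oW tchi [/L2_graphP[L2v L2Dv] wg] i psi tpsi.
have schi : smooth chi by case: tchi.
have spsi : smooth psi by case: tpsi.
have tt : test_function W (fun x => chi x * psi x).
  by under eq_fun do rewrite mulrC; exact: test_functionM.
have := @weak_leibniz _ _ W v Dv chi psi i oW L2v (L2Dv i) wg schi spsi tt (or_intror tpsi).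
rewrite Rintegral_mkcond [X in _ = - X]Rintegral_mkcond => h.
transitivity (\int[mu]_x ((fun x => chi x * v x * partial i psi x) \_ W) x).
  apply: eq_Rintegral => x _; rewrite patchE; have [Wx|Wx] := pselect (W x).
    by rewrite mem_set// ext0_in.
  by rewrite memNset// ext0_out// mulr0 mul0r.
rewrite h; congr (- _); apply: eq_Rintegral => x _.
rewrite patchE; have [Wx|Wx] := pselect (W x).
  by rewrite mem_set// !ext0_in.
by rewrite memNset// !ext0_out// !mulr0 addr0 mul0r.
Qed.

(** The domains vary with n, but the support of [chi] is compact in [Omega \ L] and avoids [L_ n]
    from a rank [n0] on. The truncated differences then have global gradients bounded in L^2, and
    they tend weakly to 0. *)
Lemma local_strong_cvg (Omega L : set T) (L_ : nat -> set T) (f_ : nat -> T -> R)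
    (Df_ : nat -> T -> T) f Df chi (C : R) :
  open Omega -> closed L -> (forall n, closed (L_ n)) ->
  (forall S, compact S -> S `&` L = set0 -> \forall n \near \oo, S `&` L_ n = set0) ->
  (forall n, H1 (Omega `\` L_ n) (f_ n) (Df_ n)) -> H1 (Omega `\` L) f Df ->
  (forall n, ipL2 mu (ext0 (Omega `\` L_ n) (f_ n)) (ext0 (Omega `\` L_ n) (f_ n)) <= C) ->
  (forall n i, ipL2 mu (ext0 (Omega `\` L_ n) (fun x => Df_ n x ord0 i))
                       (ext0 (Omega `\` L_ n) (fun x => Df_ n x ord0 i)) <= C) ->
  (forall z, L2fun mu z -> ipL2 mu (ext0 (Omega `\` L_ n) (f_ n)) z @[n --> \oo] -->
     ipL2 mu (ext0 (Omega `\` L) f) z) ->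
  test_function (Omega `\` L) chi ->
  let d n x := chi x * (ext0 (Omega `\` L_ n) (f_ n) x - ext0 (Omega `\` L) f x) in
  ipL2 mu (d n) (d n) @[n --> \oo] --> (0 : R).
Proof.
move=> oO cL cL_ LL H1f_ H1f fC DfC fw tchi d; have H := hilbert_L2 mu.
set W := Omega `\` L in H1f fw tchi d *.
pose W_ n := Omega `\` L_ n.
have oW : open W by apply: openI => //; exact: closed_openC.
have oW_ n : open (W_ n) by apply: openI => //; exact: closed_openC.
pose B := closure [set x | chi x != 0].
have cB : compact B by case: tchi.
have BW : B `<=` W by case: tchi.
have [n0 _ n0P] : \forall n \near \oo, B `&` L_ n = set0.
  by apply: LL => //; apply/seteqP; split => x // [/BW[]].
have tchin n : (n0 <= n)%N -> test_function (W_ n) chi.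
  move=> n0n; have [schi _ _] := tchi; split => // x Bx.
  split; first by have [] := BW _ Bx.
  by move=> Lx; have : (B `&` L_ n) x by []; rewrite n0P.
have L2f : L2fun mu (ext0 W f) by case: H1f => /L2_graphP[].
have L2Df i : L2fun mu (ext0 W (fun x => Df x ord0 i)) by case: H1f => /L2_graphP[].
have L2f_ n : L2fun mu (ext0 (W_ n) (f_ n)) by case: (H1f_ n) => /L2_graphP[].
have L2Df_ n i : L2fun mu (ext0 (W_ n) (fun x => Df_ n x ord0 i)).
  by case: (H1f_ n) => /L2_graphP[].
have tT : test_function setT chi := test_functionS (@subsetT _ _) tchi.
have tp i := test_function_partial i tT.
pose G_ n i : T -> R :=
  fun x => chi x * ext0 (W_ n) (fun y => Df_ n y ord0 i) x + partial i chi x * ext0 (W_ n) (f_ n) x.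
pose G i : T -> R :=
  fun x => chi x * ext0 W (fun y => Df y ord0 i) x + partial i chi x * ext0 W f x.
pose g n i := G_ n i - G i.
have dE n : d n = (fun x => chi x * ext0 (W_ n) (f_ n) x) - (fun x => chi x * ext0 W f x).
  by apply/funext => x; rewrite /d mulrBr.
have L2cf n : L2fun mu (fun x => chi x * ext0 (W_ n) (f_ n) x) by exact: L2fun_test_mul tT (L2f_ n).
have L2c : L2fun mu (fun x => chi x * ext0 W f x) by exact: L2fun_test_mul tT L2f.
have L2d n : L2fun mu (d n) by rewrite dE; exact: L2funB.
have L2gn n i : L2fun mu (G_ n i).
  apply: L2funD; first exact: L2fun_test_mul tT (L2Df_ n i).
  exact: L2fun_test_mul (tp i) (L2f_ n).
have L2gg i : L2fun mu (G i).
  apply: L2funD; first exact: L2fun_test_mul tT (L2Df i).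
  exact: L2fun_test_mul (tp i) L2f.
have L2g n i : L2fun mu (g n i) by exact: L2funB.
have [M M0 cM] := test_function_bounded tT.
have /choice[M' M'P] i : exists M', forall x, `|partial i chi x| <= M'.
  by have [M' _ h] := test_function_bounded (tp i); exists M'.
have C0 : 0 <= C := le_trans (ipL2_ge0 mu _) (fC 0%N).
(* These constants come from (a - b)^2 <= 2 a^2 + 2 b^2, with [M] and [M' i] bounding [chi] and its
   partial derivatives. *)
pose Cd := 2 * (M ^+ 2 * C) + 2 * ipL2 mu (fun x => chi x * ext0 W f x) (fun x => chi x * ext0 W f x).
pose Cg i := 2 * (2 * (M ^+ 2 * C) + 2 * (M' i ^+ 2 * C)) + 2 * ipL2 mu (G i) (G i).
have mchi := test_function_measurable tT.
have Cd0 : 0 <= Cd by rewrite addr_ge0 ?mulr_ge0 ?sqr_ge0 ?ipL2_ge0.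
have Cg0 i : 0 <= Cg i.
  have := ipL2_ge0 mu (G i); rewrite /Cg.
  have : 0 <= M ^+ 2 * C by rewrite mulr_ge0// sqr_ge0.
  have : 0 <= M' i ^+ 2 * C by rewrite mulr_ge0// sqr_ge0.
  lra.
(* The compactness theorem asks for a global gradient at every index, hence the shift. *)
rewrite -(cvg_shiftn n0).
apply: (@rellich _ _ B (fun n => d (n + n0)%N) (fun n => g (n + n0)%N) (Cd + \sum_i Cg i)).
- exact: compact_bounded.
- by apply: closed_measurable_rV; exact: closed_closure.
- by move=> n; exact: L2d.
- by move=> n i; exact: L2g.
- move=> n i psi tpsi; have L2psi := test_function_L2 tpsi.
  have L2dpsi := test_function_L2 (test_function_partial i tpsi).
  rewrite dE (ipBl H)// /g (ipBl H)//.
  rewrite (cutoff_global_gradient oW tchi H1f)//.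
  rewrite (cutoff_global_gradient (oW_ _) (tchin _ (leq_addl _ _)) (H1f_ _))//.
  by rewrite opprB opprK addrC.
- by move=> n x Bx; rewrite /d (nbhs_singleton (near_support0 Bx)) mul0r.
- move=> n; apply: (@le_trans _ _ Cd); last by rewrite lerDl sumr_ge0.
  rewrite dE; apply: le_trans (ipL2_sub_le (L2cf _) L2c) _.
  rewrite lerD2r ler_pM2l//; apply: le_trans (ipL2_mul_le mchi cM (L2f_ _)) _.
  by rewrite ler_wpM2l ?sqr_ge0//; exact: fC.
- move=> n i; apply: (@le_trans _ _ (Cg i)); last first.
    rewrite (bigD1 i)//= addrCA lerDl addr_ge0// sumr_ge0// => j _; exact: Cg0.
  rewrite /g; apply: le_trans (ipL2_sub_le (L2gn _ i) (L2gg i)) _.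
  rewrite lerD2r ler_pM2l//.
  have L2a := L2fun_test_mul tT (L2Df_ (n + n0)%N i).
  have L2b := L2fun_test_mul (tp i) (L2f_ (n + n0)%N).
  apply: le_trans (ipL2_add_le L2a L2b) _.
  apply: lerD; rewrite ler_pM2l//.
    apply: le_trans (ipL2_mul_le mchi cM (L2Df_ _ i)) _.
    by rewrite ler_wpM2l ?sqr_ge0//; exact: DfC.
  apply: le_trans (ipL2_mul_le (test_function_measurable (tp i)) (M'P i) (L2f_ _)) _.
  by rewrite ler_wpM2l ?sqr_ge0//; exact: fC.
- move=> z L2z; rewrite (cvg_shiftn n0 (fun n => ipL2 mu (d n) z)).
  have L2cz : L2fun mu (fun x => chi x * z x) by exact: L2fun_test_mul tT L2z.
  have e n : ipL2 mu (d n) z = ipL2 mu (ext0 (W_ n) (f_ n)) (fun x => chi x * z x)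
      - ipL2 mu (ext0 W f) (fun x => chi x * z x).
    rewrite -(ipBl H)// -[RHS](@ipL2_mulA _ _ chi).
    by apply: eq_Rintegral => x _.
  under eq_fun do rewrite e.
  by apply/subr_cvg0; exact: fw.
Qed.

End sobolev_calculus.

(** * From local to global strong convergence *)

Section limits.
Context {R : realType} {N : nat}.
Local Notation T := 'rV[R]_N.
Local Notation mu := (lebesgue_rV R N).
Implicit Types (U W Omega : set T) (u v : T -> R) (Du Dv : T -> T).

Lemma ipL2_eq0_ae (f : T -> R) : L2fun mu f -> ipL2 mu f f = 0 ->
  {ae mu, forall x, f x = 0}.
Proof.
move=> L2f f0; have := ipL2E L2f; rewrite f0 => /esym e.
have mf2 : measurable_fun setT (fun x => (f x ^+ 2)%:E).
  by apply/measurable_EFinP/measurable_funX; exact: L2fun_measurable L2f.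
have /(ae_eq_integral_abs mu measurableT mf2) :
    (\int[mu]_x `|(f x ^+ 2)%:E| = 0)%E.
  by rewrite -[RHS]e; apply: eq_integral => x _; rewrite gee0_abs// lee_fin sqr_ge0.
by apply: filterS => x /(_ I) /= [] /eqP; rewrite sqrf_eq0 => /eqP.
Qed.

Lemma homo_cvg_infty (s : nat -> nat) : {homo s : i j / (i < j)%N} ->
  s @ \oo --> \oo.
Proof.
move=> hs; have sj j : (j <= s j)%N.
  by elim: j => // j IH; exact: leq_ltn_trans IH (hs _ _ (ltnSn j)).
move=> A [n0 _ n0A]; exists n0 => // j /= n0j; apply: n0A => /=.
exact: leq_trans n0j (sj j).
Qed.

(** The difference is split as chi (f_n - f) + (1 - chi) f_n - (1 - chi) f. The set [A_ n] carries
    [f_ n]; the smallness of its part in [L] makes the middle term accessible to the truncation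
    estimate. *)
Lemma strong_cvg_of_weak Omega (L : set T) (L_ A_ : nat -> set T) (f_ : nat -> T -> R)
    (Df_ : nat -> T -> T) f Df (C p P : R) :
  open Omega -> bounded_set Omega -> closed L -> (forall n, closed (L_ n)) ->
  (forall S, compact S -> S `&` L = set0 -> \forall n \near \oo, S `&` L_ n = set0) ->
  (forall n, H1 (Omega `\` L_ n) (f_ n) (Df_ n)) -> H1 (Omega `\` L) f Df ->
  (forall n, ipL2 mu (ext0 (Omega `\` L_ n) (f_ n)) (ext0 (Omega `\` L_ n) (f_ n)) <= C) ->
  (forall n i, ipL2 mu (ext0 (Omega `\` L_ n) (fun x => Df_ n x ord0 i))
                       (ext0 (Omega `\` L_ n) (fun x => Df_ n x ord0 i)) <= C) ->
  (forall z, L2fun mu z -> ipL2 mu (ext0 (Omega `\` L_ n) (f_ n)) z @[n --> \oo] -->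
     ipL2 mu (ext0 (Omega `\` L) f) z) ->
  (forall n, measurable (A_ n)) -> (forall n, A_ n `<=` Omega) ->
  (forall n x, ~ A_ n x -> ext0 (Omega `\` L_ n) (f_ n) x = 0) ->
  ipL2 mu \1_(A_ n) \1_(Omega `&` L) @[n --> \oo] --> (0 : R) ->
  2 < p -> 0 <= P ->
  (forall n, (\int[mu]_x (`|ext0 (Omega `\` L_ n) (f_ n) x| `^ p)%:E <= P%:E)%E) ->
  let d n := ext0 (Omega `\` L_ n) (f_ n) - ext0 (Omega `\` L) f in
  ipL2 mu (d n) (d n) @[n --> \oo] --> (0 : R).
Proof.
move=> oO bO cL cL_ LL H1f_ H1f fC DfC fw mA AO fA bad p2 P0 fP d.
have H := hilbert_L2 mu.
set W := Omega `\` L in H1f fw d *.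
pose W_ n := Omega `\` L_ n.
have oW : open W by apply: openI => //; exact: closed_openC.
have mW := measurable_mx_open oW.
have mO := measurable_mx_open oO.
have Ooo : (mu Omega < +oo)%E by exact: bounded_lebesgue_lty.
have Woo : (mu W < +oo)%E.
  by apply: le_lt_trans Ooo; apply: le_measure; rewrite ?inE//; exact: subDsetl.
have L2f : L2fun mu (ext0 W f) by case: H1f => /L2_graphP[].
have L2f_ n : L2fun mu (ext0 (W_ n) (f_ n)) by case: (H1f_ n) => /L2_graphP[].
have [chi [tchi chi01 chi1]] := cutoff_sequence oW.
have mchi k : measurable_fun setT (chi k) := test_function_measurable (tchi k).
have chin k x : `|1 - chi k x| <= 1.
  by have /andP[c0 c1] := chi01 k x; rewrite ger0_norm; lra.
have mc k : measurable_fun setT (fun x => 1 - chi k x) by exact: measurable_funB.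
have c1 : \int[mu]_(x in W) ((1 - chi k x) ^+ 2) @[k --> \oo] --> (0 : R).
  have -> : (0 : R) = \int[mu]_(x in W) (cst 0 : T -> R) x by rewrite Rintegral_cst// mul0r.
  apply: (Rintegral_dominated_cvg mW (g := cst 1)).
  - by move=> k; apply: measurable_funTS; exact: measurable_funX.
  - exact: measurable_cst.
  - apply: aeW => x Wx; apply: cvg_near_cst; apply: filterS (chi1 x Wx) => k ->.
    by rewrite subrr expr0n.
  - apply: measurable_bounded_integrable => //.
    by exists 1; split=> [|M cM x _]; [exact: num_real|rewrite /= normr1 ltW].
  - by move=> k x _; rewrite normrX expr_le1.
have c2 : ipL2 mu (fun x => (1 - chi k x) * ext0 W f x) (fun x => (1 - chi k x) * ext0 W f x)
    @[k --> \oo] --> (0 : R).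
  have -> : (0 : R) = \int[mu]_x (cst 0 : T -> R) x.
    by rewrite /Rintegral; under eq_integral do rewrite /=; rewrite integral0.
  apply: (Rintegral_dominated_cvg measurableT (g := fun x => ext0 W f x ^+ 2)).
  - have mm k : measurable_fun setT (fun x => (1 - chi k x) * ext0 W f x).
      by apply: measurable_funM => //; exact: L2fun_measurable L2f.
    by move=> k; exact: measurable_funM.
  - exact: measurable_cst.
  - apply: aeW => x _; apply: cvg_near_cst; have [Wx|Wx] := pselect (W x).
      by apply: filterS (chi1 x Wx) => k ->; rewrite subrr mul0r mul0r.
    by apply: nearW => k; rewrite ext0_out// mulr0 mulr0.
  - exact: L2fun_sqr.
  - move=> k x _; rewrite -expr2 ger0_norm ?sqr_ge0// exprMn ler_piMl ?sqr_ge0//.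
    by rewrite -[leLHS]real_normK ?num_real// expr_le1.
apply/cvgrPdistC_lt => e e0.
(* The three squared norms are bounded by e1, 3 e1 and e1; using (a + b)^2 <= 2 a^2 + 2 b^2 twice,
   they add up to 2 e1 + 2 (6 e1 + 2 e1) = 18 e1 < e. *)
pose e1 := e / 20; have e10 : 0 < e1 by rewrite divr_gt0.
have P1 : 0 < P + 1 by rewrite ltr_wpDl.
(* The level [M] is chosen first, so that M^(2-p) P <= e1; the cutoff is chosen afterwards to
   compensate the factor M^2. Dividing by P + 1 allows P = 0. *)
have [M M0 Me] := powR_small p2 (divr_gt0 e10 P1).
have M2 : 0 < M ^+ 2 by rewrite exprn_gt0.
have eM : 0 < e1 / M ^+ 2 by rewrite divr_gt0.
have [k [k1 k2]] : exists k, \int[mu]_(x in W) ((1 - chi k x) ^+ 2) < e1 / M ^+ 2 /\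
    ipL2 mu (fun x => (1 - chi k x) * ext0 W f x) (fun x => (1 - chi k x) * ext0 W f x) < e1.
  move/cvgrPdistC_lt : c1 => /(_ _ eM) n1; move/cvgrPdistC_lt : c2 => /(_ _ e10) n2.
  have [k [h1 h2]] := filter_ex (filterI n1 n2).
  exists k; rewrite !subr0 in h1 h2.
  by split; [exact: le_lt_trans (ler_norm _) h1|exact: le_lt_trans (ler_norm _) h2].
have c3 := local_strong_cvg oO cL cL_ LL H1f_ H1f fC DfC fw (tchi k).
move/cvgrPdistC_lt : c3 => /(_ _ e10); move/cvgrPdistC_lt : bad => /(_ _ eM).
apply: filterS2 => n; rewrite !subr0 => bn cn.
rewrite ger0_norm ?ipL2_ge0//.
have {}bn := le_lt_trans (ler_norm _) bn; have {}cn := le_lt_trans (ler_norm _) cn.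
pose d1 x := chi k x * (ext0 (W_ n) (f_ n) x - ext0 W f x).
pose d2 x := (1 - chi k x) * ext0 (W_ n) (f_ n) x.
pose d3 x := (1 - chi k x) * ext0 W f x.
have L2d1 : L2fun mu d1 by apply: (L2fun_test_mul (tchi k)); exact: L2funB.
have L2d2 : L2fun mu d2 by exact: L2fun_mul_bounded (mc k) (chin k) (L2f_ n).
have L2d3 : L2fun mu d3 by exact: L2fun_mul_bounded (mc k) (chin k) L2f.
have -> : d n = d1 + (d2 - d3).
  by apply/funext => x; rewrite /d /d1 /d2 /d3 !fctE; ring.
have L2d23 : L2fun mu (d2 - d3) by exact: L2funB.
apply: le_lt_trans (ipL2_add_le L2d1 L2d23) _.
have := ipL2_sub_le L2d2 L2d3.
suff : ipL2 mu d2 d2 <= e1 + e1 + e1.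
  by move: cn k2; rewrite -/d1 -/d3 /e1; lra.
have mL : measurable L by exact: closed_measurable_rV.
have mOL : measurable (Omega `&` L) by exact: measurableI.
have fin (S : set T) : measurable S -> S `<=` Omega -> (mu S < +oo)%E.
  by move=> mS SO; apply: le_lt_trans Ooo; apply: le_measure; rewrite ?inE.
have iW : mu.-integrable W (EFin \o (fun x => (1 - chi k x) ^+ 2)).
  apply: measurable_bounded_integrable => //.
    by apply: measurable_funTS; exact: measurable_funX.
  exists 1; split=> [|c cM x _]; first exact: num_real.
  by apply: le_trans (ltW cM); rewrite /= normrX expr_le1.
(* A point of [A_ n] is either in [W], where the remainder of the cutoff is counted, or in [L],
   where the remainder is at most 1 and the measure of the part of [A_ n] in [L] is counted. *)
have hA : (\int[mu]_(x in A_ n) ((1 - chi k x) ^+ 2)%:E <=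
    (\int[mu]_(x in W) ((1 - chi k x) ^+ 2) + ipL2 mu \1_(A_ n) \1_(Omega `&` L))%:E)%E.
  have L2A : L2fun mu \1_(A_ n) by apply: L2fun_indic => //; exact: fin.
  have L2OL : L2fun mu \1_(Omega `&` L).
    by apply: L2fun_indic => //; apply: fin => //; exact: subIsetl.
  have iAL := L2funM_integrable L2A L2OL.
  rewrite EFinD /ipL2 /Rintegral !fineK; [|exact: integrable_fin_num..].
  rewrite (integral_mkcond (A_ n)) (integral_mkcond W) -ge0_integralD; last 5 first.
  - exact: measurableT.
  - by move=> x _; rewrite patchE; case: ifP => // _; rewrite lee_fin sqr_ge0.
  - apply/(measurable_restrictT _ mW); apply/measurable_EFinP; apply: measurable_funTS.
    exact: measurable_funX.
  - by move=> x _; rewrite lee_fin mulr_ge0// indicE.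
  - by apply/measurable_EFinP/measurable_funM; exact: measurable_indic.
  apply: ge0_le_integral => //.
  - by move=> x _; rewrite patchE; case: ifP => // _; rewrite lee_fin sqr_ge0.
  - apply/(measurable_restrictT _ (mA n)); apply/measurable_EFinP; apply: measurable_funTS.
    exact: measurable_funX.
  - apply: emeasurable_funD.
      apply/(measurable_restrictT _ mW); apply/measurable_EFinP; apply: measurable_funTS.
      exact: measurable_funX.
    by apply/measurable_EFinP/measurable_funM; exact: measurable_indic.
  move=> x _; rewrite !patchE !indicE; have [Ax|Ax] := pselect (A_ n x); last first.
    rewrite [in leLHS]memNset//; apply: adde_ge0; last by rewrite lee_fin mulr_ge0.
    by case: ifP => // _; rewrite lee_fin sqr_ge0.
  rewrite (mem_set Ax) mul1r; have Ox := AO _ _ Ax.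
  have [Lx|Lx] := pselect (L x).
    rewrite memNset; last by move=> [_]; apply.
    rewrite mem_set//= add0e lee_fin -[leLHS]real_normK ?num_real// expr_le1//.
  rewrite mem_set// memNset; last by move=> [_].
  by rewrite adde0.
have := cutoff_remainder p2 M0 (L2f_ n) (mchi k) (chi01 k) (mA n) (fA n) (fP n).
rewrite -(ipL2E L2d2) => h; rewrite -lee_fin; apply: le_trans h _.
apply: (@le_trans _ _ ((M ^+ 2)%:E * (\int[mu]_(x in W) ((1 - chi k x) ^+ 2) +
    ipL2 mu \1_(A_ n) \1_(Omega `&` L))%:E + (M `^ (2 - p))%:E * P%:E)%E).
  by rewrite leeD2r// lee_wpmul2l// lee_fin ltW.
rewrite -!EFinM -EFinD lee_fin Me; apply: lerD.
  rewrite mulrDr; apply: lerD; rewrite mulrC -ler_pdivlMr// ltW//.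
by rewrite -mulrA ler_piMr ?(ltW e10)// mulrC ler_pdivrMr// mul1r lerDl.
Qed.

End limits.

(** * Hausdorff convergence *)

Section hausdorff.
Context {R : realType} {N : nat}.
Local Notation T := 'rV[R]_N.
Implicit Types (A B S L : set T).

Lemma norm_le_enorm (x : T) : `|x| <= enorm x.
Proof.
rewrite /Num.Def.normr/= mx_normrE; apply: bigmax_le => [|[i j] _ /=].
  exact: sqrtr_ge0.
rewrite (ord1 i) -sqrtr_sqr ler_wsqrtr// /dot (bigD1 j)//= -expr2 lerDl.
by apply: sumr_ge0 => k _; rewrite -expr2 sqr_ge0.
Qed.

Lemma edist_set_lt (x : T) A (e : R) : (edist_set x A < e%:E)%E ->
  exists2 y, A y & `|x - y| < e.
Proof.
move=> /ereal_inf_lt[_ [y Ay <-]]; rewrite lte_fin => xy; exists y => //.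
exact: le_lt_trans (norm_le_enorm _) xy.
Qed.

(** Closeness is expressed in the sup norm, which is dominated by the Euclidean norm of the
    definition. *)
Lemma hausdorff_cvg_near (A_ : nat -> set T) A (e : R) : hausdorff_cvg A_ A -> 0 < e ->
  \forall n \near \oo, (forall x, A_ n x -> exists2 y, A y & `|x - y| < e) /\
    (forall y, A y -> exists2 x, A_ n x & `|y - x| < e).
Proof.
move=> AA e0; have : \forall n \near \oo, (hausdorff_dist (A_ n) A < e%:E)%E.
  have /(_ [set x | (x < e%:E)%E]) := AA; apply.
  by apply: open_ereal_lt'; rewrite lte_fin.
apply: filterS => n /=; rewrite /hausdorff_dist !gt_max => /and3P[_ h1 h2].
split=> x Ax; apply: edist_set_lt.
  by apply: le_lt_trans h1; apply: ereal_sup_ubound; exists x.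
by apply: le_lt_trans h2; apply: ereal_sup_ubound; exists x.
Qed.

(** The factor 2 leaves a margin: a point within r of [x] is still at distance at least r from
    [L]. *)
Lemma closed_far_ball L (x : T) : closed L -> ~ L x ->
  exists2 r, 0 < r & forall y, L y -> 2 * r <= `|x - y|.
Proof.
move=> cL nLx; have : nbhs x (~` L) by apply: open_nbhs_nbhs; split; [exact: closed_openC|].
move=> /nbhs_ballP[e /= e0 eL]; exists (e / 2); first by rewrite divr_gt0.
move=> y Ly; rewrite mulrC divfK// leNgt; apply/negP => xy.
by apply: (eL y) => //; rewrite -ball_normE.
Qed.

(** [S] is covered by finitely many balls with radius at most half the distance of the centre to
    [L]; once [L_ n] is closer to [L] than each of these radii, it misses all the balls. *)
Lemma hausdorff_cvg_disjoint (L_ : nat -> set T) L S : hausdorff_cvg L_ L ->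
  closed L -> compact S -> S `&` L = set0 -> \forall n \near \oo, S `&` L_ n = set0.
Proof.
move=> LL cL cS SL.
have /choice[r rP] (x : T) : exists r, S x -> 0 < r /\ forall y, L y -> 2 * r <= `|x - y|.
  have [Sx|?] := pselect (S x); last by exists 0.
  have nLx : ~ L x by move=> Lx; have : (S `&` L) x by []; rewrite SL.
  by have [r r0 rL] := closed_far_ball cL nLx; exists r.
have [x Sx|x Sx|s [sS scov]] := compact_cover_seq (f := fun x => ball x (r x)) cS.
- exact: ball_open.
- by apply: ballxx; have [] := rP _ Sx.
have : \forall n \near \oo, forall x, x \in s -> forall z, ball x (r x) z -> ~ L_ n z.
  elim: s {scov} sS => [_|x s IH sS]; first exact: nearW.
  have /IH IH' : forall x', x' \in s -> S x' by move=> x' x's; apply: sS; rewrite inE x's orbT.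
  have [r0 rL] := rP _ (sS _ (mem_head x s)).
  have := hausdorff_cvg_near LL r0; apply: filterS2 IH' => n h [h1 _] x'.
  rewrite inE => /predU1P[->|/h//] z; rewrite -ball_normE /ball_ /= => xz /h1[y Ly zy].
  have := rL _ Ly; have := ler_distD z x y; lra.
apply: filterS => n h; apply/seteqP; split => // x [Sx Lx].
by have [y ys yx] := scov _ Sx; exact: (h y ys x yx Lx).
Qed.

Lemma boundary_closed A : closed (boundary A).
Proof.
apply: closedI; first exact: closed_closure.
by apply: open_closedC; exact: open_interior.
Qed.

Lemma boundary_sub A : closed A -> boundary A `<=` A.
Proof. by move=> cA x [clx _]; rewrite ((closure_id A).1 cA). Qed.

Lemma setD_boundary A : closed A -> A `\` boundary A = A°.
Proof.
move=> cA; apply/seteqP; split => [x [Ax nb]|x iAx].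
  by apply: contrapT => niA; apply: nb; split => //; exact: subset_closure.
by split; [exact: interior_subset|move=> [_]].
Qed.

(* [A] is relatively clopen on the segment from [z] to [y]. *)
Lemma ball_sub_of_boundary A (x : T) (r : R) (z : T) : closed A ->
  (forall y, ball x r y -> ~ boundary A y) -> ball x r z -> A z -> ball x r `<=` A.
Proof.
move=> cA bA xz Az y xy.
pose path (t : R) : T := z + t *: (y - z).
have cpath : continuous path.
  move=> t; apply: cvgD; first exact: cvg_cst.
  by apply: cvgZr_tmp; exact: cvg_id.
have pball t : `[0, 1]%classic t -> ball x r (path t).
  rewrite /= in_itv/= => /andP[t0 t1]; rewrite -ball_normE /ball_ /= /path.
  move: xz xy; rewrite -!ball_normE /ball_ /= => xz xy.
  have -> : x - (z + t *: (y - z)) = (1 - t) *: (x - z) + t *: (x - y).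
    by apply/rowP => i; rewrite !mxE; ring.
  apply: le_lt_trans (ler_normD _ _) _; rewrite !normrZ (ger0_norm t0) ger0_norm ?subr_ge0//.
  have [t00|tn0] := eqVneq t 0; first by rewrite t00 mul0r addr0 subr0 mul1r.
  have tp : 0 < t by rewrite lt_neqAle eq_sym tn0.
  have : (1 - t) * `|x - z| <= (1 - t) * r by rewrite ler_wpM2l ?subr_ge0// ltW.
  have : t * `|x - y| < t * r by rewrite ltr_pM2l.
  lra.
have : `[0, 1]%classic `&` path @^-1` A = `[0, 1]%classic.
  apply: (@segment_connected R 0 1).
  - exists 0; split; first by rewrite /= in_itv/= lexx ler01.
    by rewrite /= /path scale0r addr0.
  - exists (path @^-1` A°); first by move/continuousP : cpath; apply; exact: open_interior.
    apply/seteqP; split => [t [t01 At]|t [t01 At]]; split => //.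
      have : (A `\` boundary A) (path t) by split=> //; exact/bA/pball.
      by rewrite setD_boundary.
    exact: (interior_subset At).
  - exists (path @^-1` A) => //.
    by apply: closed_comp => // t _; exact: cpath.
move/seteqP => [_ /(_ 1)]; rewrite /= in_itv/= ler01 lexx => /(_ isT)[_].
by rewrite /path scale1r addrC subrK.
Qed.

(** * Consequences of the convergence of the boundaries *)

Section boundary_limit.
Variables (K_ : nat -> set T) (K Kt : set T).
Hypotheses (cK_ : forall n, closed (K_ n)) (cK : closed K) (cKt : closed Kt).
Hypotheses (hK : hausdorff_cvg K_ K) (hb : hausdorff_cvg (fun n => boundary (K_ n)) Kt).

Lemma limit_in_K y : (forall e : R, 0 < e -> \forall n \near \oo, exists2 x, K_ n x & `|y - x| < e) ->
  K y.
Proof.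
move=> h; apply: cK => V /nbhs_ballP[e /= e0 eV].
have e20 : 0 < e / 2 by rewrite divr_gt0.
have [n [[x Kx yx] [h1 _]]] := filter_ex (filterI (h _ e20) (hausdorff_cvg_near hK e20)).
have [z Kz xz] := h1 _ Kx; exists z; split=> //; apply: eV.
rewrite -ball_normE /ball_ /=; have := ler_distD x y z; lra.
Qed.

Lemma boundary_limit_sub : Kt `<=` K.
Proof.
move=> y Kty; apply: limit_in_K => e e0.
have := hausdorff_cvg_near hb e0; apply: filterS => n [_ /(_ _ Kty)[x bx yx]].
by exists x => //; exact: boundary_sub bx.
Qed.

(** A small ball around [x] eventually misses the boundary of [K_ n], which stays near [Kt], and
    meets [K_ n], which comes near [x]; it cannot leave [K_ n] without crossing the boundary. *)
Lemma eventually_ball_sub x : (K `\` Kt) x ->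
  exists2 r, 0 < r & (\forall n \near \oo, ball x r `<=` K_ n) /\
    forall y, ball x r y -> ~ Kt y.
Proof.
move=> [Kx nKt]; have [r r0 rP] := closed_far_ball cKt nKt.
exists r => //; split; last first.
  move=> y; rewrite -ball_normE /ball_ /= => xy /rP; lra.
have := hausdorff_cvg_near hb r0; have := hausdorff_cvg_near hK r0.
apply: filterS2 => n [_ h1] [h2 _]; have [z Kz xz] := h1 _ Kx.
apply: (@ball_sub_of_boundary _ _ _ z) => //; last by rewrite -ball_normE.
move=> y; rewrite -ball_normE /ball_ /= => xy /h2[w /rP xw yw].
have := ler_distD y x w; lra.
Qed.

Lemma eventually_in_boundary_limit x : (K `\` Kt) x -> \forall n \near \oo, K_ n x.
Proof.
move=> /eventually_ball_sub[r r0 [h _]]; apply: filterS h => n; apply.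
exact: ballxx.
Qed.

(** A whole ball lies in [K_ n] for all large n, so its points are limits of points of [K_ n] and
    belong to [K]. *)
Lemma open_setD_boundary_limit : open (K `\` Kt).
Proof.
rewrite openE => x /eventually_ball_sub[r r0 [h nKt]].
apply/nbhs_ballP; exists r => // y xy; split; last exact: nKt.
apply: limit_in_K => e e0; apply: filterS h => n /(_ _ xy) Ky.
by exists y => //; rewrite subrr normr0.
Qed.

End boundary_limit.

End hausdorff.

(** Write [y_ n] as [y] plus an error tending strongly to 0; boundedness of the [x_ n] makes the
    pairing with the error vanish. *)
Lemma weak_strong_pairing (R : realType) (E : lmodType R) (X : set E) (ip : E -> E -> R)
    (x_ y_ : nat -> E) x y (C : R) : hilbert_on X ip ->
  (forall n, X (x_ n)) -> (forall n, X (y_ n)) -> X x -> X y ->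
  (forall n, ip (x_ n) (x_ n) <= C) ->
  (forall z, X z -> ip (x_ n) z @[n --> \oo] --> ip x z) ->
  ip (y_ n - y) (y_ n - y) @[n --> \oo] --> (0 : R) ->
  ip (x_ n) (y_ n) @[n --> \oo] --> ip x y.
Proof.
move=> H Xx_ Xy_ Xx Xy xC xw ys.
have Xd n : X (y_ n - y) by exact: (hilbertB H).
have h : ip (x_ n) (y_ n - y) @[n --> \oo] --> (0 : R).
  apply: (@squeeze_sqr _ _ (fun n => C * ip (y_ n - y) (y_ n - y))) => [n|].
    apply: le_trans (ip_CauchySchwarz H (Xx_ n) (Xd n)) _.
    by rewrite ler_wpM2r// (hilbert_ge0 H).
  by rewrite -[X in _ --> X](mulr0 C); exact: cvgMl_tmp.
have e n : ip (x_ n) (y_ n) = ip (x_ n) (y_ n - y) + ip (x_ n) y.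
  by rewrite (ipBr H)// subrK.
rewrite -[X in _ --> X]add0r; under eq_fun do rewrite e.
by apply: cvgD => //; exact: xw.
Qed.

(** * Passing to the limit in the weak equation *)

Section weak_equation.
Context {R : realType} {N : nat}.
Local Notation T := 'rV[R]_N.
Local Notation mu := (lebesgue_rV R N).
Implicit Types (U W Omega K L : set T) (u v phi : T -> R) (Du Dv Dphi : T -> T).

Lemma ae_eq_ipL2r (f g g' : T -> R) : L2fun mu f -> L2fun mu g -> L2fun mu g' ->
  {ae mu, forall x, g x = g' x} -> ipL2 mu f g = ipL2 mu f g'.
Proof.
move=> L2f L2g L2g' gg'; have H := hilbert_L2 mu.
by rewrite (hilbertC H L2f L2g) (ae_eq_ipL2 L2g L2g' L2f gg') (hilbertC H L2g' L2f).
Qed.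

Lemma Rintegral_sum_fin (f : 'I_N -> T -> R) :
  (forall i, mu.-integrable setT (EFin \o f i)) ->
  \int[mu]_x (\sum_i f i x) = \sum_i \int[mu]_x f i x.
Proof.
move=> fi; suff : forall r : seq 'I_N,
    mu.-integrable setT (EFin \o (fun x => \sum_(i <- r) f i x)) /\
    \int[mu]_x (\sum_(i <- r) f i x) = \sum_(i <- r) \int[mu]_x f i x.
  by move=> /(_ (index_enum _))[].
elim=> [|i r [IH1 IH2]].
  split; last by rewrite big_nil /Rintegral; under eq_integral do rewrite big_nil; rewrite integral0.
  apply: (@eq_integrable _ _ _ mu setT measurableT (cst 0%E)) => //.
    by move=> x _ /=; rewrite big_nil.
  exact: integrable0.
split.
  have := integrableD measurableT (fi i) IH1.
  by apply: eq_integrable => // x _ /=; rewrite big_cons EFinD.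
by rewrite big_cons -IH2 -RintegralD//; apply: eq_Rintegral => x _; rewrite big_cons.
Qed.

Lemma bilinear_formE (D : set T) (k : R) u Du phi Dphi : measurable D ->
  L2 D (graph u Du) -> L2 D (graph phi Dphi) ->
  \int[mu]_(x in D) (dot (Du x) (Dphi x) - k ^+ 2 * u x * phi x) =
  \sum_i ipL2 mu (ext0 D (fun x => Du x ord0 i)) (ext0 D (fun x => Dphi x ord0 i))
  - k ^+ 2 * ipL2 mu (ext0 D u) (ext0 D phi).
Proof.
move=> mD /L2_graphP[L2u L2Du] /L2_graphP[L2p L2Dp].
pose a i x := ext0 D (fun x => Du x ord0 i) x * ext0 D (fun x => Dphi x ord0 i) x.
pose b x := ext0 D u x * ext0 D phi x.
have ia i : mu.-integrable setT (EFin \o a i) by exact: L2funM_integrable.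
have ib : mu.-integrable setT (EFin \o b) by exact: L2funM_integrable.
have isum : mu.-integrable setT (EFin \o (fun x => \sum_i a i x)).
  have := @integrable_sum _ _ _ mu setT measurableT 'I_N (index_enum _) xpredT
    (fun i x => (a i x)%:E) (fun i _ => ia i).
  by apply: eq_integrable => // x _ /=; rewrite sumEFin.
have ikb : mu.-integrable setT (EFin \o (fun x => k ^+ 2 * b x)).
  have := integrableZl measurableT (k ^+ 2) ib.
  by apply: eq_integrable => // x _ /=; rewrite EFinM.
rewrite Rintegral_mkcond.
transitivity (\int[mu]_x (\sum_i a i x - k ^+ 2 * b x)).
  apply: eq_Rintegral => x _; rewrite patchE /a /b; have [Dx|Dx] := pselect (D x).
    rewrite mem_set// !ext0_in// mulrA; congr (_ - _).
    by apply: eq_bigr => i _; rewrite !ext0_in.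
  rewrite memNset// !ext0_out// mul0r mulr0 subr0 big1// => i _.
  by rewrite ext0_out// mul0r.
rewrite RintegralB// Rintegral_sum_fin// RintegralZl//.
Qed.

Lemma ipV_graphE (Omega : set T) (F G : T -> 'rV[R]_N.+1) : ipV Omega F G =
  ipL2 mu (component Omega F ord0) (component Omega G ord0) +
  \sum_i ipL2 mu (component Omega F (lift ord0 i)) (component Omega G (lift ord0 i)).
Proof. exact: big_ord_recl. Qed.

Lemma ext0_sub (U W : set T) (f : T -> R) : U `<=` W -> ext0 W (ext0 U f) = ext0 U f.
Proof.
move=> UW; apply/funext => x; have [Wx|Wx] := pselect (W x); first by rewrite ext0_in.
by rewrite !ext0_out// => /UW.
Qed.

Lemma ext0_coord (U : set T) Du i :
  (fun x => ext0 U Du x ord0 i) = ext0 U (fun x => Du x ord0 i).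
Proof.
apply/funext => x; have [Ux|Ux] := pselect (U x); first by rewrite !ext0_in.
by rewrite !ext0_out// mxE.
Qed.

Lemma component_graph0 (Omega U : set T) u Du : U `<=` Omega ->
  component Omega (graph (ext0 U u) (ext0 U Du)) ord0 = ext0 U u.
Proof.
move=> UO; rewrite /component -[RHS](ext0_sub u UO); congr ext0.
by apply/funext => x; rewrite graph0.
Qed.

Lemma component_graphS (Omega U : set T) u Du i : U `<=` Omega ->
  component Omega (graph (ext0 U u) (ext0 U Du)) (lift ord0 i) =
  ext0 U (fun x => Du x ord0 i).
Proof.
move=> UO; rewrite /component -[RHS](ext0_sub _ UO); congr ext0.
by rewrite -ext0_coord; apply/funext => x; rewrite graphS.
Qed.

Lemma L2_graph_ext0 (Omega U : set T) u Du : U `<=` Omega ->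
  L2 U (graph u Du) -> L2 Omega (graph (ext0 U u) (ext0 U Du)).
Proof.
move=> UO /L2_graphP[L2u L2Du] i; rewrite -/(component Omega (graph (ext0 U u) (ext0 U Du)) i).
have [j ->|->] := unliftP ord0 i; first by rewrite component_graphS//; exact: L2Du.
by rewrite component_graph0.
Qed.

(** [Omega \ L] is the disjoint union of the open sets [Omega \ K] and [Omega] intersected with
    [K \ L], and extension by 0 from one open piece to the other creates no jump. When [L = K] the
    second piece is empty. *)
Lemma H1_zero_extension Omega K L u Du : open Omega -> closed K -> closed L ->
  L `<=` K -> open (K `\` L) -> H1 (Omega `\` K) u Du ->
  let U := Omega `\` K in
  H1 (Omega `\` L) (ext0 U u) (ext0 U Du) /\
  H1_subspace Omega L (graph (ext0 U u) (ext0 U Du)).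
Proof.
move=> oO cK cL LK oKL H1u U.
have oU : open U by apply: openI => //; exact: closed_openC.
have oV : open (Omega `&` (K `\` L)) by exact: openI.
have UV0 : U `&` (Omega `&` (K `\` L)) = set0.
  by apply/seteqP; split => x // [[_ nK] [_ [Kx _]]].
have UVW : U `|` (Omega `&` (K `\` L)) = Omega `\` L.
  apply/seteqP; split => [x [[Ox nK]|[Ox [_ nL]]]|x [Ox nL]].
  - by split => // /LK.
  - by split.
  - by have [Kx|Kx] := pselect (K x); [right|left].
have H1e : H1 (Omega `\` L) (ext0 U u) (ext0 U Du).
  by rewrite -UVW; exact: H1_ext0.
split=> //; split.
  by apply: L2_graph_ext0; [exact: subDsetl|case: H1u].
exists (ext0 U u), (ext0 U Du); split => //; apply: aeW => x Ox.
have [Lx|Lx] := pselect (L x); last by rewrite [RHS]ext0_in.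
have nUx : ~ U x by move=> [_]; apply; exact: LK.
rewrite [RHS]ext0_out; last by move=> [_].
by rewrite -ext0_graph ext0_out.
Qed.

(* The pairing of [graph u Du] with
   [cutoff_operator k chi (graph f Df)] is the bilinear form of the equation at
   [u] and [chi * f]. *)
Definition cutoff_operator (k : R) (chi : T -> R) (F : T -> 'rV[R]_N.+1) : T -> 'rV[R]_N.+1 :=
  graph (fun x => - k ^+ 2 * (chi x * F x ord0 ord0))
    (mul_gradient chi (fun x => F x ord0 ord0) (fun x => \row_i F x ord0 (lift ord0 i))).

Lemma component_cutoff0 Omega k chi F :
  component Omega (cutoff_operator k chi F) ord0 =
  (- k ^+ 2) *: (fun x => chi x * component Omega F ord0 x).
Proof.
apply/funext => x; rewrite !fctE; have [Ox|Ox] := pselect (Omega x).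
  by rewrite !component_in// /cutoff_operator graph0.
by rewrite !component_out// mulr0 scaler0.
Qed.

Lemma component_cutoffS Omega k chi F i :
  component Omega (cutoff_operator k chi F) (lift ord0 i) =
  (fun x => chi x * component Omega F (lift ord0 i) x)
  + (fun x => partial i chi x * component Omega F ord0 x).
Proof.
apply/funext => x; rewrite !fctE; have [Ox|Ox] := pselect (Omega x).
  by rewrite !component_in// /cutoff_operator graphS !mxE.
by rewrite !component_out// !mulr0 addr0.
Qed.

Lemma L2_cutoff Omega k chi F : test_function setT chi -> L2 Omega F ->
  L2 Omega (cutoff_operator k chi F).
Proof.
move=> tchi L2F i; rewrite -/(component Omega (cutoff_operator k chi F) i).
have H := hilbert_L2 mu.
have [j ->|->] := unliftP ord0 i.
  rewrite component_cutoffS; apply: (hilbertD H).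
    by apply: (L2fun_test_mul tchi); exact: L2_component.
  by apply: (L2fun_test_mul (test_function_partial j tchi)); exact: L2_component.
rewrite component_cutoff0; apply: (hilbertZ H).
by apply: (L2fun_test_mul tchi); exact: L2_component.
Qed.

Lemma cutoff_operatorB k chi F G :
  cutoff_operator k chi F - cutoff_operator k chi G = cutoff_operator k chi (F - G).
Proof.
apply/funext => x; apply/rowP => i.
have e (A B : 'rV[R]_N.+1) j : (A - B) ord0 j = A ord0 j - B ord0 j by rewrite !mxE.
have -> : (cutoff_operator k chi F - cutoff_operator k chi G) x =
  cutoff_operator k chi F x - cutoff_operator k chi G x by [].
rewrite e; have [j ->|->] := unliftP ord0 i; rewrite /cutoff_operator.
  by rewrite !graphS !mxE; ring.
by rewrite !graph0 -[(F - G) x]/(F x - G x) e; ring.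
Qed.

(** [cutoff_operator] is linear and multiplies components by bounded functions, so it is bounded on
    L^2. *)
Lemma cutoff_operator_strong_cvg Omega k chi (F_ : nat -> T -> 'rV[R]_N.+1) F :
  measurable Omega -> test_function setT chi ->
  (forall n, L2 Omega (F_ n)) -> L2 Omega F ->
  ipV Omega (F_ n - F) (F_ n - F) @[n --> \oo] --> (0 : R) ->
  let Y := cutoff_operator k chi in
  ipV Omega (Y (F_ n) - Y F) (Y (F_ n) - Y F) @[n --> \oo] --> (0 : R).
Proof.
move=> mO tchi L2F_ L2F F0 Y; have H := hilbert_L2 mu; have HV := @hilbert_L2vec R N N.+1 _ mO.
have comp_cvg j : ipL2 mu (component Omega (F_ n - F) j) (component Omega (F_ n - F) j)
    @[n --> \oo] --> (0 : R).
  apply: (squeeze_cvgr _ (cvg_cst 0) F0); apply: nearW => n.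
  by rewrite ipL2_ge0 /ipV (bigD1 j)//= lerDl sumr_ge0// => i _; exact: ipL2_ge0.
have L2c n j : L2fun mu (component Omega (F_ n - F) j).
  by apply: L2_component; exact: (hilbertB HV).
have mul_cvg (h : T -> R) j : test_function setT h ->
    ipL2 mu (fun x => h x * component Omega (F_ n - F) j x)
            (fun x => h x * component Omega (F_ n - F) j x) @[n --> \oo] --> (0 : R).
  move=> th; have [M M0 hM] := test_function_bounded th.
  have c : M ^+ 2 * ipL2 mu (component Omega (F_ n - F) j) (component Omega (F_ n - F) j)
      @[n --> \oo] --> (0 : R).
    by rewrite -[X in _ --> X](mulr0 (M ^+ 2)); exact: cvgMl_tmp.
  apply: (squeeze_cvgr _ (cvg_cst 0) c); apply: nearW => n; rewrite ipL2_ge0/=.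
  exact: ipL2_mul_le (test_function_measurable th) hM (L2c n j).
rewrite /Y; under eq_fun do rewrite cutoff_operatorB.
suff : ipV Omega (cutoff_operator k chi (F_ n - F)) (cutoff_operator k chi (F_ n - F))
    @[n --> \oo] --> \sum_(i < N.+1) (0 : R) by rewrite big1.
apply: (@cvgr_sum _ _ _ (fun n i => ipL2 mu (component Omega (cutoff_operator k chi (F_ n - F)) i)
  (component Omega (cutoff_operator k chi (F_ n - F)) i)) (fun=> 0)) => i.
have [j ->|->] := unliftP ord0 i.
  under eq_fun do rewrite component_cutoffS.
  have tp := test_function_partial j tchi.
  have c : 2 * ipL2 mu (fun x => chi x * component Omega (F_ n - F) (lift ord0 j) x)
            (fun x => chi x * component Omega (F_ n - F) (lift ord0 j) x) +
      2 * ipL2 mu (fun x => partial j chi x * component Omega (F_ n - F) ord0 x)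
            (fun x => partial j chi x * component Omega (F_ n - F) ord0 x)
      @[n --> \oo] --> 2 * 0 + 2 * (0 : R).
    by apply: cvgD; apply: cvgMl_tmp; exact: mul_cvg.
  rewrite mulr0 addr0 in c.
  apply: (squeeze_cvgr _ (cvg_cst 0) c); apply: nearW => n; rewrite ipL2_ge0/=.
  apply: ipL2_add_le; first exact: L2fun_test_mul tchi (L2c _ _).
  exact: L2fun_test_mul tp (L2c _ _).
under eq_fun do rewrite component_cutoff0.
have c : (- k ^+ 2) ^+ 2 * ipL2 mu (fun x => chi x * component Omega (F_ n - F) ord0 x)
            (fun x => chi x * component Omega (F_ n - F) ord0 x)
      @[n --> \oo] --> (- k ^+ 2) ^+ 2 * (0 : R).
  by apply: cvgMl_tmp; exact: mul_cvg.
rewrite mulr0 in c.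
apply: cvg_trans c; apply: near_eq_cvg; apply: nearW => n.
have L2m := L2fun_test_mul tchi (L2c n ord0).
by rewrite (ipZl H) ?(ipZr H)//; [ring|exact: (hilbertZ H)].
Qed.

End weak_equation.

Section weak_equation_limit.
Context {R : realType} {N : nat}.
Local Notation T := 'rV[R]_N.
Local Notation mu := (lebesgue_rV R N).
Implicit Types (U W Omega K L : set T) (u v phi : T -> R) (Du Dv Dphi : T -> T).

(** Only products are compared, because the factors may disagree where their partner is 0: so it is
    for the test pair on [K_ n], where the extended solution vanishes. *)
Lemma eq_ipV m Omega (A A' B B' : T -> 'rV[R]_m) :
  L2 Omega A -> L2 Omega A' -> L2 Omega B -> L2 Omega B' ->
  {ae mu, forall x, Omega x -> forall i,
     A x ord0 i * B x ord0 i = A' x ord0 i * B' x ord0 i} ->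
  ipV Omega A B = ipV Omega A' B'.
Proof.
move=> L2A L2A' L2B L2B' e; apply: eq_bigr => i _.
rewrite /ipL2 /Rintegral; congr fine; apply: ae_eq_integral => //.
- by apply: measurable_int (L2funM_integrable _ _); exact: L2_component.
- by apply: measurable_int (L2funM_integrable _ _); exact: L2_component.
apply: filterS e => x e _; congr EFin.
have [Ox|Ox] := pselect (Omega x); last by rewrite !component_out// !mul0r.
by rewrite !component_in//; exact: e.
Qed.

Lemma bilinear_form_ipV Omega U (k : R) u Du phi Dphi : measurable U -> U `<=` Omega ->
  L2 U (graph u Du) -> L2 U (graph phi Dphi) ->
  let B := graph (- k ^+ 2 *: ext0 U phi) (ext0 U Dphi) in
  L2 Omega B /\ ipV Omega (graph (ext0 U u) (ext0 U Du)) B =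
  \int[mu]_(x in U) (dot (Du x) (Dphi x) - k ^+ 2 * u x * phi x).
Proof.
move=> mU UO L2u L2p B; have H := hilbert_L2 mu.
have /L2_graphP[L2u0 _] := L2u; have /L2_graphP[L2p0 L2Dp] := L2p.
have e : B = graph (ext0 U (- k ^+ 2 *: phi)) (ext0 U Dphi).
  rewrite /B; congr graph; apply/funext => x; rewrite !fctE.
  by have [Ux|Ux] := pselect (U x); [rewrite !ext0_in|rewrite !ext0_out// scaler0].
have eZ : ext0 U (- k ^+ 2 *: phi) = - k ^+ 2 *: ext0 U phi.
  apply/funext => x; rewrite !fctE.
  by have [Ux|Ux] := pselect (U x); [rewrite !ext0_in|rewrite !ext0_out// scaler0].
split.
  rewrite e; apply: L2_graph_ext0 => //; apply/L2_graphP; split=> //.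
  by rewrite eZ; exact: (hilbertZ H).
rewrite bilinear_formE// ipV_graphE e !component_graph0// addrC; congr (_ + _).
  by apply: eq_bigr => i _; rewrite !component_graphS.
by rewrite eZ (ipZr H)// mulNr.
Qed.

Lemma ess_support_mul (D : set T) chi phi :
  ess_support D (fun x => chi x * phi x) `<=` closure [set x | chi x != 0].
Proof.
move=> x ex; apply: contrapT => nx.
apply: (ex (~` closure [set x | chi x != 0])) => //.
  by apply: closed_openC; exact: closed_closure.
apply: aeW => y ny _; have -> : chi y = 0; last by rewrite mul0r.
by apply: contra_notP ny => /eqP cy; exact: subset_closure.
Qed.

Lemma compactly_contained_sub (A S Omega : set T) : A `<=` S -> closed S -> compact S ->
  S `<=` Omega -> compactly_contained A Omega.
Proof.
move=> AS cS kS SO; have cAS : closure A `<=` S.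
  by rewrite [X in _ `<=` X]((closure_id _).1 cS); exact: closureS.
split; last exact: subset_trans cAS SO.
by apply: subclosed_compact kS cAS; exact: closed_closure.
Qed.

(** [phi] vanishes almost everywhere off its support, and [chi] is 1 on the closure of that support,
    so chi phi = phi; equality of the gradients then follows from their uniqueness. *)
Lemma H1_cutoff_eq Omega U chi phi Dphi : open U -> (mu U < +oo)%E ->
  test_function setT chi -> H1 U phi Dphi ->
  (forall x, closure (ess_support U phi) x -> chi x = 1) ->
  {ae mu, forall x, U x -> chi x * phi x = phi x /\ mul_gradient chi phi Dphi x = Dphi x}.
Proof.
move=> oU Uoo tchi H1p chi1.
have [/L2_graphP[L2p L2Dp] wgp] := H1p.
have [/L2_graphP[L2c L2Dc] wgc] := H1_mul oU tchi H1p.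
have e0 : {ae mu, forall x, U x -> chi x * phi x = phi x}.
  have := ess_support_ae0 oU (@closed_closure _ (ess_support U phi)) Uoo L2p
    (@subset_closure _ _).
  apply: filterS => x h Ux; have [cx|ncx] := pselect (closure (ess_support U phi) x).
    by rewrite chi1// mul1r.
  by rewrite h// mulr0.
have eS := weak_gradient_unique oU Uoo L2Dc L2Dp L2c L2p wgc wgp e0.
have : {ae mu, forall x i, U x -> mul_gradient chi phi Dphi x ord0 i = Dphi x ord0 i}.
  by apply: filter_forall => i; exact: eS.
apply: filterS2 e0 => x h0 hS Ux; split; first exact: h0.
by apply/rowP => i; exact: hS.
Qed.

Lemma cutoff_operator0 k chi (F : T -> 'rV[R]_N.+1) x :
  cutoff_operator k chi F x ord0 ord0 = - k ^+ 2 * (chi x * F x ord0 ord0).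
Proof. by rewrite /cutoff_operator graph0. Qed.

Lemma cutoff_operatorS k chi (F : T -> 'rV[R]_N.+1) x i :
  cutoff_operator k chi F x ord0 (lift ord0 i) =
  chi x * F x ord0 (lift ord0 i) + partial i chi x * F x ord0 ord0.
Proof. by rewrite /cutoff_operator graphS !mxE. Qed.

(** Weak convergence of the pairs (u_n, grad u_n) suffices: the other factor, a cutoff of the Mosco
    approximants of phi, converges strongly together with its gradient. *)
Lemma weak_equation_limit Omega K L (K_ L_ : nat -> set T) k
    (u_ : nat -> T -> R) (Du_ : nat -> T -> T) (C : R) (s : nat -> nat) F v Dv :
  open Omega -> bounded_set Omega ->
  (forall n, closed (K_ n)) -> closed K -> (forall n, closed (L_ n)) -> closed L ->
  (forall n, L_ n `<=` K_ n) -> L `<=` K ->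
  open (K `\` L) -> mosco_H1 Omega L_ L ->
  (forall n, weak_solution Omega (K_ n) k (u_ n) (Du_ n)) ->
  let V n := graph (ext0 (Omega `\` K_ n) (u_ n)) (ext0 (Omega `\` K_ n) (Du_ n)) in
  {homo s : i j / (i < j)%N} ->
  (forall n, ipV Omega (V n) (V n) <= C) -> L2 Omega F ->
  (forall G, L2 Omega G -> ipV Omega (V (s j)) G @[j --> \oo] --> ipV Omega F G) ->
  H1 (Omega `\` L) v Dv ->
  {ae mu, forall x, Omega x -> F x = ext0 (Omega `\` L) (graph v Dv) x} ->
  weak_solution Omega K k v Dv.
Proof.
move=> oO bO cK_ cK cL_ cL LK_ LK oKL mos hu V hs VC L2F Vw H1v Fv.
pose U_ n := Omega `\` K_ n; pose U := Omega `\` K; pose W := Omega `\` L.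
have oU_ n : open (U_ n) by apply: openI => //; exact: closed_openC.
have oU : open U by apply: openI => //; exact: closed_openC.
have mO := measurable_mx_open oO; have mU := measurable_mx_open oU.
have Uoo : (mu U < +oo)%E.
  apply: le_lt_trans (bounded_lebesgue_lty bO mO); apply: le_measure; rewrite ?inE//.
  exact: subDsetl.
have UW : U `<=` W by move=> x [Ox nK]; split => // /LK.
have UO : U `<=` Omega by exact: subDsetl.
have H1vU : H1 U v Dv := H1_restrict oU UW H1v.
split=> // phi Dphi H1p [cpt sub].
have [chi [tchiO _ chi1]] := smooth_cutoff cpt oO sub.
have tchi : test_function setT chi by exact: test_functionS tchiO.
pose Y := @cutoff_operator R N k chi.
pose Phi := graph (ext0 U phi) (ext0 U Dphi).
have [H1Phi sPhi] := H1_zero_extension oO cK cL LK oKL H1p.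
have [Phi_ sPhi_ Phicvg] := mos.2 _ sPhi.
have L2Phi_ n : L2 Omega (Phi_ n) by case: (sPhi_ n).
have L2Phi : L2 Omega Phi by case: sPhi.
have L2V n : L2 Omega (V n).
  by apply: L2_graph_ext0; [exact: subDsetl|case: (hu n) => -[]].
(* [Phi_ n] comes from some [f] in H^1(Omega \ L_n). Restricted to Omega \ K_n and multiplied by
   [chi], it is an admissible test function; elsewhere in Omega the factor [V n] is 0. *)
have V0 n : ipV Omega (V n) (Y (Phi_ n)) = 0.
  have [_ [f [Df [H1f Phif]]]] := sPhi_ n.
  have UW_ : U_ n `<=` Omega `\` L_ n by move=> x [Ox nK]; split => // /LK_.
  have H1fU := H1_restrict (oU_ n) UW_ H1f.
  have H1c := H1_mul (oU_ n) tchi H1fU.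
  have [H1u /(_ _ _ H1c)] := hu n.
  have UO_ : U_ n `<=` Omega by exact: subDsetl.
  have [L2B <-] := bilinear_form_ipV k (measurable_mx_open (oU_ n)) UO_ H1u.1 H1c.1.
  move=> <-; last first.
    case: tchiO => _ cchi chiO; apply: compactly_contained_sub cchi chiO.
      exact: ess_support_mul.
    exact: closed_closure.
  apply: eq_ipV; [exact: L2V|exact: L2V|exact: (L2_cutoff k tchi (L2Phi_ n))|exact: L2B|].
  apply: filterS Phif => x /[swap] Ox /(_ Ox) Px i; rewrite -/(U_ n).
  have [Ux|Ux] := pselect (U_ n x); last first.
    by rewrite /V -ext0_graph ext0_out// mxE !mul0r.
  congr (_ * _); rewrite ext0_in in Px; last exact: UW_.
  have [j ->|->] := unliftP ord0 i.
    by rewrite cutoff_operatorS !graphS ext0_in// mxE Px graphS graph0.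
  by rewrite cutoff_operator0 !graph0 !fctE ext0_in// Px graph0.
have F0 : ipV Omega F (Y Phi) = 0.
  have H := @hilbert_L2vec R N N.+1 Omega mO.
  have c1 := strong_cvg_ipV mO L2Phi_ L2Phi Phicvg.
  have c2 : ipV Omega (Phi_ (s j) - Phi) (Phi_ (s j) - Phi) @[j --> \oo] --> (0 : R).
    by apply: (cvg_comp s (fun n => ipV Omega (Phi_ n - Phi) (Phi_ n - Phi)) _ c1); exact: homo_cvg_infty.
  have c3 := cutoff_operator_strong_cvg k mO tchi (fun j => L2Phi_ (s j)) L2Phi c2.
  have := weak_strong_pairing H (fun j => L2V (s j))
    (fun j => L2_cutoff k tchi (L2Phi_ (s j))) L2F (L2_cutoff k tchi L2Phi)
    (fun j => VC (s j)) Vw c3.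
  under eq_fun do rewrite V0.
  by move=> c; rewrite -(cvg_unique _ c (cvg_cst 0)).
have [L2B <-] := bilinear_form_ipV k mU UO H1vU.1 H1p.1.
rewrite -F0; apply/esym/eq_ipV; [exact: L2F|exact: L2_graph_ext0 H1vU.1|
  exact: (L2_cutoff k tchi L2Phi)|exact: L2B|].
have := H1_cutoff_eq Omega oU Uoo tchi H1p chi1.
apply: filterS2 Fv => x /[swap] hc /[swap] Ox /(_ Ox) Fx i; rewrite -/U.
(* Off [U] nothing is known here about [F], but both second factors vanish there. *)
have [Ux|Ux] := pselect (U x); last first.
  have [j ->|->] := unliftP ord0 i.
    by rewrite cutoff_operatorS !graphS graph0 !ext0_out// mxE !mulr0 addr0 mulr0.
  by rewrite cutoff_operator0 !graph0 !fctE !ext0_out// scaler0 !mulr0.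
have [cp cD] := hc Ux.
congr (_ * _).
  rewrite Fx -/W ext0_in; last exact: UW.
  by have [j ->|->] := unliftP ord0 i; rewrite ?graphS ?graph0 ext0_in.
have [j ->|->] := unliftP ord0 i.
  by rewrite cutoff_operatorS !graphS graph0 !ext0_in// -[in RHS]cD mxE.
by rewrite cutoff_operator0 !graph0 !fctE !ext0_in// cp.
Qed.

End weak_equation_limit.

(** * Compactness of solutions *)

Section compactness.
Context {R : realType} {N : nat}.
Local Notation T := 'rV[R]_N.
Local Notation mu := (lebesgue_rV R N).
Implicit Types (U W Omega K L : set T) (u v : T -> R) (Du Dv : T -> T).

Lemma ipL2_component_le m (D : set T) (F : T -> 'rV[R]_m) i :
  ipL2 mu (component D F i) (component D F i) <= ipV D F F.
Proof. by rewrite /ipV (bigD1 i)//= lerDl sumr_ge0// => j _; exact: ipL2_ge0. Qed.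

Lemma ipL2r0 (f : T -> R) : ipL2 mu f (cst 0) = 0.
Proof.
by rewrite /ipL2; under eq_Rintegral do rewrite mulr0; rewrite /Rintegral integral0.
Qed.

(** The pair (z, 0). Pairing with it sees only the component of order zero, so that weak convergence
    of pairs yields weak convergence of functions. *)
Definition scalar_graph (z : T -> R) : T -> 'rV[R]_N.+1 := graph z (cst 0).

Lemma component_scalar_graph0 Omega z : component Omega (scalar_graph z) ord0 = ext0 Omega z.
Proof. by congr ext0; apply/funext => x; rewrite graph0. Qed.

Lemma component_scalar_graphS Omega z i :
  component Omega (scalar_graph z) (lift ord0 i) = cst 0.
Proof.
apply/funext => x; have [Ox|Ox] := pselect (Omega x).
  by rewrite component_in// graphS mxE.
by rewrite component_out.
Qed.

Lemma L2_scalar_graph Omega z : L2fun mu (ext0 Omega z) -> L2 Omega (scalar_graph z).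
Proof.
move=> L2z i; rewrite -/(component Omega (scalar_graph z) i).
have [j ->|->] := unliftP ord0 i; last by rewrite component_scalar_graph0.
by rewrite component_scalar_graphS; exact: L2fun0.
Qed.

Lemma ipV_scalar_graph Omega (F : T -> 'rV[R]_N.+1) z :
  ipV Omega F (scalar_graph z) = ipL2 mu (component Omega F ord0) z.
Proof.
rewrite ipV_graphE component_scalar_graph0 big1 ?addr0.
  rewrite /ipL2; apply: eq_Rintegral => x _.
  have [Ox|Ox] := pselect (Omega x); first by rewrite ext0_in.
  by rewrite component_out// !mul0r.
by move=> i _; rewrite component_scalar_graphS ipL2r0.
Qed.

Lemma ext0_indic (A B : set T) : A `<=` B -> ext0 B \1_A = \1_A :> (T -> R).
Proof.
move=> AB; apply/funext => x; have [Bx|Bx] := pselect (B x); first by rewrite ext0_in.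
by rewrite ext0_out// indicE memNset// => /AB.
Qed.

Lemma indic_H1_subspace Omega L : open Omega -> bounded_set Omega -> closed L ->
  H1_subspace Omega L (scalar_graph \1_(Omega `\` L)).
Proof.
move=> oO bO cL; have oW : open (Omega `\` L) by apply: openI => //; exact: closed_openC.
have bW : bounded_set (Omega `\` L) by apply: sub_boundedr bO => A AO x [Ox _]; exact: AO.
have mW := measurable_mx_open oW.
split.
  apply: L2_scalar_graph; rewrite ext0_indic; last exact: subDsetl.
  by apply: L2fun_indic => //; exact: bounded_lebesgue_lty.
exists (cst 1), (cst 0); split; first exact: H1_cst1.
apply: aeW => x _; rewrite ext0_graph /scalar_graph; congr rV_cons; congr pair.
  rewrite indicE; have [Wx|Wx] := pselect ((Omega `\` L) x).
    by rewrite mem_set// ext0_in.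
  by rewrite memNset// ext0_out.
by have [Wx|Wx] := pselect ((Omega `\` L) x); [rewrite ext0_in|rewrite ext0_out].
Qed.

Lemma integral_Lp_le (p P : R) (f : T -> R) : 0 < p ->
  (Lnorm mu p%:E (EFin \o f) <= P%:E)%E ->
  (\int[mu]_x (`|f x| `^ p)%:E <= (P `^ p)%:E)%E.
Proof.
move=> p0 fP; have P0 : 0 <= P.
  by rewrite -lee_fin; apply: le_trans fP; exact: Lnorm_ge0.
have := poweR_Lnorm mu (EFin \o f) (lt0r_neq0 p0).
rewrite (_ : (\int[mu]_x _)%E = \int[mu]_x (`|f x| `^ p)%:E)%E//.
move=> <-; rewrite -poweR_EFin; apply: gt0_ler_poweR => //; first exact: ltW.
  by rewrite in_itv/= Lnorm_ge0 leey.
by rewrite in_itv/= lee_fin P0 leey.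
Qed.

Lemma H1_normE Omega U u Du : U `<=` Omega ->
  H1_norm U u Du = L2_norm Omega (ext0 U (graph u Du)).
Proof.
move=> UO; rewrite /H1_norm /L2_norm /Lp_norm; congr (fine (Lnorm _ _ (_ \o _))).
apply/funext => x; have [Ux|Ux] := pselect (U x).
  by rewrite !ext0_in//=; [rewrite ext0_in|exact: UO].
rewrite [LHS]ext0_out//; have [Ox|Ox] := pselect (Omega x); last by rewrite ext0_out.
rewrite ext0_in//= ext0_out// /enorm /dot big1 ?sqrtr0// => i _.
by rewrite mxE mul0r.
Qed.

(** Let g be [f] cut down to [B]. Since [f_ n] vanishes on [K_ n], its pairing with g only sees the
    part of g off [K_ n], which tends to 0 in L^2 by dominated convergence; in the limit the squared
    norm of g is 0. *)
Lemma ae0_of_eventually0 (f_ : nat -> T -> R) f (K_ : nat -> set T) (B : set T) (C : R) :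
  measurable B -> (forall n, measurable (K_ n)) ->
  (forall n, L2fun mu (f_ n)) -> L2fun mu f ->
  (forall n, ipL2 mu (f_ n) (f_ n) <= C) ->
  (forall n x, K_ n x -> f_ n x = 0) ->
  (forall x, B x -> \forall n \near \oo, K_ n x) ->
  (forall z, L2fun mu z -> ipL2 mu (f_ n) z @[n --> \oo] --> ipL2 mu f z) ->
  {ae mu, forall x, B x -> f x = 0}.
Proof.
move=> mB mK_ L2f_ L2f fC fK BK fw; have H := hilbert_L2 mu.
pose g := f \_ B; have L2g : L2fun mu g by exact: L2fun_patch.
pose h n := g \_ (~` K_ n).
have L2h n : L2fun mu (h n) by apply: L2fun_patch => //; exact: measurableC.
have hcvg : ipL2 mu (h n) (h n) @[n --> \oo] --> (0 : R).
  have -> : (0 : R) = \int[mu]_x (cst 0 x) by rewrite /Rintegral integral0.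
  apply: (@Rintegral_dominated_cvg _ _ _ mu setT _ (cst 0) (fun x => g x ^+ 2)) => //.
  - move=> n; apply: measurable_funM; exact: L2fun_measurable (L2h n).
  - apply: aeW => x _; apply: cvg_near_cst.
    have [Bx|Bx] := pselect (B x).
      apply: filterS (BK _ Bx) => n Kx.
      by rewrite /h patchE memNset ?mul0r//; apply.
    by apply: nearW => n; rewrite /h /g !patchE (memNset Bx); case: ifP; rewrite ?mul0r.
  - exact: L2fun_sqr.
  move=> n x _; rewrite /h patchE; case: ifP => _; last by rewrite mul0r normr0 sqr_ge0.
  by rewrite -expr2 ger0_norm// sqr_ge0.
have fg n : ipL2 mu (f_ n) g = ipL2 mu (f_ n) (h n).
  apply: eq_Rintegral => x _; rewrite /h patchE; case: ifPn => //.
  by rewrite notin_setE => /contrapT Kx; rewrite fK// !mul0r.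
have fg0 : ipL2 mu (f_ n) g @[n --> \oo] --> (0 : R).
  have c : C * ipL2 mu (h n) (h n) @[n --> \oo] --> (0 : R).
    by rewrite -[X in _ --> X](mulr0 C); exact: cvgMl_tmp.
  apply: squeeze_sqr c => n; rewrite fg.
  apply: le_trans (ip_CauchySchwarz H (L2f_ n) (L2h n)) _.
  by rewrite ler_wpM2r// ipL2_ge0.
have gg : ipL2 mu g g = 0.
  rewrite -(cvg_unique _ (fw _ L2g) fg0) //; apply: eq_Rintegral => x _.
  by rewrite /g patchE; case: ifP => //; rewrite !mulr0.
apply: filterS (ipL2_eq0_ae L2g gg) => x gx Bx.
by move: gx; rewrite /g patchE mem_set.
Qed.

End compactness.

Section limit.
Context {R : realType} {N : nat}.
Local Notation T := 'rV[R]_N.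
Local Notation mu := (lebesgue_rV R N).

(** Common to both alternatives: [L_] is [K_] in the first and the sequence of boundaries in the
    second. Hausdorff convergence enters only through openness of [K \ L], the inclusion of [L] in
    [K], and the eventual behaviour of [L_ n] on compact sets and of [K_ n] at points of [K \ L]. *)
Lemma compactness_of_solutions (Omega K L : set T) (K_ L_ : nat -> set T) (k : R)
    (u_ : nat -> T -> R) (Du_ : nat -> T -> T) (C p C1 : R) :
  open Omega -> bounded_set Omega ->
  (forall n, closed (K_ n)) -> closed K -> (forall n, closed (L_ n)) -> closed L ->
  (forall n, L_ n `<=` K_ n) -> L `<=` K ->
  (forall n, open (K_ n `\` L_ n)) -> open (K `\` L) ->
  (forall S, compact S -> S `&` L = set0 -> \forall n \near \oo, S `&` L_ n = set0) ->
  (forall x, (K `\` L) x -> \forall n \near \oo, K_ n x) ->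
  mosco_H1 Omega L_ L ->
  (forall n, weak_solution Omega (K_ n) k (u_ n) (Du_ n)) ->
  (forall n, L2_norm Omega (ext0 (Omega `\` K_ n) (graph (u_ n) (Du_ n))) <= C) ->
  2 < p -> 0 < C1 ->
  (forall n, (Lp_norm (Omega `\` K_ n) p (u_ n) <=
     (C1 * H1_norm (Omega `\` K_ n) (u_ n) (Du_ n))%:E)%E) ->
  exists (s : nat -> nat) u Du,
    [/\ {homo s : i j / (i < j)%N}, weak_solution Omega K k u Du &
        Lp_norm Omega 2 (ext0 (Omega `\` K_ (s j)) (u_ (s j)) \- ext0 (Omega `\` K) u)
          @[j --> \oo] --> 0%E].
Proof.
move=> oO bO cK_ cK cL_ cL LK_ LK oKL_ oKL farL inK mos hu hC p2 C10 hLp.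
have H := hilbert_L2 mu.
have mO := measurable_mx_open oO; have HV := @hilbert_L2vec R N N.+1 Omega mO.
pose U_ n := Omega `\` K_ n; pose U := Omega `\` K.
pose W_ n := Omega `\` L_ n; pose W := Omega `\` L.
have oU_ n : open (U_ n) by apply: openI => //; exact: closed_openC.
have oU : open U by apply: openI => //; exact: closed_openC.
have oW_ n : open (W_ n) by apply: openI => //; exact: closed_openC.
have oW : open W by apply: openI => //; exact: closed_openC.
have UO_ n : U_ n `<=` Omega by exact: subDsetl.
have WO_ n : W_ n `<=` Omega by exact: subDsetl.
have UW_ n : U_ n `<=` W_ n by move=> x [Ox nK]; split => // /LK_.
have UW : U `<=` W by move=> x [Ox nK]; split => // /LK.
have fin (A : set T) : A `<=` Omega -> measurable A -> (mu A < +oo)%E.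
  move=> AO mA; apply: le_lt_trans (bounded_lebesgue_lty bO mO).
  by apply: le_measure; rewrite ?inE.
have mOL : measurable (Omega `&` L) by apply: measurableI => //; exact: closed_measurable_rV.
have L2ind (A : set T) : A `<=` Omega -> measurable A -> L2fun mu \1_A.
  by move=> AO mA; apply: L2fun_indic => //; exact: fin.
pose f_ n := ext0 (U_ n) (u_ n); pose Df_ n := ext0 (U_ n) (Du_ n).
pose V n := graph (f_ n) (Df_ n).
have H1f n : H1 (W_ n) (f_ n) (Df_ n).
  exact: (H1_zero_extension oO (cK_ n) (cL_ n) (LK_ n) (oKL_ n) (hu n).1).1.
have sV n : H1_subspace Omega (L_ n) (V n).
  exact: (H1_zero_extension oO (cK_ n) (cL_ n) (LK_ n) (oKL_ n) (hu n).1).2.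
have L2V n : L2 Omega (V n) by case: (sV n).
have VC n : ipV Omega (V n) (V n) <= C ^+ 2.
  have := hC n; rewrite ext0_graph (L2_normE (L2V n)).2 => sC.
  rewrite -[leLHS]sqr_sqrtr; last exact: (hilbert_ge0 HV).
  by rewrite lerXn2r// nnegrE ?sqrtr_ge0// (le_trans _ sC)// sqrtr_ge0.
pose I n := scalar_graph (\1_(W_ n) : T -> R).
have sI n : H1_subspace Omega (L_ n) (I n) by exact: indic_H1_subspace.
have L2I n : L2 Omega (I n) by case: (sI n).
have IC n : ipV Omega (I n) (I n) <= ipL2 mu \1_Omega \1_Omega.
  rewrite ipV_scalar_graph component_scalar_graph0 ext0_indic//.
  have mW_ := measurable_mx_open (oW_ n).
  apply: ipL2_le_pointwise; [exact: L2ind|exact: L2ind|move=> x].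
  rewrite !indicE; case: (asboolP (W_ n x)) => Wx; last by rewrite memNset// expr0n sqr_ge0.
  by rewrite !mem_set//; exact: WO_ Wx.
(* Two successive extractions, for the solutions and for the indicators, give both weak limits along
   the same [s]. *)
have [s1 [F [hs1 L2F VF]]] := weak_sequential_compactness HV L2V VC.
have [s2 [G [hs2 L2G IG]]] :=
  weak_sequential_compactness HV (fun j => L2I (s1 j)) (fun j => IC (s1 j)).
pose s := s1 \o s2.
have hs : {homo s : i j / (i < j)%N} by move=> i j /hs2 /hs1.
have {}VF Z : L2 Omega Z -> ipV Omega (V (s j)) Z @[j --> \oo] --> ipV Omega F Z.
  move=> /VF; apply: (cvg_comp s2 (fun j => ipV Omega (V (s1 j)) Z)).
  exact: homo_cvg_infty.
have [_ [v [Dv [H1v Fv]]]] : H1_subspace Omega L F.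
  apply: (mos.1 _ _ _ hs (fun j => sV (s j)) L2F).
  exact: weak_cvg_ipV mO (fun j => L2V (s j)) L2F VF.
have [_ [g [Dg [_ Gg]]]] : H1_subspace Omega L G.
  apply: (mos.1 _ _ _ hs (fun j => sI (s j)) L2G).
  exact: weak_cvg_ipV mO (fun j => L2I (s j)) L2G IG.
(* The limit [G] is 0 almost everywhere on [L]; pairing with the indicator of the part of [L] in
   Omega shows that the measure of Omega \ L_n within [L] tends to 0, and Omega \ K_n is smaller. *)
have bad : ipL2 mu \1_(U_ (s j)) \1_(Omega `&` L) @[j --> \oo] --> (0 : R).
  have L2z : L2 Omega (scalar_graph (\1_(Omega `&` L) : T -> R)).
    by apply: L2_scalar_graph; rewrite ext0_indic; [apply: L2ind => //|]; exact: subIsetl.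
  have := IG _ L2z; have -> : ipV Omega G (scalar_graph \1_(Omega `&` L)) = 0.
    rewrite -(ip0l HV L2z); apply: eq_ipV => //; first exact: hilbert0 HV.
    apply: filterS Gg => x Gx Ox i; rewrite [in RHS]mxE mul0r.
    have [Lx|Lx] := pselect (L x).
      rewrite Gx// ext0_out; last by case.
      by rewrite mxE mul0r.
    have [j ->|->] := unliftP ord0 i; first by rewrite graphS mxE mulr0.
    by rewrite graph0 indicE memNset ?mulr0//; case.
  move=> c; apply: (squeeze_cvgr _ (cvg_cst 0) c); apply: nearW => j.
  rewrite ipV_scalar_graph component_scalar_graph0 ext0_indic//.
  apply/andP; split.
    by apply: Rintegral_ge0 => x _; rewrite mulr_ge0.
  have L2OL : L2fun mu \1_(Omega `&` L) by apply: L2ind => //; exact: subIsetl.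
  have L2U : L2fun mu \1_(U_ (s j)) by apply: L2ind => //; exact: measurable_mx_open.
  have L2W : L2fun mu \1_(W_ (s j)) by apply: L2ind => //; exact: measurable_mx_open.
  apply: le_Rintegral => //; [exact: L2funM_integrable|exact: L2funM_integrable|].
  move=> x _; rewrite ler_wpM2r//.
  rewrite !indicE; case: (asboolP (U_ (s j) x)) => Ux; last by rewrite memNset.
  by rewrite !mem_set//; exact: UW_.
have L2f n : L2fun mu (f_ n).
  by have [/L2_graphP[]] := (hu n).1.
have L2v : L2fun mu (ext0 W v) by have [/L2_graphP[]] := H1v.
have f_W n : ext0 (Omega `\` L_ n) (f_ n) = f_ n by exact: ext0_sub.
have compV n : component Omega (V n) ord0 = f_ n by exact: component_graph0.
have fC n : ipL2 mu (f_ n) (f_ n) <= C ^+ 2.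
  by rewrite -compV; apply: le_trans (VC n); exact: ipL2_component_le.
have fw z : L2fun mu z -> ipL2 mu (f_ (s j)) z @[j --> \oo] --> ipL2 mu (ext0 W v) z.
  move=> L2z; have L2Z : L2 Omega (scalar_graph z).
    by apply: L2_scalar_graph; exact: L2fun_patch.
  have := VF _ L2Z; rewrite ipV_scalar_graph.
  under eq_fun do rewrite ipV_scalar_graph compV.
  rewrite (@ae_eq_ipL2 _ _ _ (ext0 W v))//; first exact: L2_component.
  apply: filterS Fv => x Fx; have [Ox|Ox] := pselect (Omega x).
    by rewrite component_in// Fx// ext0_graph graph0.
  by rewrite component_out// ext0_out//; case.
have strong : ipL2 mu (f_ (s j) - ext0 W v) (f_ (s j) - ext0 W v) @[j --> \oo] --> (0 : R).
  have p0 : 0 < p by apply: lt_trans p2.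
  under eq_fun => j do rewrite -(f_W (s j)).
  apply: (@strong_cvg_of_weak R N Omega L (L_ \o s) (U_ \o s) (f_ \o s) (Df_ \o s) v Dv
    (C ^+ 2) p ((C1 * C) `^ p)) => //=.
  - move=> S cS SL; exact: homo_cvg_infty hs _ (farL S cS SL).
  - by move=> j; exact: H1f.
  - by move=> j; rewrite f_W.
  - move=> j i; apply: le_trans (VC (s j)).
    rewrite (_ : ext0 _ _ = component Omega (V (s j)) (lift ord0 i)).
      exact: ipL2_component_le.
    by rewrite component_graphS// ext0_coord; exact: ext0_sub.
  - by move=> z L2z; under eq_fun do rewrite f_W; exact: fw.
  - by move=> j; exact: measurable_mx_open.
  - by move=> j x nU; rewrite f_W /f_ ext0_out.
  - exact: powR_ge0.
  - move=> j; under eq_integral do rewrite f_W.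
    apply: integral_Lp_le => //; apply: le_trans (hLp (s j)) _.
    rewrite lee_fin ler_wpM2l//; first exact: ltW.
    by rewrite (H1_normE _ _ (UO_ (s j))); exact: hC.
(* The limit obtained so far lives on Omega \ L, whereas the conclusion involves the extension by 0
   from Omega \ K; the two agree because the former vanishes almost everywhere on the part of
   [K \ L] in Omega. *)
have v0 : {ae mu, forall x, ext0 W v x = ext0 U v x}.
  have : {ae mu, forall x, (Omega `&` (K `\` L)) x -> ext0 W v x = 0}.
    apply: (@ae0_of_eventually0 _ _ (f_ \o s) _ (K_ \o s) _ (C ^+ 2)) => //.
    - by apply: measurable_mx_open; exact: openI.
    - by move=> j; apply: closed_measurable_rV; exact: cK_.
    - by move=> j; exact: L2f.
    - by move=> j; exact: fC.
    - by move=> j x Kx; rewrite /= /f_ ext0_out//; case.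
    - by move=> x [_ /inK]; exact: homo_cvg_infty hs _.
  apply: filterS => x h; have [Ux|Ux] := pselect (U x).
    by rewrite !ext0_in//; exact: UW.
  rewrite [RHS]ext0_out//; have [Wx|Wx] := pselect (W x); last by rewrite ext0_out.
  by case: (Wx) => Ox nL; apply: h; split => //; split => //; apply: contrapT => nK; apply: Ux.
exists s, v, Dv; split=> //.
  exact: weak_equation_limit oO bO cK_ cK cL_ cL LK_ LK oKL mos hu hs VC L2F VF H1v Fv.
have L2Uv : L2fun mu (ext0 U v).
  by have [/L2_graphP[]] := H1_restrict oU UW H1v.
have e j : Lp_norm Omega 2 (ext0 (Omega `\` K_ (s j)) (u_ (s j)) \- ext0 (Omega `\` K) v) =
    (Num.sqrt (ipL2 mu (f_ (s j) - ext0 W v) (f_ (s j) - ext0 W v)))%:E.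
  have L2d : L2fun mu (f_ (s j) - ext0 U v) by exact: (hilbertB H).
  have L2d' : L2fun mu (f_ (s j) - ext0 W v) by exact: (hilbertB H).
  have aee : {ae mu, forall x, (f_ (s j) - ext0 U v) x = (f_ (s j) - ext0 W v) x}.
    by apply: filterS v0 => x vx; rewrite !fctE vx.
  rewrite /Lp_norm (_ : ext0 Omega _ = f_ (s j) - ext0 U v); last first.
    apply/funext => x; have [Ox|Ox] := pselect (Omega x); first by rewrite ext0_in.
    by rewrite ext0_out// !fctE /f_ !ext0_out ?subr0// => -[].
  rewrite (@Lnorm2E _ _ _ _ _ (fun x => (f_ (s j) - ext0 U v) x * (f_ (s j) - ext0 U v) x))//.
  - rewrite -/(ipL2 mu (f_ (s j) - ext0 U v) (f_ (s j) - ext0 U v)).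
    by rewrite (ae_eq_ipL2 L2d L2d' L2d aee) (ae_eq_ipL2r L2d' L2d L2d' aee).
  - exact: L2funM_integrable.
under eq_fun do rewrite e.
apply: cvg_EFin; first exact: nearW.
rewrite /= -[X in _ --> X]sqrtr0.
by apply: continuous_cvg strong; exact: sqrt_continuous.
Qed.

End limit.

Theorem proposition2p9 (R : realType) (N : nat) (hN : (2 <= N)%N)
  (k : R) (hk : 0 < k)
  (Omega1 Omega : set 'rV[R]_N)
  (hO1 : open Omega1) (hO1b : bounded_set Omega1)
  (hO : open Omega) (hOb : bounded_set Omega)
  (hO1O : compactly_contained Omega1 Omega)
  (hOlip : lipschitz_boundary Omega)
  (K_ : nat -> set 'rV[R]_N) (K : set 'rV[R]_N)
  (hK_ : forall n, compact (K_ n) /\ K_ n `<=` closure Omega1)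
  (hK : compact K /\ K `<=` closure Omega1)
  (hcvg : hausdorff_cvg K_ K)
  (hmosco :
    mosco_H1 Omega K_ K \/
    exists Kt : set 'rV[R]_N,
      [/\ compact Kt /\ Kt `<=` closure Omega1,
          mosco_H1 Omega (fun n => boundary (K_ n)) Kt &
          hausdorff_cvg (fun n => boundary (K_ n)) Kt])
  (u_ : nat -> 'rV[R]_N -> R) (Du_ : nat -> 'rV[R]_N -> 'rV[R]_N)
  (hu_ : forall n, weak_solution Omega (K_ n) k (u_ n) (Du_ n))
  (hC : exists C : R, forall n,
    L2_norm Omega (ext0 (Omega `\` K_ n) (graph (u_ n) (Du_ n))) <= C)
  (p C1 : R) (hp : 2 < p) (hC1 : 0 < C1)
  (hLp : forall n (u : 'rV[R]_N -> R) (Du : 'rV[R]_N -> 'rV[R]_N),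
    H1 (Omega `\` K_ n) u Du ->
    (Lp_norm (Omega `\` K_ n) p u
       <= (C1 * H1_norm (Omega `\` K_ n) u Du)%:E)%E) :
  exists (s : nat -> nat) (u : 'rV[R]_N -> R) (Du : 'rV[R]_N -> 'rV[R]_N),
    [/\ {homo s : i j / (i < j)%N},
        weak_solution Omega K k u Du &
        Lp_norm Omega 2
          (ext0 (Omega `\` K_ (s j)) (u_ (s j)) \- ext0 (Omega `\` K) u)
          @[j --> \oo] --> 0%E].
Proof.
have cptcl (A : set 'rV[R]_N) : compact A -> closed A.
  by apply: compact_closed; exact: norm_hausdorff.
have cK_ n : closed (K_ n) by apply: cptcl; case: (hK_ n).
have cK : closed K by apply: cptcl; case: hK.
have [C hC'] := hC.
have hLp' n := hLp n _ _ (hu_ n).1.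
case: hmosco => [mos|[Kt [[cptKt _] mos hb]]].
  (* First alternative: with [L = K] the differences are empty. *)
  apply: (@compactness_of_solutions R N Omega K K K_ K_ k u_ Du_ C p C1) => //.
  - by move=> n x.
  - by move=> n; rewrite classical_sets.setDv; exact: open0.
  - by rewrite classical_sets.setDv; exact: open0.
  - by move=> S cS SK; exact: hausdorff_cvg_disjoint hcvg cK cS SK.
  - by move=> x [].
have cKt : closed Kt by exact: cptcl.
(* Second alternative: a closed set minus its boundary is its interior; for the limit sets, openness
   of the difference results from the two Hausdorff convergences together. *)
apply: (@compactness_of_solutions R N Omega K Kt K_ (fun n => boundary (K_ n)) k u_ Du_ C p C1) => //.
- by move=> n; exact: boundary_closed.
- by move=> n; exact: boundary_sub.
- exact: boundary_limit_sub hb.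
- by move=> n; rewrite setD_boundary//; exact: open_interior.
- exact: open_setD_boundary_limit hb.
- by move=> S cS SK; exact: hausdorff_cvg_disjoint hb cKt cS SK.
- by move=> x; exact: eventually_in_boundary_limit hb x.
Qed.
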